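(* Let $\mathbb K$ be a field, let $p(z)$ be a non-constant Hilbert polynomial, and let $\mathbf{Hilb}^{p(z)}_{\mathbb P^n}$ be the Hilbert scheme parameterizing closed subschemes of $\mathbb P^n_{\mathbb K}$ with Hilbert polynomial $p(z)$. The strict complete intersection locus in $\mathbf{Hilb}^{p(z)}_{\mathbb P^n}$ is an open subset.
   Context: A proper ideal in a Noetherian ring is a complete intersection if the minimal number of its generators equals its height. A closed projective scheme in $\mathbb P^n$ defined by a homogeneous ideal $I\subset\mathbb K[x_0,\dots,x_n]$ is a strict (or global) complete intersection if the saturated ideal $I^{sat}$ is a complete intersection. The strict complete intersection locus is the subset of points of the Hilbert scheme corresponding to strict complete intersection schemes, where a point with residue field $\kappa$ corresponds to a closed subscheme of $\mathbb P^n_\kappa$ with Hilbert polynomial $p(z)$. *)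

(* Defs.v *)
From HB Require Import structures.
From mathcomp Require Import all_boot all_order all_algebra.
From mathcomp Require Import mpoly.
From mathcomp Require Import boolp classical_sets topology.

Set Implicit Arguments.
Unset Strict Implicit.
Unset Printing Implicit Defensive.

Import GRing.Theory.
Local Open Scope classical_set_scope.
Local Open Scope ring_scope.

(** * Commutative algebra *)

Section Ideals.
Variable R : comNzRingType.

(* Unlike the library's [idealr], this includes the unit ideal. *)
Definition is_ideal (I : set R) : Prop :=
  [/\ I 0, forall x y, I x -> I y -> I (x + y) & forall a x, I x -> I (a * x)].

Definition ideal_gen (E : set R) : set R :=
  [set x | exists (r : nat) (a e : 'I_r -> R),
     (forall i, E (e i)) /\ x = \sum_(i < r) a i * e i].

Definition generated_by (I : set R) (r : nat) : Prop :=
  exists e : 'I_r -> R, I = ideal_gen (range e).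

Definition min_generators (I : set R) (r : nat) : Prop :=
  generated_by I r /\ forall s, generated_by I s -> (r <= s)%N.

(* There is a chain of primes C 0 < C 1 < ... < C h = Q; the values C i with
   i > h are irrelevant. *)
Definition prime_height_ge (Q : prime_idealr R) (h : nat) : Prop :=
  exists C : nat -> prime_idealr R,
    [set` C h] = [set` Q] /\
    forall i, (i < h)%N -> [set` C i] `<` [set` C i.+1].

(* The least height of a prime containing I is h. *)
Definition has_height (I : set R) (h : nat) : Prop :=
  (forall Q : prime_idealr R, I `<=` [set` Q] -> prime_height_ge Q h) /\
  (exists Q : prime_idealr R, I `<=` [set` Q] /\ ~ prime_height_ge Q h.+1).

Definition complete_intersection (I : set R) : Prop :=
  [/\ is_ideal I, ~ I 1 & exists h, min_generators I h /\ has_height I h].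

End Ideals.

Section Flatness.
Variable A : comNzRingType.

(* \sum_i x i (x) y i = 0 in the tensor product of N and M, that is, every
   bilinear map kills this sum (take for B the universal one). *)
Definition tensor_zero (N M : lmodType A) (r : nat)
    (x : 'I_r -> N) (y : 'I_r -> M) : Prop :=
  forall (P : lmodType A) (B : N -> M -> P),
    (forall u, linear (B u)) -> (forall v, linear (B^~ v)) ->
    \sum_(i < r) B (x i) (y i) = 0.

(* Tensoring with M preserves injectivity. *)
Definition flat (M : lmodType A) : Prop :=
  forall (N N' : lmodType A) (f : {linear N -> N'}), injective f ->
  forall (r : nat) (x : 'I_r -> N) (y : 'I_r -> M),
    tensor_zero (f \o x) y -> tensor_zero x y.

(* M is the quotient S / J. *)
Definition flat_quotient (S : lmodType A) (J : set S) : Prop :=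
  exists (M : lmodType A) (q : {linear S -> M}),
    [/\ flat M, forall v, exists s, q s = v & forall s, q s = 0 <-> J s].

End Flatness.

(** * Spectra and residue fields *)

(* Mathcomp's [prime_idealr] consists of boolean predicates; with the classical
   axioms of [boolp] these are all the prime ideals. *)
Definition Spec (A : comNzRingType) : Type := prime_idealr A.

HB.instance Definition _ (A : comNzRingType) := gen_eqMixin (Spec A).
HB.instance Definition _ (A : comNzRingType) := gen_choiceMixin (Spec A).

Section Zariski.
Variable A : comNzRingType.

Definition Spec_open (U : set (Spec A)) : Prop :=
  exists E : set A, U = [set P : Spec A | exists2 a, E a & a \notin (P : prime_idealr A)].

Lemma Spec_openT : Spec_open setT.
Proof.
exists [set 1]; rewrite eqEsubset; split=> // P _.
by exists 1 => //; rewrite idealr1.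
Qed.

Lemma Spec_openI : setI_closed Spec_open.
Proof.
move=> _ _ [E ->] [F ->].
exists [set z | exists a b, [/\ E a, F b & z = a * b]].
rewrite eqEsubset; split=> P /=.
  move=> [[a Ea aP] [b Fb bP]]; exists (a * b); first by exists a, b.
  by rewrite prime_idealrM negb_or aP.
move=> [_ [a [b [Ea Fb ->]]]]; rewrite prime_idealrM negb_or => /andP[aP bP].
by split; [exists a | exists b].
Qed.

Lemma Spec_open_bigU (I : Type) (f : I -> set (Spec A)) :
  (forall i, Spec_open (f i)) -> Spec_open (\bigcup_i f i).
Proof.
move=> fo; exists [set a | [set P : Spec A | a \notin (P : prime_idealr A)]
                             `<=` \bigcup_i f i].
rewrite eqEsubset; split=> P /=; last by move=> [a]; apply.
move=> [i _ fiP]; have [E fE] := fo i.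
move: (fiP); rewrite fE => -[a Ea aP]; exists a => // Q aQ.
by exists i => //; rewrite fE; exists a.
Qed.

HB.instance Definition _ := isOpenTopological.Build (Spec A)
  Spec_openT Spec_openI Spec_open_bigU.

End Zariski.

(* [residue_dom P] is the domain A / P; the inverses of its units, required by
   [idomainType], are obtained by choice. *)
Section ResidueField.
Variables (A : comNzRingType) (P : prime_idealr A).

Definition residue_dom : Type := {ideal_quot P}.
HB.instance Definition _ := GRing.ComNzRing.on residue_dom.

Definition residue_unit : pred residue_dom := fun x => `[< exists y, y * x = 1 >].
Definition residue_inv (x : residue_dom) : residue_dom :=
  xget x [set y | y * x = 1].

Lemma residue_mulVr : {in residue_unit, left_inverse 1 residue_inv *%R}.
Proof.
move=> x /asboolP ex; rewrite /residue_inv.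
by case: xgetP => // /(_ _) h; case: ex => y /h.
Qed.

Lemma residue_unitP (x y : residue_dom) : y * x = 1 -> residue_unit x.
Proof. by move=> h; apply/asboolP; exists y. Qed.

Lemma residue_invr_out : {in [predC residue_unit], residue_inv =1 id}.
Proof.
move=> x; rewrite inE => /asboolP nex; rewrite /residue_inv.
by case: xgetP => // y _ hy; case: nex; exists y.
Qed.

HB.instance Definition _ := GRing.ComNzRing_hasMulInverse.Build residue_dom
  residue_mulVr residue_unitP residue_invr_out.
HB.instance Definition _ := GRing.ComUnitRing_isIntegral.Build residue_dom
  (@Quotient.rquot_IdomainAxiom A P).

Definition residue_field : fieldType := {fraction residue_dom}.

Definition residue_proj (a : A) : residue_dom := (\pi_({ideal_quot P}) a)%qT.

Lemma residue_proj_zmod : zmod_morphism residue_proj.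
Proof. exact: (@rmorphB A {ideal_quot P} \pi_({ideal_quot P})%qT). Qed.

Lemma residue_proj_monoid : monoid_morphism residue_proj.
Proof.
by split; [exact: (@rmorph1 A {ideal_quot P} \pi_({ideal_quot P})%qT)
          |exact: (@rmorphM A {ideal_quot P} \pi_({ideal_quot P})%qT)].
Qed.

HB.instance Definition _ :=
  GRing.isZmodMorphism.Build A residue_dom residue_proj residue_proj_zmod.
HB.instance Definition _ :=
  GRing.isMonoidMorphism.Build A residue_dom residue_proj residue_proj_monoid.

Definition residue_map : {rmorphism A -> residue_field} :=
  @FracField.tofrac residue_dom \o residue_proj.

End ResidueField.

(** * Closed subschemes of projective space *)

(* A closed subscheme of P^n_A is given by a homogeneous ideal of
   A[x_0, ..., x_n]; two such ideals define the same subscheme if and only if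
   they have the same saturation. *)
Section ProjectiveSubschemes.
Variable n : nat.

Section Ring.
Variable A : comNzRingType.
Implicit Types I J : set {mpoly A[n.+1]}.

Definition homogeneous I : Prop :=
  exists2 E : set {mpoly A[n.+1]},
    (forall f, E f -> exists d, f \is d.-homog) & I = ideal_gen E.

Definition saturation I : set {mpoly A[n.+1]} :=
  [set f | exists k, forall m : 'X_{1..n.+1}, mdeg m = k -> I ('X_[m] * f)].

Definition same_subscheme I J : Prop := saturation I = saturation J.

Definition strict_complete_intersection I : Prop :=
  complete_intersection (saturation I).

(* On the affine chart x_i <> 0, the coordinate ring of the subscheme is
   A[x_0, ..., x_n] / (I, x_i - 1). *)
Definition chart_ideal I (i : 'I_n.+1) : set {mpoly A[n.+1]} :=
  ideal_gen (I `|` [set 'X_i - 1]).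

Definition flat_subscheme I : Prop :=
  forall i, flat_quotient (chart_ideal I i).

End Ring.

Definition base_change (A B : comNzRingType) (phi : {rmorphism A -> B})
    (I : set {mpoly A[n.+1]}) : set {mpoly B[n.+1]} :=
  ideal_gen (map_mpoly phi @` I).

Section Field.
Variable L : fieldType.
Implicit Types I : set {mpoly L[n.+1]}.

(* The degree d component of L[x_0, ..., x_n] / I has dimension r. *)
Definition quotient_dim I (d r : nat) : Prop :=
  exists b : 'I_r -> {mpoly L[n.+1]},
    [/\ forall i, b i \is d.-homog,
        forall f, f \is d.-homog ->
          exists c : 'I_r -> L, I (f - \sum_(i < r) c i *: b i)
      & forall c : 'I_r -> L, I (\sum_(i < r) c i *: b i) -> forall i, c i = 0].

Definition has_hilbert_poly I (p : {poly rat}) : Prop :=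
  exists d0, forall d, (d0 <= d)%N ->
    exists2 r, quotient_dim I d r & p.[d%:R] = r%:R.

End Field.

End ProjectiveSubschemes.

Definition hilbert_polynomial (K : fieldType) (p : {poly rat}) : Prop :=
  exists (N : nat) (I : set {mpoly K[N.+1]}), homogeneous I /\ has_hilbert_poly I p.

(** * The Hilbert scheme *)

(* The Hilbert scheme is given by the functor it represents: [hilb_family n p A]
   is the set of its A-valued points, i.e. flat families over Spec A of closed
   subschemes of P^n with Hilbert polynomial p.  Its underlying space [Hilb] is
   the geometric realization of this functor: it is glued from the spectra of
   all such A along all such families, so that a point is a class of
   field-valued points, two of them being identified when they agree over a
   common extension, and the topology is the final one for the classifying maps
   Spec A -> Hilb.  As the Hilbert scheme is of finite type over K, it is
   covered by spectra of finitely generated K-algebras, and only these A, in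
   the form K[y_1, ..., y_m] / J, are used; all residue fields of Hilb arise
   from them. *)
Record hilb_family (n : nat) (p : {poly rat}) (A : comNzRingType) := HilbFamily {
  fam_ideal : set {mpoly A[n.+1]};
  fam_homogeneous : homogeneous fam_ideal;
  fam_flat : flat_subscheme fam_ideal;
  fam_hilbert : forall P : Spec A,
    has_hilbert_poly (base_change (residue_map P) fam_ideal) p }.

Section FgAlgebra.
Variable K : fieldType.

Record fg_algebra := FgAlgebra {
  fg_nvars : nat;
  fg_relations : idealr {mpoly K[fg_nvars]} }.

Definition fg_ring (A : fg_algebra) : comNzRingType :=
  {ideal_quot (fg_relations A)}.

Definition fg_struct (A : fg_algebra) : {rmorphism K -> fg_ring A} :=
  \pi_({ideal_quot (fg_relations A)})%qT \o @mpolyC (fg_nvars A) K.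

End FgAlgebra.

Coercion fg_ring : fg_algebra >-> GRing.ComNzRing.type.

Section HilbertScheme.
Variables (K : fieldType) (n : nat) (p : {poly rat}).

Record field_point := FieldPoint {
  pt_alg : fg_algebra K;
  pt_family : hilb_family n p pt_alg;
  pt_prime : Spec pt_alg }.

Definition pt_field (x : field_point) : fieldType := residue_field (pt_prime x).

Definition pt_struct (x : field_point) : {rmorphism K -> pt_field x} :=
  residue_map (pt_prime x) \o fg_struct (pt_alg x).

Definition pt_ideal (x : field_point) : set {mpoly (pt_field x)[n.+1]} :=
  base_change (residue_map (pt_prime x)) (fam_ideal (pt_family x)).

Arguments pt_ideal : clear implicits.

Definition equiv_points (x y : field_point) : Prop :=
  exists (L : fieldType)
    (f : {rmorphism pt_field x -> L}) (g : {rmorphism pt_field y -> L}),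
    (forall a, f (pt_struct x a) = g (pt_struct y a)) /\
    same_subscheme (base_change f (pt_ideal x)) (base_change g (pt_ideal y)).

Record Hilb := MkHilb {
  hilb_class : set field_point;
  hilb_classP : exists x, hilb_class = [set y | equiv_points x y] }.

HB.instance Definition _ := gen_eqMixin Hilb.
HB.instance Definition _ := gen_choiceMixin Hilb.

Definition hilb_point (x : field_point) : Hilb :=
  MkHilb (ex_intro (fun z => _ = [set y | equiv_points z y]) x erefl).

Definition classify (A : fg_algebra K) (X : hilb_family n p A) (P : Spec A) : Hilb :=
  hilb_point (FieldPoint X P).

(* The residue field of a point of Hilb is the field of those representatives
   from which every other representative is obtained by extension of scalars. *)
Definition over_residue_field (x : field_point) : Prop :=
  forall y, equiv_points x y ->
  exists f : {rmorphism pt_field x -> pt_field y},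
    (forall a, f (pt_struct x a) = pt_struct y a) /\
    same_subscheme (base_change f (pt_ideal x)) (pt_ideal y).

Definition Hilb_open (U : set Hilb) : Prop :=
  forall (A : fg_algebra K) (X : hilb_family n p A), open (classify X @^-1` U).

Lemma Hilb_openT : Hilb_open setT.
Proof. by move=> A X; rewrite preimage_setT; exact: openT. Qed.

Lemma Hilb_openI : setI_closed Hilb_open.
Proof.
by move=> U V Uo Vo A X; rewrite preimage_setI; apply: openI; [apply: Uo|apply: Vo].
Qed.

Lemma Hilb_open_bigU (J : Type) (f : J -> set Hilb) :
  (forall j, Hilb_open (f j)) -> Hilb_open (\bigcup_j f j).
Proof.
move=> fo A X; rewrite preimage_bigcup; apply: bigcup_open => j _.
exact: fo.
Qed.

HB.instance Definition _ := isOpenTopological.Build Hilb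
  Hilb_openT Hilb_openI Hilb_open_bigU.

Definition strict_ci_locus : set Hilb :=
  [set c | exists x, [/\ hilb_class c x, over_residue_field x
                       & strict_complete_intersection (pt_ideal x)]].

End HilbertScheme.

(* Main.v *)
(* Over a field, a saturated homogeneous ideal is a complete intersection exactly
   when it is generated by a homogeneous regular sequence (Macaulay's unmixedness,
   with dimension measured by the growth of the Hilbert function); this property is
   insensitive to field extensions.  The class of a point of the Hilbert scheme has a
   representative over its residue field: the field generated by the coefficients of
   the reduced standard basis, over which the same basis spans a flat family.  Hence
   it suffices to see that, in a flat family over a Noetherian ring A, the points with
   complete intersection fiber form an open set.  This set contains a neighbourhood of
   each of its points q in the closure of q: generators and a standard basis of the
   fiber spread out, and a sequence whose Hilbert function does not exceed that of a
   regular sequence of the same degrees is regular.  It is also stable under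
   generization: as the Hilbert polynomial is nonconstant, the homogeneous coordinate
   ring of the special complete intersection has depth at least two, and constancy of
   the Hilbert polynomial then lets its generators be lifted to the general fiber. *)

Require Import Defs.
From HB Require Import structures.
From mathcomp Require Import functions.
From mathcomp Require Import all_boot all_order all_algebra.
From mathcomp Require Import mpoly.
From mathcomp Require Import boolp classical_sets topology.

Set Implicit Arguments.
Unset Strict Implicit.
Unset Printing Implicit Defensive.

Import Order.TTheory GRing.Theory.
Local Open Scope classical_set_scope.
Local Open Scope ring_scope.

(** * Ideals and regular sequences *)

(** In low degrees a fiber ideal may jump, so a generator f of the saturated special ideal cannot be
    lifted directly. Only the products x^a f with |a| = t0 lie in degrees where constancy of the
    Hilbert polynomial gives the fiber ideals constant dimension. They are viewed as numerators of
    compatible fractions u_a / x^a. Depth two makes every such family come from one polynomial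
    (vanishing of the first local cohomology); this says that a three-term complex of matrices over
    A is exact in the middle at the special point. Semicontinuity of ranks then lifts the kernel of
    its first map, up to a scalar, to the general point. The definition of a complete intersection
    involves arbitrary primes and arbitrary generators, while the argument is graded. Primes are
    reached through the growth of a Hilbert function filtered by degree, which makes sense for
    inhomogeneous ideals; generators are compared with homogeneous ones by a graded Nakayama
    argument. Field extensions of infinite degree are handled by linear functionals applied to
    coefficients. *)

Lemma Zorn_chains (T : Type) (P : set (set T)) (X0 : set T) : P X0 ->
  (forall F : set (set T), F !=set0 -> F `<=` P -> total_on F subset ->
     P (\bigcup_(X in F) X)) ->
  exists A, [/\ P A, X0 `<=` A & forall B, A `<=` B -> P B -> B = A].
Proof.
(* [Zorn_bigcup] also asks for the union of the empty chain; adjoining the empty set provides it. *)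
move=> PX0 Pch; pose P' X := X = set0 \/ (X0 `<=` X /\ P X).
have [F FP' Ftot|A [PA Amax]] := @Zorn_bigcup T P'.
  have [[X [FX X0X]]|FN] := pselect (exists X, F X /\ (X0 `<=` X /\ P X)); last first.
    left; rewrite -subset0 => x [X FX Xx].
    by have [X0'|h] := FP' X FX; [rewrite X0' in Xx|case: FN; exists X].
  right; split.
    by move=> x X0x; exists X => //; case: X0X => /(_ x X0x).
  pose G := [set Y | F Y /\ (X0 `<=` Y /\ P Y)].
  have -> : \bigcup_(X in F) X = \bigcup_(X in G) X.
    rewrite eqEsubset; split=> x [Y].
      move=> FY Yx; have [Y0|h] := FP' Y FY; first by rewrite Y0 in Yx.
      by exists Y.
    by move=> [FY _] Yx; exists Y.
  apply: Pch; first by exists X.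
    by move=> Y [_ []].
  by move=> Y Z [FY _] [FZ _]; apply: Ftot.
have [A0|[X0A PA']] := PA.
  have X00 : X0 = set0.
    apply: contrapT => X0n; apply: (Amax X0); last by right; split.
    rewrite A0; split=> [x //|h]; apply: X0n.
    by rewrite -subset0.
  exists X0; split=> // B _ PB; apply: contrapT => BX0.
  apply: (Amax B); last by right; rewrite X00; split.
  rewrite A0; split=> [x //|h]; apply: BX0.
  by rewrite X00 -subset0.
exists A; split=> // B AB PB; apply: contrapT => BA.
apply: (Amax B); last by right; split=> //; exact: subset_trans AB.
by split=> // BA'; apply: BA; rewrite eqEsubset.
Qed.

Section IdealTheory.
Variable R : comNzRingType.
Implicit Types (I J : set R) (f g x y : R) (fs gs : seq R).

Section Closure.
Variables (I : set R) (idI : is_ideal I).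

Lemma ideal0 : I 0. Proof. by case: idI. Qed.

Lemma idealD x y : I x -> I y -> I (x + y).
Proof. by case: idI => _ + _; apply. Qed.

Lemma ideal_mull a x : I x -> I (a * x).
Proof. by case: idI => _ _; apply. Qed.

Lemma ideal_mulr x a : I x -> I (x * a).
Proof. by move=> Ix; rewrite mulrC; apply: ideal_mull. Qed.

Lemma idealN x : I x -> I (- x).
Proof. by rewrite -mulN1r; apply: ideal_mull. Qed.

Lemma idealB x y : I x -> I y -> I (x - y).
Proof. by move=> Ix Iy; apply: idealD => //; apply: idealN. Qed.

Lemma ideal_sum (T : Type) (r : seq T) (P : pred T) (F : T -> R) :
  (forall i, P i -> I (F i)) -> I (\sum_(i <- r | P i) F i).
Proof. by move=> IF; apply: big_ind => //; [exact: ideal0|exact: idealD]. Qed.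

Lemma ideal_sum_seq (T : eqType) (r : seq T) (F : T -> R) :
  (forall i, i \in r -> I (F i)) -> I (\sum_(i <- r) F i).
Proof. by move=> IF; rewrite big_seq; apply: ideal_sum. Qed.

Lemma idealDr x y : I x -> I (x + y) -> I y.
Proof. by move=> Ix /idealB /(_ Ix); rewrite addrC addKr. Qed.

End Closure.

Lemma ideal_gen_sub (E : set R) : E `<=` ideal_gen E.
Proof.
by move=> x Ex; exists 1%N, (fun=> 1), (fun=> x); split=> //; rewrite big_ord1 mul1r.
Qed.

Lemma ideal_gen_ideal (E : set R) : is_ideal (ideal_gen E).
Proof.
split.
- by exists 0%N, (fun=> 0), (fun=> 0); split; [case|rewrite big_ord0].
- move=> x y [r [a [e [Ee ->]]]] [s [b [e' [Ee' ->]]]].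
  exists (r + s)%N, (fun i => match split i with inl j => a j | inr j => b j end),
    (fun i => match split i with inl j => e j | inr j => e' j end); split.
    by move=> i; case: splitP.
  rewrite big_split_ord /=; congr (_ + _); apply: eq_bigr => i _.
    by case: splitP => j /= ij; [congr (a _ * e _); apply/val_inj
      |by have := ltn_ord i; rewrite ij ltnNge leq_addr].
  case: splitP => j /= ij; first by have := ltn_ord j; rewrite -ij ltnNge leq_addr.
  by have /val_inj <- : val i = val j by apply/eqP; rewrite -(eqn_add2l r) -ij.
- move=> c x [r [a [e [Ee ->]]]]; exists r, (fun i => c * a i), e; split=> //.
  by rewrite mulr_sumr; apply: eq_bigr => i _; rewrite mulrA.
Qed.

Lemma ideal_gen_min (E I : set R) : is_ideal I -> E `<=` I -> ideal_gen E `<=` I.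
Proof.
move=> idI EI x [r [a [e [Ee ->]]]]; apply: ideal_sum => // i _.
by apply: ideal_mull => //; apply: EI.
Qed.

Lemma ideal_gen_id I : is_ideal I -> ideal_gen I = I.
Proof.
by move=> idI; rewrite eqEsubset; split; [exact: ideal_gen_min|exact: ideal_gen_sub].
Qed.

Definition add_gen I f : set R := [set x | exists i a, I i /\ x = i + a * f].

Definition gens_over I fs : set R := foldl add_gen I fs.

Definition gens fs : set R := gens_over [set 0] fs.

Definition colon I g : set R := [set x | I (x * g)].

Definition regular_mod I f : Prop := forall g, I (f * g) -> I g.

(** Weak regularity: the final quotient may be zero. Where properness matters it comes from the
    positive degrees of the elements ([gens_proper]). *)
Fixpoint regular_seq I fs : Prop :=
  if fs is f :: fs' then regular_mod I f /\ regular_seq (add_gen I f) fs' else True.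

Lemma ideal_zero : is_ideal [set (0 : R)].
Proof.
by split=> [//|x y -> ->|a x ->] /=; rewrite ?addr0 ?mulr0.
Qed.

Lemma colon_ideal I g : is_ideal I -> is_ideal (colon I g).
Proof.
move=> idI; split; rewrite /colon /=.
- by rewrite mul0r; apply: ideal0.
- by move=> x y Ix Iy; rewrite mulrDl; apply: idealD.
- by move=> a x Ix; rewrite -mulrA; apply: ideal_mull.
Qed.

Lemma sub_colon I g : is_ideal I -> I `<=` colon I g.
Proof. by move=> idI x Ix; apply: ideal_mulr. Qed.

Lemma add_gen_ideal I f : is_ideal I -> is_ideal (add_gen I f).
Proof.
move=> idI; split.
- by exists 0, 0; rewrite mul0r addr0; split=> //; apply: ideal0.
- move=> _ _ [i [a [Ii ->]]] [j [b [Ij ->]]]; exists (i + j), (a + b).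
  by split; [apply: idealD|rewrite mulrDl addrACA].
- move=> c _ [i [a [Ii ->]]]; exists (c * i), (c * a).
  by split; [apply: ideal_mull|rewrite mulrDr mulrA].
Qed.

Lemma add_gen_sub I f : I `<=` add_gen I f.
Proof. by move=> x Ix; exists x, 0; rewrite mul0r addr0. Qed.

Lemma add_gen_mul I f a : is_ideal I -> add_gen I f (a * f).
Proof. by move=> idI; exists 0, a; rewrite add0r; split=> //; apply: ideal0. Qed.

Lemma add_gen_mem I f : is_ideal I -> add_gen I f f.
Proof. by move=> idI; rewrite -[X in _ X]mul1r; apply: add_gen_mul. Qed.

Lemma add_gen_min I f J : is_ideal J -> I `<=` J -> J f -> add_gen I f `<=` J.
Proof.
move=> idJ IJ Jf _ [i [a [Ii ->]]]; apply: idealD => //; first exact: IJ.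
exact: ideal_mull.
Qed.

Lemma add_genC I f g : add_gen (add_gen I f) g = add_gen (add_gen I g) f.
Proof.
rewrite eqEsubset; split=> _ [_ [b [[i [a [Ii ->]]] ->]]].
  by rewrite addrAC; exists (i + b * g), a; split=> //; exists i, b.
by rewrite addrAC; exists (i + b * f), a; split=> //; exists i, b.
Qed.

Lemma gens_over_ideal I fs : is_ideal I -> is_ideal (gens_over I fs).
Proof. by elim: fs I => //= f fs IH I idI; apply/IH/add_gen_ideal. Qed.

Lemma gens_over_sub I fs : I `<=` gens_over I fs.
Proof.
elim: fs I => [|f fs IH] I //=; apply: subset_trans (IH _); exact: add_gen_sub.
Qed.

Lemma gens_over_mem I fs f : is_ideal I -> f \in fs -> gens_over I fs f.
Proof.
elim: fs I => //= g fs IH I idI; rewrite inE => /predU1P[->|ffs].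
  by apply: gens_over_sub; apply: add_gen_mem.
by apply: IH => //; apply: add_gen_ideal.
Qed.

Lemma gens_over_min I fs J : is_ideal J -> I `<=` J ->
  (forall f, f \in fs -> J f) -> gens_over I fs `<=` J.
Proof.
move=> idJ; elim: fs I => //= f fs IH I IJ Jfs; apply: IH.
  by apply: add_gen_min => //; apply: Jfs; rewrite mem_head.
by move=> g gfs; apply: Jfs; rewrite inE gfs orbT.
Qed.

Lemma gens_over_cat I fs gs : gens_over I (fs ++ gs) = gens_over (gens_over I fs) gs.
Proof. exact: foldl_cat. Qed.

Lemma gens_over_rcons I fs f : gens_over I (rcons fs f) = add_gen (gens_over I fs) f.
Proof. by rewrite -cats1 gens_over_cat. Qed.

Lemma gens_ideal fs : is_ideal (gens fs).
Proof. exact/gens_over_ideal/ideal_zero. Qed.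

Lemma gens_mem fs f : f \in fs -> gens fs f.
Proof. exact/gens_over_mem/ideal_zero. Qed.

Lemma gens_min fs I : is_ideal I -> (forall f, f \in fs -> I f) -> gens fs `<=` I.
Proof. by move=> idI Ifs; apply: gens_over_min => // x ->; apply: ideal0. Qed.

Lemma gens_subset fs gs : {subset fs <= gs} -> gens fs `<=` gens gs.
Proof.
move=> fg; apply: gens_min => [|f ffs]; first exact: gens_ideal.
by apply: gens_mem; apply: fg.
Qed.

Lemma gens_genE fs : gens fs = ideal_gen [set f | f \in fs].
Proof.
rewrite eqEsubset; split.
  by apply: gens_min => [|f ffs]; [exact: ideal_gen_ideal|exact: ideal_gen_sub].
by apply: ideal_gen_min => [|f]; [exact: gens_ideal|exact: gens_mem].
Qed.

Lemma gens_range r (e : 'I_r -> R) : ideal_gen (range e) = gens [seq e i | i : 'I_r].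
Proof.
rewrite gens_genE; congr ideal_gen; rewrite eqEsubset; split=> x.
  by move=> [i _ <-] /=; apply/mapP; exists i => //; rewrite mem_enum.
by move=> /= /mapP[i _ ->]; exists i.
Qed.

Lemma generated_by_gens fs : generated_by (gens fs) (size fs).
Proof.
exists (fun i => fs`_i); rewrite gens_genE; congr ideal_gen.
rewrite eqEsubset; split=> x /=.
  move=> xfs; have h : (index x fs < size fs)%N by rewrite index_mem.
  by exists (Ordinal h) => //=; rewrite nth_index.
by move=> [i _ <-]; rewrite mem_nth.
Qed.

Lemma gens_over_lin I fs x : gens_over I fs x ->
  exists2 y, I y & exists a : 'I_(size fs) -> R, x = y + \sum_i a i * fs`_i.
Proof.
elim: fs I x => [|f fs IH] I x /=.
  by exists x => //; exists (fun=> 0); rewrite big_ord0 addr0.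
move=> /IH[_ [i [b [Ii ->]]] [a ->]]; exists i => //.
exists (fun j => oapp a b (unlift ord0 j)).
rewrite big_ord_recl unlift_none /= addrA; congr (_ + _).
by apply: eq_bigr => j _; rewrite liftK.
Qed.

Lemma gens_lin fs x : gens fs x ->
  exists a : 'I_(size fs) -> R, x = \sum_i a i * fs`_i.
Proof. by move=> /gens_over_lin[y -> [a ->]]; exists a; rewrite add0r. Qed.

Lemma regular_seq_cat I fs gs :
  regular_seq I (fs ++ gs) <-> regular_seq I fs /\ regular_seq (gens_over I fs) gs.
Proof.
elim: fs I => [|f fs IH] I /=; first by split=> // -[].
by rewrite IH; split=> [[? []]|[[]]].
Qed.

Lemma regular_modX I f b : regular_mod I f -> regular_mod I (f ^+ b).
Proof.
move=> fr; elim: b => [|b IH] g; first by rewrite expr0 mul1r.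
by rewrite exprS -mulrA => /fr/IH.
Qed.

(* In general only this half of a permutation of a regular sequence stays
   regular; the other half needs a grading. *)
Lemma regular_mod_swap I x y : is_ideal I ->
  regular_mod I x -> regular_mod (add_gen I x) y -> regular_mod (add_gen I y) x.
Proof.
move=> idI xr yr g [i [h [Ii xg]]].
have /yr[i' [h' [Ii' hE]]] : add_gen I x (y * h).
  exists (- i), g; split; first exact: idealN.
  by rewrite [g * x]mulrC xg addKr mulrC.
suff Ig : I (g - y * h').
  by exists (g - y * h'), h'; rewrite [h' * y]mulrC subrK.
apply: xr; rewrite mulrBr xg hE.
have -> : i + (i' + h' * x) * y - x * (y * h') = i + i' * y.
  by rewrite mulrDl addrA -[h' * x * y]mulrA [h' * _]mulrC -mulrA addrK.
by apply: idealD => //; apply: ideal_mulr.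
Qed.

Lemma regular_mod_colon I f g : regular_mod I f -> regular_mod (colon I g) f.
Proof. by move=> fr x; rewrite /colon /= -mulrA => /fr. Qed.

End IdealTheory.

(** * Prime ideals and heights *)

Section PrimeIdeals.
Variable R : comNzRingType.
Implicit Types (I : set R) (Q : prime_idealr R).

Definition prime_set I : Prop :=
  [/\ is_ideal I, ~ I 1 & forall x y, I (x * y) -> I x \/ I y].

Section MkPrime.
Variables (I : set R) (pI : prime_set I).

(** The proof is an explicit argument so that the instances below, which rely on it, can be attached
    to this predicate. *)
Definition prime_pred (pI : prime_set I) (x : R) : bool := `[< I x >].

Lemma prime_pred_zmod : zmod_closed (prime_pred pI).
Proof.
have [idI _ _] := pI; split; first exact/asboolP/(ideal0 idI).
by move=> x y /asboolP Ix /asboolP Iy; apply/asboolP; apply: (idealB idI).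
Qed.

Lemma prime_pred_proper : ring_quotient.proper_ideal (prime_pred pI).
Proof.
have [idI I1 _] := pI; split; first by apply/asboolPn.
by move=> a x /asboolP Ix; apply/asboolP; apply: (ideal_mull idI).
Qed.

Lemma prime_pred_prime : prime_idealr_closed (prime_pred pI).
Proof.
have [_ _ Ip] := pI.
by move=> x y /asboolP/Ip[] /asboolP h; apply/orP; [left|right].
Qed.

HB.instance Definition _ := GRing.isZmodClosed.Build R (prime_pred pI) prime_pred_zmod.
HB.instance Definition _ := isProperIdeal.Build R (prime_pred pI) prime_pred_proper.
HB.instance Definition _ :=
  isPrimeIdealrClosed.Build R (prime_pred pI) prime_pred_prime.

Definition mk_prime : prime_idealr R := prime_pred pI.

Lemma mk_primeE : [set` mk_prime] = I.
Proof. by rewrite eqEsubset; split=> x /= /asboolP. Qed.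

End MkPrime.

Lemma prime_setP Q : prime_set [set` Q].
Proof.
split; first split.
- exact: idealr0.
- by move=> x y; apply: rpredD.
- by move=> a x; apply: idealMr.
- by rewrite /= idealr1.
- by move=> x y /=; rewrite prime_idealrM => /orP.
Qed.

(** An ideal maximal among those that contain [I] and miss [M] is prime: for x and y outside it, the
    ideals enlarged by x and by y both meet [M], and the product of the two elements found would lie
    in the ideal if x y did. *)
Lemma prime_avoiding I (M : set R) : is_ideal I -> M 1 ->
  (forall x y, M x -> M y -> M (x * y)) -> (forall x, I x -> ~ M x) ->
  exists Q, I `<=` [set` Q] /\ forall x, x \in Q -> ~ M x.
Proof.
move=> idI M1 MM IM.
pose P X := is_ideal X /\ forall x, X x -> ~ M x.
have [|F [X0 FX0] FP Ftot|A [[idA AM] IA Amax]] := @Zorn_chains R P I; first by split.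
  split; last by move=> x [X FX]; apply: (FP X FX).2.
  split.
  - by exists X0 => //; apply: ideal0; case: (FP _ FX0).
  - move=> x y [X FX Xx] [Y FY Yy].
    have [XY|YX] := Ftot _ _ FX FY.
      by exists Y => //; apply: idealD => //; [case: (FP _ FY)|apply: XY].
    by exists X => //; apply: idealD => //; [case: (FP _ FX)|apply: YX].
  - by move=> a x [X FX Xx]; exists X => //; apply: ideal_mull => //; case: (FP _ FX).
have out x : ~ A x -> exists2 s, add_gen A x s & M s.
  move=> Ax; apply: contrapT => h; apply: Ax.
  rewrite -(Amax (add_gen A x)); first exact: add_gen_mem.
    exact: add_gen_sub.
  split; first exact: add_gen_ideal.
  by move=> s As Ms; apply: h; exists s.
have pA : prime_set A.
  split=> // [A1|x y Axy]; first exact: AM A1 M1.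
  apply: contrapT => /not_orP[/out[_ [i [a [Ai ->]]] M1'] /out[_ [j [b [Aj ->]]] M2]].
  apply: AM (MM _ _ M1' M2); rewrite mulrDl !mulrDr; apply: idealD => //.
    by apply: idealD => //; [apply: ideal_mulr|apply: ideal_mulr].
  apply: idealD => //; first exact: ideal_mull.
  by rewrite mulrACA; apply: ideal_mull.
exists (mk_prime pA); split.
  by rewrite mk_primeE.
by move=> x xA; apply: AM; rewrite -(mk_primeE pA).
Qed.

(** Regularity of [f] keeps the products s f^k with s outside [Q] out of [I], and a prime missing
    them all lies in [Q] without containing [f]. If [f] is in [Q] the inclusion is strict, which
    lengthens a chain of primes by one. *)
Lemma prime_below I Q f : is_ideal I -> I `<=` [set` Q] -> regular_mod I f ->
  exists Q' : prime_idealr R, [/\ I `<=` [set` Q'], [set` Q'] `<=` [set` Q] & f \notin Q'].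
Proof.
move=> idI IQ fr.
pose M := [set x | exists s k, s \notin Q /\ x = s * f ^+ k].
have [||x Ix [s [k [sQ xE]]]|Q' [IQ' Q'M]] := prime_avoiding idI (M := M).
- by exists 1, 0%N; rewrite idealr1 mulr1.
- move=> _ _ [s [k [sQ ->]]] [t [l [tQ ->]]]; exists (s * t), (k + l)%N.
  by rewrite prime_idealrM negb_or sQ tQ exprD mulrACA.
- move: Ix; rewrite xE mulrC => /(regular_modX fr)/IQ /=.
  by rewrite (negbTE sQ).
exists Q'; split=> //.
  move=> x xQ' /=; apply: contrapT => /negP xQ.
  by apply: (Q'M x xQ'); exists x, 0%N; rewrite expr0 mulr1.
by apply/negP => /Q'M; apply; exists 1, 1%N; rewrite idealr1 expr1 mul1r.
Qed.

Lemma prime_height_regular fs Q : regular_seq [set 0] fs -> gens fs `<=` [set` Q] ->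
  prime_height_ge Q (size fs).
Proof.
elim/last_ind: fs Q => [|fs f IH] Q; first by exists (fun=> Q).
rewrite -cats1 regular_seq_cat /= => -[fsr [fr _]]; rewrite /gens gens_over_cat /= => fQ.
have [|Q' [fsQ' Q'Q fQ']] := @prime_below (gens fs) Q f (gens_ideal fs) _ fr.
  by apply: subset_trans fQ; apply: add_gen_sub.
have [C [CQ' Cinc]] := IH Q' fsr fsQ'.
rewrite size_cat addn1.
exists (fun i => if (i <= size fs)%N then C i else Q); rewrite ltnn; split=> // i.
rewrite ltnS => ile; rewrite ile; move: ile.
rewrite leq_eqVlt => /predU1P[->|iltn]; last first.
  by rewrite iltn; apply: Cinc.
rewrite ltnn CQ'; split=> // QQ'.
have /QQ' /= : [set` Q] f by apply: fQ; apply: add_gen_mem; apply: gens_ideal.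
by rewrite (negbTE fQ').
Qed.

End PrimeIdeals.

(** * Homogeneous ideals and standard bases *)

Section Noetherian.
Variable R : comNzRingType.

Definition noetherian : Prop :=
  forall I : set R, is_ideal I -> exists fs, I = gens fs.

Hypothesis noethR : noetherian.

(** The union of a chain is finitely generated and its generators already lie in one member, so the
    union is that member. *)
Lemma noetherian_max (P : set (set R)) (I0 : set R) : P I0 -> P `<=` @is_ideal R ->
  exists A, [/\ P A, I0 `<=` A & forall B, A `<=` B -> P B -> B = A].
Proof.
move=> PI0 Pid; apply: Zorn_chains => // F [X0 FX0] FP Ftot.
set U := \bigcup_(X in F) X.
have up (fs : seq R) : (forall f, f \in fs -> U f) -> exists2 X, F X & forall f, f \in fs -> X f.
  elim: fs => [|f fs IH] Ufs; first by exists X0.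
  have [|X FX Xfs] := IH; first by move=> g gfs; apply: Ufs; rewrite inE gfs orbT.
  have [Y FY Yf] := Ufs f (mem_head _ _).
  have [XY|YX] := Ftot _ _ FX FY.
    by exists Y => // g; rewrite inE => /predU1P[->//|/Xfs/XY].
  by exists X => // g; rewrite inE => /predU1P[->|/Xfs//]; apply: YX.
have idU : is_ideal U.
  split; first by exists X0 => //; apply: ideal0; apply/Pid/FP.
    move=> x y Ux Uy; have [|X FX Xxy] := up [:: x; y].
      by move=> f; rewrite !inE => /pred2P[] ->.
    exists X => //; apply: idealD; first exact/Pid/FP.
      by apply: Xxy; rewrite mem_head.
    by apply: Xxy; rewrite !inE eqxx orbT.
  by move=> a x [X FX Xx]; exists X => //; apply: ideal_mull => //; apply/Pid/FP.
have [fs UE] := noethR idU.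
have [|X FX Xfs] := up fs; first by move=> f ffs; rewrite UE; apply: gens_mem.
suff -> : U = X by apply: FP.
rewrite eqEsubset; split; last by move=> x Xx; exists X.
by rewrite UE; apply: gens_min => //; apply/Pid/FP.
Qed.

Lemma noetherian_subset (E : set R) :
  exists fs : seq R, (forall f, f \in fs -> E f) /\ ideal_gen E = gens fs.
Proof.
have [gs gsE] := noethR (ideal_gen_ideal E).
suff [fs [fsE gfs]] : exists fs : seq R, (forall f, f \in fs -> E f) /\
    (forall g, g \in gs -> gens fs g).
  exists fs; split=> //; rewrite eqEsubset; split.
    by rewrite gsE; apply: gens_min => //; apply: gens_ideal.
  apply: gens_min => [|f ffs]; first exact: ideal_gen_ideal.
  exact/ideal_gen_sub/fsE.
have : forall g, g \in gs -> ideal_gen E g by move=> g; rewrite gsE; apply: gens_mem.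
elim: gs {gsE} => [|g gs IH] gE; first by exists [::].
have [|fs [fsE gfs]] := IH; first by move=> h hgs; apply: gE; rewrite inE hgs orbT.
have [r [a [e [Ee ->]]]] := gE g (mem_head _ _).
exists ([seq e i | i : 'I_r] ++ fs); split.
  by move=> f; rewrite mem_cat => /orP[/mapP[i _ ->]|/fsE].
move=> h; rewrite inE => /predU1P[->|/gfs].
  apply: ideal_sum => [|i _]; first exact: gens_ideal.
  apply: ideal_mull; first exact: gens_ideal.
  by apply: gens_mem; rewrite mem_cat map_f ?mem_enum.
by apply: gens_subset => f ffs; rewrite mem_cat ffs orbT.
Qed.

End Noetherian.

(** * Monomials *)

Section Monomials.
Variable N : nat.
Implicit Types (m b : 'X_{1..N}) (B : seq 'X_{1..N}).

(** Dickson's lemma, by induction on the number [j] of coordinates compared. Beyond the largest new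
    coordinate [c] occurring in a basis for [j], that basis still works; below [c], each value of
    the new coordinate gets a basis of its own. *)
Lemma dickson (M : set 'X_{1..N}) :
  exists B, (forall b, b \in B -> M b) /\
            forall m, M m -> exists2 b, b \in B & (b <= m)%MM.
Proof.
have coord (j : nat) : exists B, (forall b, b \in B -> M b) /\
    forall m, M m -> exists2 b, b \in B & forall i : 'I_N, (i < j)%N -> (b i <= m i)%N.
  elim: j M => [|j IH] M.
    have [[m Mm]|h] := pselect (M !=set0).
      by exists [:: m]; split=> [b|m' _]; [rewrite inE => /eqP->|exists m; rewrite ?mem_head].
    by exists [::]; split=> // m Mm; case: h; exists m.
  have [jN|jN] := ltnP j N; last first.
    have [B [BM MB]] := IH M; exists B; split=> // m /MB[b bB bm]; exists b => // i _.
    by apply: bm; apply: leq_trans (ltn_ord i) jN.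
  pose j' := Ordinal jN.
  have [B [BM MB]] := IH M; pose c := (\max_(b <- B) b j')%N.
  have /choice[Bv BvP] := fun v => IH [set m | M m /\ m j' = v].
  exists (B ++ flatten [seq Bv v | v <- iota 0 c]); split.
    move=> b; rewrite mem_cat => /orP[/BM//|/flattenP[_ /mapP[v _ ->]]].
    by move=> /(proj1 (BvP v))[].
  move=> m Mm; have [mc|cm] := ltnP (m j') c.
    have [b bB bm] := (BvP (m j')).2 m (conj Mm erefl).
    exists b => [|i].
      rewrite mem_cat; apply/orP; right; apply/flattenP; exists (Bv (m j')) => //.
      by apply: map_f; rewrite mem_iota.
    rewrite ltnS leq_eqVlt => /predU1P[ij|]; last exact: bm.
    have -> : i = j' by apply/val_inj.
    by have [_ ->] := (BvP (m j')).1 b bB.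
  have [b bB bm] := MB m Mm; exists b; first by rewrite mem_cat bB.
  move=> i; rewrite ltnS leq_eqVlt => /predU1P[ij|]; last exact: bm.
  have -> : i = j' by apply/val_inj.
  by apply: leq_trans cm; rewrite /c; apply: (@leq_bigmax_seq _ B predT (fun b => b j')).
have [B [BM MB]] := coord N; exists B; split=> // m /MB[b bB bm].
by exists b => //; apply/mnm_lepP => i; apply: bm.
Qed.

Lemma monomial_splitting m e : (e <= mdeg m)%N ->
  exists a b, [/\ m = (a + b)%MM & mdeg a = e].
Proof.
elim: e => [|e IH] em; first by exists 0%MM, m; rewrite add0m mdeg0.
have [a [b [mE ae]]] := IH (ltnW em).
have /existsP[i bi] : [exists i, b i != 0%N].
  apply: contraLR em; rewrite negb_exists => /forallP b0.
  have -> : m = a by rewrite mE; apply/mnmP => i; rewrite mnmDE (eqP (negbNE (b0 i))) addn0.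
  by rewrite ae ltnn.
exists (a + U_(i))%MM, (b - U_(i))%MM; rewrite mdegD mdeg1 ae addn1; split=> //.
by rewrite -addmA [(U_(i) + _)%MM]addmC submK // lep1mP.
Qed.

Definition standard B m : bool := ~~ has (fun b => (b <= m)%MM) B.

End Monomials.

Section HomogeneousComponents.
Variables (N : nat) (R : comNzRingType).
Implicit Types (f g : {mpoly R[N]}) (m : 'X_{1..N}) (d e : nat) (I J : set {mpoly R[N]}).

Local Notation hc d f := (pihomog mdeg d f).

Lemma mcoeff_pihomog d f m : (hc d f)@_m = if mdeg m == d then f@_m else 0.
Proof.
case: eqP => [md|/eqP md]; last exact: dhomog_nemf_coeff (pihomogP _ _ _) md.
have -> : f@_m = \sum_(i < mmeasure mdeg f) (hc i f)@_m.
  rewrite {1}(pihomog_partitionE (leqnn (mmeasure mdeg f))).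
  exact: (raddf_sum (mcoeff m)).
have [dlt|dge] := ltnP d (mmeasure mdeg f).
  rewrite (bigD1 (Ordinal dlt)) //= big1 ?addr0 // => i id.
  apply: dhomog_nemf_coeff (pihomogP _ _ _) _.
  by rewrite /= md; apply: contraNneq id => di; apply/eqP/val_inj.
rewrite big1 => [|i _].
  rewrite pihomogE raddf_sum /= big1_seq // => m' /andP[/eqP m'd m'f].
  by have := mmeasure_mnm_lt mdeg m'f; rewrite /= m'd ltnNge dge.
apply: dhomog_nemf_coeff (pihomogP _ _ _) _.
by rewrite /= md; apply: contraTneq (ltn_ord i) => <-; rewrite -leqNgt.
Qed.

Lemma pihomog_sumE f D : (msize f <= D)%N -> f = \sum_(d < D) hc d f.
Proof.
move=> fD; apply/mpolyP => m; rewrite raddf_sum /=.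
under eq_bigr do rewrite mcoeff_pihomog.
have [mD|mD] := ltnP (mdeg m) D; last first.
  rewrite big1 => [|i _]; first by apply/memN_msupp_eq0/msize_mdeg_ge/(leq_trans fD).
  by rewrite (_ : _ == _ = false) //; apply/eqP => mi; have := ltn_ord i; rewrite -mi ltnNge mD.
rewrite (bigD1 (Ordinal mD)) //= eqxx big1 ?addr0 // => i im.
by rewrite (_ : _ == _ = false) //; apply: contraNF im => /eqP mi; apply/eqP/val_inj.
Qed.

Lemma pihomog_sum d (T : Type) (r : seq T) (P : pred T) (F : T -> {mpoly R[N]}) :
  hc d (\sum_(i <- r | P i) F i) = \sum_(i <- r | P i) hc d (F i).
Proof. exact: (raddf_sum (pihomog mdeg d)). Qed.

Lemma pihomog_homog d e f : f \is d.-homog -> hc e f = if e == d then f else 0.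
Proof.
move=> fd; apply/mpolyP => m; rewrite mcoeff_pihomog.
have [->|ed] := eqVneq e d.
  by case: eqP => // /eqP md; rewrite (dhomog_nemf_coeff fd).
rewrite mcoeff0; case: eqP => // me; apply: dhomog_nemf_coeff fd _.
by rewrite /= me.
Qed.

Lemma pihomogM d e a f : f \is d.-homog -> hc (e + d) (a * f) = hc e a * f.
Proof.
move=> fd; have aE := pihomog_sumE (leqnn (msize a)).
rewrite {1}aE mulr_suml raddf_sum /=.
under eq_bigr do rewrite (pihomog_homog _ (dhomogM (pihomogP mdeg _ a) fd)) eqn_add2r.
have [elt|ege] := ltnP e (msize a).
  rewrite (bigD1 (Ordinal elt)) //= eqxx big1 ?addr0 // => i ie.
  by rewrite (_ : _ == _ = false) //; apply: contraNF ie => /eqP ei; apply/eqP/val_inj.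
rewrite big1 => [|i _]; last first.
  by rewrite (_ : _ == _ = false) //; apply/eqP => ei; have := ltn_ord i; rewrite -ei ltnNge ege.
rewrite (_ : hc e a = 0) ?mul0r //; apply/mpolyP => m; rewrite mcoeff_pihomog mcoeff0.
by case: eqP => // me; apply/memN_msupp_eq0/msize_mdeg_ge; rewrite me.
Qed.

Lemma pihomogM_lt d t a f : f \is d.-homog -> (t < d)%N -> hc t (a * f) = 0.
Proof.
move=> fd td; have aE := pihomog_sumE (leqnn (msize a)).
rewrite {1}aE mulr_suml raddf_sum /= big1 // => i _.
rewrite (pihomog_homog _ (dhomogM (pihomogP mdeg _ a) fd)).
by rewrite (_ : _ == _ = false) //; apply/eqP => td'; move: td; rewrite td' ltnNge leq_addl.
Qed.

Lemma homog_msize_le d f : f \is d.-homog -> (msize f <= d.+1)%N.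
Proof.
by move=> /dhomogP fd; rewrite msizeE; apply/bigmax_leqP_seq => m /fd -> _.
Qed.

Lemma homogX m : 'X_[m] \is [in R[N], (mdeg m).-homog].
Proof. by rewrite dhomogX. Qed.

(** Closure under components passes easily to colon ideals and saturations, for which no homogeneous
    generators are at hand. *)
Definition hideal I : Prop := is_ideal I /\ forall d f, I f -> I (hc d f).

Lemma hideal_comps I f : is_ideal I ->
  (forall d, I (hc d f)) -> I f.
Proof.
move=> idI If; rewrite (pihomog_sumE (leqnn (msize f))).
by apply: ideal_sum => // i _; apply: If.
Qed.

Lemma hideal_sub I J : hideal I -> is_ideal J ->
  (forall d f, f \is d.-homog -> I f -> J f) -> I `<=` J.
Proof.
move=> [idI hI] idJ IJ f If; apply: hideal_comps => // d.
by apply: (IJ d) (hI _ _ If); apply: pihomogP.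
Qed.

Lemma hideal_zero : hideal [set 0].
Proof. by split=> [|d f ->]; [exact: ideal_zero|rewrite /= raddf0]. Qed.

Lemma hideal_gen (E : set {mpoly R[N]}) :
  (forall f, E f -> exists d, f \is d.-homog) -> hideal (ideal_gen E).
Proof.
move=> Eh; split; first exact: ideal_gen_ideal.
move=> t f [r [a [e [Ee ->]]]]; rewrite raddf_sum /=; apply: ideal_sum.
  exact: ideal_gen_ideal.
move=> i _; have [d ed] := Eh _ (Ee i).
have [td|dt] := ltnP t d.
  by rewrite (pihomogM_lt _ ed) //; apply: ideal0; apply: ideal_gen_ideal.
rewrite -(subnK dt) (pihomogM _ _ ed); apply: ideal_mull; first exact: ideal_gen_ideal.
exact: ideal_gen_sub.
Qed.

Lemma hideal_add I f d : hideal I -> f \is d.-homog -> hideal (add_gen I f).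
Proof.
move=> [idI hI] fd; split; first exact: add_gen_ideal.
move=> t _ [i [a [Ii ->]]]; rewrite raddfD /=.
apply: idealD; [exact: add_gen_ideal|exact/add_gen_sub/hI|].
have [td|dt] := ltnP t d.
  by rewrite (pihomogM_lt _ fd) //; apply: ideal0; apply: add_gen_ideal.
by rewrite -(subnK dt) (pihomogM _ _ fd); apply: add_gen_mul.
Qed.

Lemma hideal_colon I g d : hideal I -> g \is d.-homog -> hideal (colon I g).
Proof.
move=> [idI hI] gd; split; first exact: colon_ideal.
by move=> t f; rewrite /colon /= => /(hI (t + d)%N); rewrite (pihomogM _ _ gd).
Qed.

(** The zero polynomial qualifies, being homogeneous of every degree. *)
Definition hpos f : Prop := exists2 d, (0 < d)%N & f \is d.-homog.

Lemma hideal_gens_over I fs : hideal I ->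
  (forall f, f \in fs -> exists d, f \is d.-homog) -> hideal (gens_over I fs).
Proof.
elim: fs I => //= f fs IH I hI fsh; apply: IH.
  by have [d fd] := fsh f (mem_head _ _); apply: hideal_add fd.
by move=> g gfs; apply: fsh; rewrite inE gfs orbT.
Qed.

Lemma hideal_gens fs : (forall f, f \in fs -> exists d, f \is d.-homog) ->
  hideal (gens fs).
Proof. exact/hideal_gens_over/hideal_zero. Qed.

Lemma hpos_homog f : hpos f -> exists d, f \is d.-homog.
Proof. by move=> [d _ fd]; exists d. Qed.

Lemma hideal_add_proper I f : hideal I -> ~ I 1 -> hpos f -> ~ add_gen I f 1.
Proof.
move=> [idI hI] I1 [d d0 fd] [i [a [Ii E]]]; apply: I1.
have -> : 1 = hc 0 (1 : {mpoly R[N]}) by rewrite (pihomog_homog _ (dhomog1 _ _)).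
by rewrite {1}E raddfD /= (pihomogM_lt _ fd) // addr0; apply: hI.
Qed.

Lemma hideal_gens_over_proper I fs : hideal I -> ~ I 1 ->
  (forall f, f \in fs -> hpos f) -> ~ gens_over I fs 1.
Proof.
elim: fs I => //= f fs IH I hI I1 fsh.
have fp := fsh f (mem_head _ _); apply: IH.
- by have [d _ fd] := fp; apply: hideal_add fd.
- exact: hideal_add_proper.
- by move=> g gfs; apply: fsh; rewrite inE gfs orbT.
Qed.

End HomogeneousComponents.

Notation hc d f := (pihomog mdeg d f).

(** * Division by monic polynomials *)

Section Division.
Variables (N : nat) (R : comNzRingType) (B : seq 'X_{1..N}) (G : 'X_{1..N} -> {mpoly R[N]}).
Variable J : set {mpoly R[N]}.
Hypothesis idJ : is_ideal J.
Hypothesis JG : forall b, b \in B -> J (G b).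
Hypothesis G1 : forall b, b \in B -> (G b)@_b = 1.
Hypothesis Gle : forall b m, b \in B -> m \in msupp (G b) -> (m <= b)%O.

(** Well-founded induction on the monomial order: subtracting a multiple of some [G b] cancels the
    leading term. Leading coefficients equal to 1 make this work over any ring, as families
    require. *)
Lemma division_monomial m : exists r : {mpoly R[N]}, J ('X_[m] - r) /\
  forall m', m' \in msupp r -> standard B m' && (m' <= m)%O.
Proof.
elim/(well_founded_ind (@ltom_wf N)): m => m IH.
have [mstd|/negPn/hasP[b bB bm]] := boolP (standard B m).
  exists 'X_[m]; rewrite subrr; split; first exact: ideal0.
  by move=> m'; rewrite msuppX inE => /eqP->; rewrite mstd lexx.
set h := 'X_[m] - 'X_[m - b] * G b.
have hlt m' : m' \in msupp h -> (m' < m)%O.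
  rewrite lt_neqAle => m'h; apply/andP; split.
    apply: contraTneq m'h => ->; rewrite mcoeff_msupp negbK mcoeffB mcoeffX eqxx.
    by rewrite -{1}(submK bm) [_ * G b]mulrC mcoeffMX G1 // subrr.
  have := msuppB_le m'h; rewrite mem_cat msuppX inE => /orP[/eqP->//|].
  rewrite mulrC (perm_mem (msuppMX _ _)) => /mapP[c cG ->].
  by rewrite -{2}(submK bm) lemc_add2r; apply: Gle.
have /choice[rf rfP] : forall m', exists r : {mpoly R[N]}, (m' < m)%O ->
    J ('X_[m'] - r) /\ forall m'', m'' \in msupp r -> standard B m'' && (m'' <= m')%O.
  move=> m'; have [/IH[r ?]|] := boolP (m' < m)%O; [by exists r|by exists 0].
exists (\sum_(m' <- msupp h) h@_m' *: rf m'); split.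
  have -> : 'X_[m] = h + 'X_[m - b] * G b by rewrite subrK.
  rewrite [X in X + _ - _]mpolyE addrAC -sumrB.
  apply: idealD => //; last by apply: ideal_mull => //; apply: JG.
  apply: ideal_sum_seq => // m' m'h; rewrite -scalerBr -mul_mpolyC.
  by apply: ideal_mull => //; apply: (rfP m' (hlt _ m'h)).1.
move=> m'' /msupp_sum_le /flattenP[_ /mapP[m' + ->]].
rewrite filter_predT => m'h /msuppZ_le m''r.
have /andP[-> /= m''m'] := (rfP m' (hlt _ m'h)).2 _ m''r.
exact/ltW/(le_lt_trans m''m')/hlt.
Qed.

Lemma division f : exists r : {mpoly R[N]}, J (f - r) /\
  forall m, m \in msupp r -> standard B m && has (fun m' => (m <= m')%O) (msupp f).
Proof.
have /choice[rf rfP] := division_monomial.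
exists (\sum_(m' <- msupp f) f@_m' *: rf m'); split.
  rewrite {1}[f]mpolyE -sumrB; apply: ideal_sum_seq => // m' _.
  by rewrite -scalerBr -mul_mpolyC; apply: ideal_mull => //; apply: (rfP m').1.
move=> m /msupp_sum_le /flattenP[_ /mapP[m' + ->]].
rewrite filter_predT => m'h /msuppZ_le mr.
have /andP[-> /= mm'] := (rfP m').2 _ mr.
by apply/hasP; exists m'.
Qed.

Lemma division_homog d f : hideal J -> f \is d.-homog ->
  exists r : {mpoly R[N]}, [/\ J (f - r), r \is d.-homog &
    forall m, m \in msupp r -> standard B m && has (fun m' => (m <= m')%O) (msupp f)].
Proof.
move=> [_ hJ] fd; have [r [Jfr rstd]] := division f.
exists (hc d r); split; last 2 first.
- exact: pihomogP.
- move=> m mr; apply: rstd; rewrite mcoeff_msupp.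
  move: mr; rewrite mcoeff_msupp mcoeff_pihomog.
  by case: ifP => //; rewrite eqxx.
by have := hJ d _ Jfr; rewrite raddfB /= (pihomog_homog _ fd) eqxx.
Qed.

End Division.

(** * Reduced standard bases over a field *)

Section StandardBasis.
Variables (N : nat) (k : fieldType).
Implicit Types (J : set {mpoly k[N]}) (f : {mpoly k[N]}).

Definition std_supp (R : nzRingType) (B : seq 'X_{1..N}) (f : {mpoly R[N]}) : Prop :=
  forall m, m \in msupp f -> standard B m.

Lemma std_suppP (R : nzRingType) (B : seq 'X_{1..N}) (f : {mpoly R[N]}) :
  (forall m, ~~ standard B m -> f@_m = 0) -> std_supp B f.
Proof.
move=> f0 m; rewrite mcoeff_msupp => /eqP fm; apply: contraT => /f0.
by [].
Qed.

(** A reduced Groebner basis. By [stdb_tail] and [stdb_indep] the difference ['X_[b] - G b] is the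
    normal form of ['X_[b]], so [G b] is determined by the ideal and [B]; this is what later makes
    its coefficients canonical. *)
Record std_basis J (B : seq 'X_{1..N}) (G : 'X_{1..N} -> {mpoly k[N]}) : Prop := {
  stdb_mem : forall b, b \in B -> J (G b);
  stdb_lead : forall b, b \in B -> (G b)@_b = 1;
  stdb_le : forall b m, b \in B -> m \in msupp (G b) -> (m <= b)%O;
  stdb_tail : forall b, b \in B -> std_supp B ('X_[b] - G b);
  stdb_indep : forall f, J f -> std_supp B f -> f = 0 }.

Lemma std_basis_exists J : is_ideal J -> exists B G, std_basis J B G.
Proof.
move=> idJ.
have [B [BJ JB]] := dickson [set m | exists f, [/\ J f, f != 0 & mlead f = m]].
have indep f : J f -> std_supp B f -> f = 0.
  move=> Jf fstd; apply/eqP; apply: contraT => f0.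
  have [|b bB bm] := JB (mlead f); first by exists f.
  by have := fstd _ (mlead_supp f0); rewrite /standard => /hasPn/(_ _ bB); rewrite bm.
have /choice[G GP] : forall b, exists g, b \in B ->
    [/\ J g, g@_b = 1 & forall m, m \in msupp g -> (m <= b)%O].
  move=> b; have [/BJ[f [Jf f0 <-]]|] := boolP (b \in B); last by exists 0.
  exists ((mleadc f)^-1 *: f) => _; split.
  - by rewrite -mul_mpolyC; apply: ideal_mull.
  - by rewrite mcoeffZ mulVf // mleadc_eq0.
  - by move=> m /msuppZ_le; apply: msupp_le_mlead.
have GJ b : b \in B -> J (G b) by move=> /GP[].
have G1 b : b \in B -> (G b)@_b = 1 by move=> /GP[].
have Gle b m : b \in B -> m \in msupp (G b) -> (m <= b)%O by move=> /GP[_ _]; apply.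
have /choice[r rP] := division_monomial idJ GJ G1 Gle.
(* Subtracting the remainder [r b] makes the basis reduced: b is the only nonstandard monomial
   left. *)
exists B, (fun b => 'X_[b] - r b); split=> //.
- by move=> b _; have [] := rP b.
- move=> b bB; rewrite mcoeffB mcoeffX eqxx memN_msupp_eq0 ?subr0 //.
  apply/negP => /(rP b).2 /andP[/hasPn/(_ _ bB)].
  by rewrite lepm_refl.
- move=> b m bB /msuppB_le; rewrite mem_cat msuppX inE => /orP[/eqP->//|].
  by move=> /(rP b).2 /andP[].
- by move=> b bB m; rewrite opprB addrC subrK => /(rP b).2 /andP[].
Qed.

Lemma std_basis_gens J B G : is_ideal J -> std_basis J B G -> J = gens [seq G b | b <- B].
Proof.
move=> idJ sb; have GB b : b \in B -> gens [seq G b | b <- B] (G b).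
  by move=> bB; apply: gens_mem; apply: map_f.
have GJ : gens [seq G b | b <- B] `<=` J.
  by apply: gens_min => // f /mapP[b bB ->]; apply: stdb_mem sb _ bB.
rewrite eqEsubset; split=> // f Jf.
have [r [fr rstd]] := division (gens_ideal _) GB (stdb_lead sb) (stdb_le sb) f.
suff r0 : r = 0 by rewrite r0 subr0 in fr.
apply: (stdb_indep sb) => [|m /rstd /andP[]//].
by have := idealB idJ Jf (GJ _ fr); rewrite opprB addrC subrK.
Qed.

Lemma mpoly_noetherian : noetherian {mpoly k[N]}.
Proof.
move=> J idJ; have [B [G sb]] := std_basis_exists idJ.
by exists [seq G b | b <- B]; apply: std_basis_gens.
Qed.

End StandardBasis.

(** * Relative dimensions *)

Section QuotientDimension.
Variables (k : fieldType) (T : lmodType k).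
Implicit Types (U V W : set T) (r s : nat).

Record subspace W : Prop := {
  subsp0 : W 0;
  subspD : forall x y, W x -> W y -> W (x + y);
  subspZ : forall c x, W x -> W (c *: x) }.

Lemma subspB W x y : subspace W -> W x -> W y -> W (x - y).
Proof.
by move=> sW Wx Wy; apply: subspD => //; rewrite -scaleN1r; apply: subspZ.
Qed.

Lemma subsp_sum W (I : Type) (r : seq I) (P : pred I) (F : I -> T) :
  subspace W -> (forall i, P i -> W (F i)) -> W (\sum_(i <- r | P i) F i).
Proof. by move=> sW WF; apply: big_ind => //; [exact: subsp0|exact: subspD]. Qed.

Lemma subsp_comb W r (c : 'I_r -> k) (b : 'I_r -> T) :
  subspace W -> (forall i, W (b i)) -> W (\sum_i c i *: b i).
Proof. by move=> sW Wb; apply: subsp_sum => // i _; apply: subspZ. Qed.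

Lemma subspI V W : subspace V -> subspace W -> subspace (V `&` W).
Proof.
move=> sV sW; split; first by split; apply: subsp0.
  by move=> x y [? ?] [? ?]; split; apply: subspD.
by move=> c x [? ?]; split; apply: subspZ.
Qed.

Definition free_mod W r (b : 'I_r -> T) : Prop :=
  forall c : 'I_r -> k, W (\sum_i c i *: b i) -> forall i, c i = 0.

Definition span_mod V W r (b : 'I_r -> T) : Prop :=
  forall v, V v -> exists c : 'I_r -> k, W (v - \sum_i c i *: b i).

Definition finmod V W : Prop := exists r (b : 'I_r -> T), span_mod V W b.

Definition qdim_is V W r : Prop :=
  exists b : 'I_r -> T, [/\ forall i, V (b i), span_mod V W b & free_mod W b].

(** For subspaces, the dimension of the image of [V] in the quotient by [W], without forming that
    quotient. The default value 0 stands for infinite dimension. *)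
Definition qdim V W : nat := xget 0%N [set r | qdim_is V W r].

Lemma free_span_le V W r s (b : 'I_r -> T) (e : 'I_s -> T) : subspace W ->
  (forall i, V (b i)) -> free_mod W b -> span_mod V W e -> (r <= s)%N.
Proof.
move=> sW Vb fb se; rewrite leqNgt; apply/negP => sr.
have /choice[C CP] := fun i => se _ (Vb i).
pose M := \matrix_(i < r, j < s) C i j.
have : kermx M != 0.
  rewrite -mxrank_eq0 mxrank_ker subn_eq0 -ltnNge.
  exact: leq_ltn_trans (rank_leq_col _) sr.
case/rowV0Pn => v /sub_kermxP vM /negP v0; apply: v0.
suff v0 : forall i, v ord0 i = 0 by apply/eqP/rowP => i; rewrite v0 mxE.
apply: fb.
have -> : \sum_i v ord0 i *: b i = \sum_i v ord0 i *: (b i - \sum_j C i j *: e j).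
  rewrite -[LHS]subr0; under [RHS]eq_bigr do rewrite scalerBr.
  rewrite sumrB; congr (_ - _).
  under eq_bigr do rewrite scaler_sumr.
  rewrite exchange_big big1 //= => j _.
  under eq_bigr do rewrite scalerA.
  rewrite -scaler_suml; have /matrixP/(_ ord0 j) := vM; rewrite !mxE => vMj.
  rewrite (_ : \sum_i _ = 0) ?scale0r // -[RHS]vMj.
  by apply: eq_bigr => i _; rewrite mxE.
exact: subsp_comb.
Qed.

Lemma qdim_eq V W r : subspace W -> qdim_is V W r -> qdim V W = r.
Proof.
move=> sW rP; have [b [Vb sb fb]] := rP.
rewrite /qdim; case: xgetP => [s _ [b' [Vb' sb' fb']]|/(_ r)//].
by apply/eqP; rewrite eqn_leq (free_span_le sW Vb' fb' sb) (free_span_le sW Vb fb sb').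
Qed.

Lemma qdim_exists V W s (e : 'I_s -> T) : subspace W -> span_mod V W e ->
  exists2 r, (r <= s)%N & qdim_is V W r.
Proof.
move=> sW se.
pose P r := `[< exists b : 'I_r -> T, (forall i, V (b i)) /\ free_mod W b >].
have exP : exists r, P r.
  by exists 0%N; apply/asboolP; exists (fun=> 0); split=> [[]|c _ []].
have boundP r : P r -> (r <= s)%N.
  by move=> /asboolP[b [Vb fb]]; apply: free_span_le Vb fb se.
case: (ex_maxnP exP boundP) => r /[dup] /boundP rs /asboolP[b [Vb fb]] rmax.
exists r => //; exists b; split=> // v Vv; apply: contrapT => nv.
suff /rmax : P r.+1 by rewrite ltnn.
apply/asboolP; exists (fun i => oapp b v (unlift ord0 i)); split.
  by move=> i; case: unliftP => [j _|_] //=; apply: Vb.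
move=> c; rewrite big_ord_recl unlift_none /=.
under eq_bigr do rewrite liftK /=.
move=> Wc; have c0 : c ord0 = 0.
  apply: contrapT => /eqP c0; apply: nv.
  exists (fun i => - (c ord0)^-1 * c (lift ord0 i)).
  have := subspZ sW (c ord0)^-1 Wc; rewrite scalerDr scalerA mulVf // scale1r.
  rewrite scaler_sumr -sumrN; congr (W (_ + _)).
  by apply: eq_bigr => i _; rewrite mulNr scaleNr opprK scalerA.
move: Wc; rewrite c0 scale0r add0r => /fb cl i.
by case: (unliftP ord0 i) => [j ->|->].
Qed.

Lemma qdimP V W : subspace W -> finmod V W -> qdim_is V W (qdim V W).
Proof.
move=> sW [s [e se]]; have [r _ rP] := qdim_exists sW se.
by rewrite (qdim_eq sW rP).
Qed.

Lemma qdim_le_span V W s (e : 'I_s -> T) : subspace W -> span_mod V W e ->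
  (qdim V W <= s)%N.
Proof.
by move=> sW se; have [r rs rP] := qdim_exists sW se; rewrite (qdim_eq sW rP).
Qed.

Lemma qdim_ge_free V W r (b : 'I_r -> T) : subspace W -> finmod V W ->
  (forall i, V (b i)) -> free_mod W b -> (r <= qdim V W)%N.
Proof.
by move=> sW /(qdimP sW)[e [_ se _]] Vb fb; apply: free_span_le Vb fb se.
Qed.

Lemma span_modS V V' W W' r (b : 'I_r -> T) : V' `<=` V -> W `<=` W' ->
  span_mod V W b -> span_mod V' W' b.
Proof. by move=> VV WW sb v /VV/sb[c Wc]; exists c; apply: WW. Qed.

Lemma finmodS V V' W W' : V' `<=` V -> W `<=` W' -> finmod V W -> finmod V' W'.
Proof. by move=> VV WW [r [b sb]]; exists r, b; apply: span_modS sb. Qed.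

Lemma qdimS V V' W W' : subspace W -> subspace W' -> finmod V W -> V' `<=` V ->
  W `<=` W' -> (qdim V' W' <= qdim V W)%N.
Proof.
move=> sW sW' fV VV WW; have [b [_ sb _]] := qdimP sW fV.
exact/(qdim_le_span sW')/(span_modS VV WW sb).
Qed.

Definition cat_fam r s (b : 'I_r -> T) (e : 'I_s -> T) : 'I_(r + s) -> T :=
  fun i => match split i with inl j => b j | inr j => e j end.

Lemma cat_fam_sum r s (b : 'I_r -> T) (e : 'I_s -> T) (c : 'I_(r + s) -> k) :
  \sum_i c i *: cat_fam b e i =
  \sum_i c (lshift s i) *: b i + \sum_i c (rshift r i) *: e i.
Proof.
rewrite big_split_ord /=; congr (_ + _); apply: eq_bigr => i _; rewrite /cat_fam.
  by rewrite -[lshift s i]/(unsplit (inl i)) unsplitK.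
by rewrite -[rshift r i]/(unsplit (inr i)) unsplitK.
Qed.

(** Additivity along the map from V/W to V/U, whose kernel is the image of the intersection of [V]
    and [U]: a basis modulo [U] and a basis of the kernel make up a basis modulo [W]. *)
Lemma qdimD V U W : subspace V -> subspace U -> subspace W -> W `<=` U ->
  finmod V W -> qdim V W = (qdim V U + qdim (V `&` U) W)%N.
Proof.
move=> sV sU sW WU fV.
have [b [Vb sb fb]] := qdimP sU (finmodS (@subset_refl _ V) WU fV).
have fVU : finmod (V `&` U) W by apply: finmodS fV => // x [].
have [e [Ve se fe]] := qdimP sW fVU.
apply: qdim_eq => //; exists (cat_fam b e); split.
- by move=> i; rewrite /cat_fam; case: split => j //; case: (Ve j).
- move=> v Vv; have [c Uc] := sb v Vv.
  have [|c' Wc'] := se (v - \sum_i c i *: b i).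
    by split=> //; apply: subspB => //; apply: subsp_comb.
  exists (fun i => match split i with inl j => c j | inr j => c' j end).
  rewrite cat_fam_sum opprD addrA; congr (W (_ - _ - _)): Wc'.
    apply: eq_bigr => i _.
    by rewrite -[lshift _ i]/(unsplit (inl i)) unsplitK.
  apply: eq_bigr => i _.
  by rewrite -[rshift _ i]/(unsplit (inr i)) unsplitK.
- move=> c; rewrite cat_fam_sum => Wc.
  have Ue : U (\sum_i c (rshift (qdim V U) i) *: e i).
    by apply: subsp_comb => // i; case: (Ve i).
  have cl : forall i, c (lshift (qdim (V `&` U) W) i) = 0.
    by apply: fb; have := subspB sU (WU _ Wc) Ue; rewrite addrK.
  have cr : forall i, c (rshift (qdim V U) i) = 0.
    apply: fe; move: Wc; rewrite big1 ?add0r // => i _.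
    by rewrite cl scale0r.
  by move=> i; rewrite -(splitK i); case: split => j /=.
Qed.

Lemma qdim_gt0 V W v : subspace W -> finmod V W -> V v -> ~ W v -> (0 < qdim V W)%N.
Proof.
move=> sW fV Vv Wv; apply: (@qdim_ge_free V W 1 (fun=> v)) => // c.
rewrite big_ord1 => Wc i; apply: contrapT => /eqP; rewrite (ord1 i) => ci; apply: Wv.
have := subspZ sW (c ord0)^-1 Wc.
by rewrite scalerA mulVf ?scale1r.
Qed.

Lemma qdim_eq0 V W v : subspace W -> finmod V W -> qdim V W = 0%N -> V v -> W v.
Proof.
by move=> sW fV q0 Vv; apply: contrapT => /(qdim_gt0 sW fV Vv); rewrite q0.
Qed.

(** The inequality leaves dimension 0 for the second summand in [qdimD]. This is how comparisons of
    Hilbert functions become equalities of ideals. *)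
Lemma qdim_sub_eq V W W' v : subspace V -> subspace W -> subspace W' -> finmod V W ->
  W `<=` W' -> (qdim V W <= qdim V W')%N -> V v -> W' v -> W v.
Proof.
move=> sV sW sW' fV WW le Vv W'v.
have := qdimD sV sW' sW WW fV => E.
apply: (@qdim_eq0 (V `&` W')) => //.
  by apply: finmodS fV => // x [].
by apply/eqP; rewrite -leqn0 -(leq_add2l (qdim V W')) addn0 -E.
Qed.

End QuotientDimension.

Section QuotientDimensionMap.
Variables (k : fieldType) (T T' : lmodType k) (phi : T -> T').
Hypothesis lin : linear phi.

Let phi0 : phi 0 = 0.
Proof. by have := lin (-1) 0 0; rewrite scaler0 addr0 scaleN1r => ->; rewrite addNr. Qed.

Let phi_sum r (c : 'I_r -> k) (b : 'I_r -> T) :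
  phi (\sum_i c i *: b i) = \sum_i c i *: phi (b i).
Proof.
elim: r c b => [|r IH] c b; first by rewrite !big_ord0 phi0.
by rewrite !big_ord_recl lin IH.
Qed.

Let phiB x y : phi (x - y) = phi x - phi y.
Proof. by rewrite addrC -scaleN1r lin scaleN1r addrC. Qed.

Lemma free_mod_map V W V' W' r (b : 'I_r -> T) : subspace V ->
  (forall v, V v -> W' (phi v) -> W v) -> (forall v, V v -> V' (phi v)) ->
  (forall i, V (b i)) -> free_mod W b ->
  (forall i, V' (phi (b i))) /\ free_mod W' (phi \o b).
Proof.
move=> sV WW VV Vb fb; split=> [i|c]; first exact: VV.
rewrite /= -phi_sum => /WW Wc; apply/fb/Wc; exact: subsp_comb.
Qed.

Lemma qdim_map V W V' W' : subspace V -> subspace W -> subspace W' ->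
  (forall v, V v -> W' (phi v) <-> W v) -> (forall v, V v -> V' (phi v)) ->
  (forall v', V' v' -> exists2 v, V v & W' (v' - phi v)) -> finmod V W ->
  qdim V' W' = qdim V W.
Proof.
move=> sV sW sW' WW VV VV' fV; have [b [Vb sb fb]] := qdimP sW fV.
apply: qdim_eq => //; exists (phi \o b).
have WW1 v : V v -> W' (phi v) -> W v by move=> /WW[].
have [V'b fb'] := free_mod_map sV WW1 VV Vb fb.
split=> // v' /VV'[v Vv W'v]; have [c Wc] := sb v Vv; exists c.
have := (WW (v - \sum_i c i *: b i) (subspB sV Vv (subsp_comb _ sV Vb))).2 Wc.
by rewrite phiB phi_sum => /(subspD sW' W'v); rewrite addrA subrK.
Qed.

End QuotientDimensionMap.

(** * Hilbert functions and dimension *)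

Section Growth.
Variables (N : nat) (k : fieldType).
Local Notation S := {mpoly k[N]}.
Implicit Types (I J : set S) (f g : S) (d t h : nat).

Lemma ideal_subspace I : is_ideal I -> subspace I.
Proof.
move=> idI; split; [exact: ideal0|exact: idealD|].
by move=> c x Ix; rewrite -mul_mpolyC; apply: ideal_mull.
Qed.
Hint Resolve ideal_subspace : core.

Lemma mul_linear f : linear ( *%R f : S -> S).
Proof. by move=> c x y; rewrite mulrDr scalerAr. Qed.

Definition deg_le t : set S := [set f | (msize f <= t.+1)%N].
Definition homs t : set S := [set f | f \is t.-homog].

Lemma deg_le_subspace t : subspace (deg_le t).
Proof.
split; rewrite /deg_le /=; first by rewrite msize0.
  by move=> x y xt yt; apply: leq_trans (msizeD_le _ _) _; rewrite geq_max xt.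
by move=> c x; apply: leq_trans; apply: msizeZ_le.
Qed.
Hint Resolve deg_le_subspace : core.

Lemma homs_subspace t : subspace (homs t).
Proof.
split; rewrite /homs /=; first exact: dhomog0.
  by move=> x y xt yt; apply: dhomogD.
by move=> c x xt; apply: dhomogZ.
Qed.
Hint Resolve homs_subspace : core.

Lemma homs_deg_le t : homs t `<=` deg_le t.
Proof. by move=> f; apply: homog_msize_le. Qed.

Lemma deg_leS t t' : (t <= t')%N -> deg_le t `<=` deg_le t'.
Proof. by move=> tt f /leq_trans; apply. Qed.

Lemma deg_leM d t f g : deg_le d f -> deg_le t g -> deg_le (t + d) (f * g).
Proof.
rewrite /deg_le /=.
have [->|f0] := eqVneq f 0; first by rewrite mul0r msize0.
have [->|g0] := eqVneq g 0; first by rewrite mulr0 msize0.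
rewrite msizeM // (mpolySpred mdeg f0) (mpolySpred mdeg g0) addSn addnS /= !ltnS.
by rewrite addnC => fd gt; apply: leq_add.
Qed.

Lemma card_bmultinom t : (#|{: 'X_{1..N < t.+1}}| <= t.+1 ^ N)%N.
Proof.
have mt (m : 'X_{1..N < t.+1}) i : ((m : 'X_{1..N}) i < t.+1)%N.
  rewrite (leq_ltn_trans _ (bmdeg m)) // mdegE (bigD1 i) //=; exact: leq_addr.
pose phi (m : 'X_{1..N < t.+1}) := [ffun i : 'I_N => Ordinal (mt m i)].
have inj : injective phi.
  move=> m m' /ffunP mm; apply/val_inj/mnmP => i.
  by have := mm i; rewrite !ffunE => /(congr1 val).
by have := leq_card phi inj; rewrite card_ffun !card_ord.
Qed.

Lemma span_deg_le t W : W 0 ->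
  span_mod (deg_le t) W (fun i : 'I_#|{: 'X_{1..N < t.+1}}| => 'X_[enum_val i] : S).
Proof.
move=> W0 f ft; exists (fun i : 'I_#|{: 'X_{1..N < t.+1}}| => f@_(enum_val i)).
rewrite -(big_enum_val (fun m : 'X_{1..N < t.+1} => f@_m *: 'X_[m])) /=.
by rewrite -(mpolywE ft) subrr.
Qed.

Lemma finmod_deg_le t I : is_ideal I -> finmod (deg_le t) I.
Proof.
by move=> idI; eexists; eexists; apply: span_deg_le; apply: ideal0.
Qed.
Hint Resolve finmod_deg_le : core.

Lemma finmod_homs t I : is_ideal I -> finmod (homs t) I.
Proof.
by move=> idI; apply: finmodS (finmod_deg_le t idI) => //; apply: homs_deg_le.
Qed.
Hint Resolve finmod_homs : core.

(** The affine Hilbert function: filtering by degree instead of grading makes it apply to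
    inhomogeneous ideals, such as the members of a chain of primes. [gf] is the graded version. *)
Definition hf I t := qdim (deg_le t) I.
Definition gf I t := qdim (homs t) I.

Lemma hf_bound I t : is_ideal I -> (hf I t <= t.+1 ^ N)%N.
Proof.
move=> idI; apply: leq_trans (card_bmultinom t).
apply: qdim_le_span; [exact: ideal_subspace|exact: span_deg_le (ideal0 idI)].
Qed.

Lemma hf_mono I t t' : is_ideal I -> (t <= t')%N -> (hf I t <= hf I t')%N.
Proof.
move=> idI tt; apply: qdimS => //; [exact: ideal_subspace..|exact: finmod_deg_le|].
exact: deg_leS.
Qed.

Lemma hf_sub I J t : is_ideal I -> is_ideal J -> I `<=` J -> (hf J t <= hf I t)%N.
Proof.
by move=> idI idJ IJ; apply: qdimS => //; [exact: ideal_subspace..|exact: finmod_deg_le].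
Qed.

Lemma hf_proper I t : is_ideal I -> ~ I 1 -> (0 < hf I t)%N.
Proof.
move=> idI; apply: qdim_gt0; [exact: ideal_subspace|exact: finmod_deg_le|].
by rewrite /deg_le /= msize1.
Qed.

Lemma hf_all I t : is_ideal I -> I 1 -> hf I t = 0%N.
Proof.
move=> idI I1; apply/eqP; rewrite -leqn0.
apply: (@qdim_le_span _ _ _ _ 0 (fun=> 0)); first exact: ideal_subspace.
by move=> f _; exists (fun=> 0); rewrite -[X in I X]mulr1; apply: ideal_mull.
Qed.

(** Since [I] and [f] are homogeneous, the multiplier of [f] can be truncated: its components above
    degree t only contribute in degrees above t + d, where x vanishes. *)
Lemma add_gen_truncate I f d t x : hideal I -> f \is d.-homog ->
  add_gen I f x -> deg_le (t + d) x -> exists2 v, deg_le t v & I (x - f * v).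
Proof.
move=> [idI hI] fd [i [a [Ii xE]]] xt.
exists (\sum_(e < t.+1) hc e a).
  rewrite /deg_le /=; apply: leq_trans (msize_sum _ _ _) _.
  apply/bigmax_leqP => e _; apply: leq_trans (homog_msize_le (pihomogP _ _ _)) _.
  exact: ltn_ord.
apply: hideal_comps => // e; rewrite raddfB /= mulrC mulr_suml pihomog_sum.
have [ed|de] := ltnP e d.
  rewrite big1 ?subr0 => [|j _]; last exact: pihomogM_lt fd _.
  by rewrite xE raddfD /= (pihomogM_lt _ fd) // addr0; apply: hI.
rewrite -(subnK de); set e' := (e - d)%N.
have -> : \sum_(j < t.+1) hc (e' + d) (hc j a * f) =
    \sum_(j < t.+1) (if e' == j then hc j a else 0) * f.
  by apply: eq_bigr => j _; rewrite (pihomogM _ _ fd) (pihomog_homog _ (pihomogP _ _ _)).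
rewrite -mulr_suml; have [et|te] := ltnP e' t.+1.
  rewrite (bigD1 (Ordinal et)) //= eqxx big1 ?addr0 => [|j je]; last first.
    by case: eqP => // ej; case/negP: je; apply/eqP/val_inj.
  by rewrite xE raddfD /= (pihomogM _ _ fd) addrK; apply: hI.
rewrite big1 => [|j _]; last by case: eqP => // ej; have := ltn_ord j; rewrite -ej ltnNge te.
rewrite mul0r subr0 (_ : hc _ x = 0); first exact: ideal0.
apply/mpolyP => m; rewrite mcoeff_pihomog mcoeff0; case: eqP => // me.
apply/memN_msupp_eq0/msize_mdeg_ge; rewrite me; apply: leq_trans xt _.
by rewrite -addSn leq_add2r.
Qed.

(** Multiplication by [f] identifies the quotient by [colon I f], shifted by d, with the kernel of
    the map from the quotient by [I] to the quotient by [add_gen I f]. *)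
Lemma hf_exact I f d t : hideal I -> f \is d.-homog ->
  hf I (t + d) = (hf (add_gen I f) (t + d) + hf (colon I f) t)%N.
Proof.
move=> hI fd; have idI := hI.1; have idIf := add_gen_ideal f idI.
rewrite /hf (@qdimD _ _ _ (add_gen I f)) //; try exact: ideal_subspace.
- congr addn; apply: (qdim_map (mul_linear f)) => //.
  + exact/ideal_subspace/colon_ideal.
  + exact: ideal_subspace.
  + by move=> v _; rewrite /colon /= mulrC.
  + move=> v vt; split; first exact: deg_leM (homog_msize_le fd) vt.
    by rewrite mulrC; apply: add_gen_mul.
  + move=> x [xt Ix].
    by have [v vt Iv] := add_gen_truncate hI fd Ix xt; exists v.
  + exact/finmod_deg_le/colon_ideal.
- exact: add_gen_sub.
- exact: finmod_deg_le.
Qed.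

Lemma gf_exact I f d t : hideal I -> f \is d.-homog ->
  gf I (t + d) = (gf (add_gen I f) (t + d) + gf (colon I f) t)%N.
Proof.
move=> hI fd; have idI := hI.1; have idIf := add_gen_ideal f idI.
rewrite /gf (@qdimD _ _ _ (add_gen I f)) //; try exact: ideal_subspace.
- congr addn; apply: (qdim_map (mul_linear f)) => //.
  + exact/ideal_subspace/colon_ideal.
  + exact: ideal_subspace.
  + by move=> v _; rewrite /colon /= mulrC.
  + move=> v vt; split; first by rewrite addnC; apply: dhomogM.
    by rewrite mulrC; apply: add_gen_mul.
  + move=> x [xt [i [a [Ii xE]]]]; exists (hc t a); first exact: pihomogP.
    have -> : x = hc (t + d) x by rewrite (pihomog_homog _ xt) eqxx.
    by rewrite {1}xE raddfD /= (pihomogM _ _ fd) [f * _]mulrC addrK; apply: hI.2.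
  + exact/finmod_homs/colon_ideal.
- exact: add_gen_sub.
- exact: finmod_homs.
Qed.

Lemma add_gen_low I f d t : hideal I -> f \is d.-homog -> (t < d)%N ->
  deg_le t `&` add_gen I f `<=` I.
Proof.
move=> [idI hI] fd td x [xt [i [a [Ii xE]]]]; apply: hideal_comps => // e.
have [ed|de] := ltnP e d.
  by rewrite xE raddfD /= (pihomogM_lt _ fd) // addr0; apply: hI.
rewrite (_ : hc _ x = 0); first exact: ideal0.
apply/mpolyP => m; rewrite mcoeff_pihomog mcoeff0; case: eqP => // me.
apply/memN_msupp_eq0/msize_mdeg_ge; rewrite me; apply: leq_trans xt _.
exact: leq_trans de.
Qed.

Lemma qdim_low (V : set S) I f d t : subspace V -> V `<=` deg_le t ->
  hideal I -> f \is d.-homog -> (t < d)%N -> qdim V (add_gen I f) = qdim V I.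
Proof.
move=> sV Vt hI fd td; have idI := hI.1; have idIf := add_gen_ideal f idI.
have fV : finmod V I by apply: finmodS (finmod_deg_le t idI).
rewrite [RHS](@qdimD _ _ _ (add_gen I f)) //; try exact: ideal_subspace.
  rewrite -[LHS]addn0; congr addn; apply/esym/eqP; rewrite -leqn0.
  apply: (@qdim_le_span _ _ _ _ 0 (fun=> 0)); first exact: ideal_subspace.
  move=> x [Vx fx]; exists (fun=> 0); rewrite big_ord0 subr0.
  by apply: (add_gen_low hI fd td); split=> //; apply: Vt.
exact: add_gen_sub.
Qed.

Lemma hf_low I f d t : hideal I -> f \is d.-homog -> (t < d)%N ->
  hf (add_gen I f) t = hf I t.
Proof. exact: qdim_low. Qed.

Lemma gf_low I f d t : hideal I -> f \is d.-homog -> (t < d)%N ->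
  gf (add_gen I f) t = gf I t.
Proof. by apply: qdim_low => //; apply: homs_deg_le. Qed.

(* [codim_growth I h] says that the dimension of the quotient by [I] is at most
   [N - h], in a form that avoids truncated subtraction. *)
Definition codim_growth I h : Prop :=
  exists C, forall t, (hf I t * t.+1 ^ h <= C * t.+1 ^ N)%N.

Lemma codim_growth0 I : is_ideal I -> codim_growth I 0.
Proof. by move=> idI; exists 1%N => t; rewrite muln1 mul1n; apply: hf_bound. Qed.

Lemma codim_growth_all I h : is_ideal I -> I 1 -> codim_growth I h.
Proof. by move=> idI I1; exists 0%N => t; rewrite hf_all. Qed.

Lemma codim_growthS I J h : is_ideal I -> is_ideal J -> I `<=` J ->
  codim_growth I h -> codim_growth J h.
Proof.
move=> idI idJ IJ [C CP]; exists C => t; apply: leq_trans (CP t).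
by rewrite leq_mul2r hf_sub ?orbT.
Qed.

Lemma codim_growth_le I h h' : (h' <= h)%N -> codim_growth I h -> codim_growth I h'.
Proof.
move=> hh [C CP]; exists C => t; apply: leq_trans (CP t).
by rewrite leq_mul2l leq_pexp2l ?orbT.
Qed.

Lemma codim_growth_bound I h : is_ideal I -> ~ I 1 -> codim_growth I h -> (h <= N)%N.
Proof.
move=> idI I1 [C CP]; rewrite leqNgt; apply/negP => Nh.
(* At t = C the bound would give (C + 1)^(N + 1) <= C (C + 1)^N. *)
have := CP C; rewrite leqNgt => /negP; apply.
apply: (@leq_trans (C.+1 ^ h)); last by rewrite leq_pmull ?hf_proper.
apply: leq_trans (leq_pexp2l _ Nh) => //.
by rewrite expnS ltn_mul2r expn_gt0 /= ltnSn.
Qed.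

(** Multiplication by [f] embeds the quotient by [I] into J/I, so hf J (t + d) + hf I t <= hf I (t +
    d). Adding up t + 1 such inequalities gives (t + 1) hf J t <= hf I (t + (t + 1) d): one power of
    t is gained. No grading is involved, so this applies to arbitrary primes. *)
Lemma codim_growth_regular I J f h : is_ideal I -> is_ideal J -> I `<=` J -> J f ->
  regular_mod I f -> codim_growth I h -> codim_growth J h.+1.
Proof.
move=> idI idJ IJ Jf fr [C CP]; pose d := msize f.
have fd : deg_le d f by apply: leqnSn.
have step t : (hf J (t + d) + hf I t <= hf I (t + d))%N.
  rewrite [X in (_ <= X)%N]/hf (@qdimD _ _ _ J) //; try exact: ideal_subspace.
    rewrite leq_add2l; have [b [Vb sb fb]] := qdimP (ideal_subspace idI) (finmod_deg_le t idI).
    have [||V'b fb'] := @free_mod_map _ _ _ _ (mul_linear f) (deg_le t) I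
      (deg_le (t + d) `&` J) I _ b (deg_le_subspace t) _ _ Vb fb.
    - by move=> v _; apply: fr.
    - move=> v vt; split; first exact: deg_leM fd vt.
      exact: ideal_mulr.
    apply: qdim_ge_free V'b fb'; first exact: ideal_subspace.
    by apply: finmodS (finmod_deg_le (t + d) idI) => // x [].
  exact: finmod_deg_le.
have steps t j : (j * hf J t <= hf I (t + j * d))%N.
  elim: j => // j IH; rewrite mulSn mulSn [(d + _)%N]addnC addnA.
  apply: leq_trans (step _); apply: leq_add => //.
  by apply: hf_mono => //; rewrite -addnA leq_addr.
(* The degree t + (t + 1) d has successor (t + 1)(d + 1), which explains the factor (d + 1)^N. *)
exists (C * d.+1 ^ N)%N => t.
have TE : (t + t.+1 * d).+1 = (t.+1 * d.+1)%N by rewrite mulnS addSn.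
have := CP (t + t.+1 * d)%N; rewrite TE => CPt.
have : (t.+1 * hf J t * t.+1 ^ h <= C * (t.+1 * d.+1) ^ N)%N.
  apply: leq_trans CPt; apply: leq_mul; first exact: steps.
  by rewrite expnMn leq_pmulr // expn_gt0.
by rewrite expnMn expnS [(t.+1 * hf J t)%N]mulnC -!mulnA [(t.+1 ^ N * _)%N]mulnC.
Qed.

(** One form of positive degree lowers the dimension by at most one: by [hf_exact], hf I t is at
    most hf (I + (f)) t + hf I (t - d), and induction bounds it by (t + 1) hf (I + (f)) t. *)
Lemma codim_growth_lift I f h : hideal I -> hpos f ->
  codim_growth (add_gen I f) h.+1 -> codim_growth I h.
Proof.
move=> hI [d d0 fd] [C CP]; have idI := hI.1; have idIf := add_gen_ideal f idI.
exists C => t; apply: leq_trans (CP t).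
rewrite expnS mulnA leq_mul2r; apply/orP; right.
elim/ltn_ind: t => t IH.
have [td|dt] := ltnP t d; first by rewrite (hf_low hI fd td) leq_pmulr.
have tE := subnK dt; set s := (t - d)%N in tE.
have st : (s < t)%N by rewrite -tE -addn1 leq_add2l.
rewrite -{1}tE (hf_exact s hI fd) tE mulnS leq_add2l.
apply: leq_trans (leq_trans (IH s st) _).
  by apply: hf_sub => //; [exact: colon_ideal|exact: sub_colon].
by apply: leq_mul => //; apply: hf_mono => //; apply: ltnW.
Qed.

Lemma codim_growth_regular_seq I fs h : is_ideal I -> regular_seq I fs ->
  codim_growth I h -> codim_growth (gens_over I fs) (h + size fs).
Proof.
elim: fs I h => [|f fs IH] I h idI /=; first by rewrite addn0.
move=> [fr fsr] cI; rewrite addnS -addSn; apply: IH => //; first exact: add_gen_ideal.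
apply: codim_growth_regular fr cI => //; first exact: add_gen_ideal.
  exact: add_gen_sub.
exact: add_gen_mem.
Qed.

Lemma codim_growth_lift_seq I fs h : hideal I -> (forall f, f \in fs -> hpos f) ->
  codim_growth (gens_over I fs) (h + size fs) -> codim_growth I h.
Proof.
elim: fs I h => [|f fs IH] I h hI fsh /=; first by rewrite addn0.
have fp := fsh f (mem_head _ _).
rewrite addnS -addSn => /IH cI; apply: (codim_growth_lift hI fp); apply: cI.
  by have [d _ fd] := fp; apply: hideal_add fd.
by move=> g gfs; apply: fsh; rewrite inE gfs orbT.
Qed.

(** The ideal generated by the variables in [A], described by supports so that regularity of a
    further variable can be read off coefficients. *)
Definition var_ideal (A : seq 'I_N) : set S :=
  [set f | forall m, m \in msupp f -> has (fun i => m i != 0%N) A].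

Lemma var_idealE A f : var_ideal A f <->
  forall m : 'X_{1..N}, ~~ has (fun i => m i != 0%N) A -> f@_m = 0.
Proof.
split=> h m; first by move=> mA; apply/memN_msupp_eq0; apply: contra mA; apply: h.
by rewrite mcoeff_msupp => /eqP fm; apply: contraT => /h.
Qed.

Lemma var_ideal_ideal A : is_ideal (var_ideal A).
Proof.
split.
- by apply/var_idealE => m _; rewrite mcoeff0.
- move=> x y /var_idealE hx /var_idealE hy; apply/var_idealE => m mA.
  by rewrite mcoeffD hx ?hy ?addr0.
- move=> a x /var_idealE hx; apply/var_idealE => m mA.
  rewrite mcoeffM big1 // => -[m1 m2] /= /eqP mE; rewrite hx ?mulr0 //.
  apply: contra mA => /hasP[i iA m2i]; apply/hasP; exists i => //.
  by rewrite mE mnmDE addn_eq0 negb_and m2i orbT.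
Qed.

Lemma var_ideal_cons A j : var_ideal (j :: A) = add_gen (var_ideal A) 'X_j.
Proof.
rewrite eqEsubset; split; last first.
  apply: add_gen_min; first exact: var_ideal_ideal.
    by move=> f fA m /fA /= ->; rewrite orbT.
  by move=> m; rewrite msuppX inE => /eqP-> /=; rewrite mnm1E eqxx.
move=> f fA; pose P (m : 'X_{1..N}) := m j != 0%N.
exists (\sum_(m <- msupp f | ~~ P m) f@_m *: 'X_[m]),
  (\sum_(m <- msupp f | P m) f@_m *: 'X_[m - U_(j)]); split.
  rewrite big_seq_cond; apply: ideal_sum => [|m /andP[mf mj]].
    exact: var_ideal_ideal.
  move=> m' /msuppZ_le; rewrite msuppX inE => /eqP->.
  by have := fA m mf => /= /orP[mj'|//]; rewrite /P mj' in mj.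
rewrite mulr_suml {1}[f]mpolyE (bigID P) /= addrC; congr (_ + _).
by apply: eq_bigr => m mj; rewrite -scalerAl -mpolyXD submK // lep1mP.
Qed.

Lemma var_ideal_regular A j : j \notin A -> regular_mod (var_ideal A) 'X_j.
Proof.
move=> jA g /var_idealE gA; apply/var_idealE => m mA.
have := gA (U_(j) + m)%MM; rewrite mulrC mcoeffMX; apply.
apply: contra mA => /hasP[i iA mi]; apply/hasP; exists i => //.
have [ji|ji] := eqVneq j i; first by rewrite ji iA in jA.
by move: mi; rewrite mnmDE mnm1E (negbTE ji).
Qed.

Lemma regular_seq_vars : regular_seq [set 0] [seq 'X_i : S | i <- enum 'I_N].
Proof.
have <- : var_ideal [::] = [set 0].
  rewrite eqEsubset; split=> [f f0|f ->]; last by apply: ideal0; apply: var_ideal_ideal.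
  by apply/mpolyP => m; rewrite mcoeff0; apply/memN_msupp_eq0/negP => /f0.
have : uniq (enum 'I_N) by apply: enum_uniq.
have : forall j, j \in enum 'I_N -> j \notin ([::] : seq 'I_N) by [].
elim: (enum 'I_N) [::] => //= j s IH A jA /andP[js us]; split.
  by apply/var_ideal_regular/jA; rewrite mem_head.
rewrite -var_ideal_cons; apply: IH => // i is_; rewrite inE negb_or.
apply/andP; split; first by apply: contraNneq js => <-.
by apply: jA; rewrite inE is_ orbT.
Qed.

Lemma hpos_var i : hpos ('X_i : S).
Proof. by exists 1%N => //; rewrite dhomogX /= mdeg1. Qed.

(** The polynomial ring has dimension no less than N: cutting down by the N variables would
    otherwise give a proper ideal of growth N + 1, against [codim_growth_bound]. *)
Lemma codim_growth_zero : ~ codim_growth [set (0 : S)] 1.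
Proof.
have idz := @ideal_zero S.
move=> /(codim_growth_regular_seq idz regular_seq_vars).
rewrite size_map size_enum_ord add1n => /codim_growth_bound.
rewrite ltnn => h; suff: false by []; apply: h; first exact: gens_ideal.
apply: hideal_gens_over_proper; first exact: hideal_zero.
  by move=> /eqP; rewrite oner_eq0.
by move=> f /mapP[i _ ->]; apply: hpos_var.
Qed.

(** Each step of the chain adds an element that is regular modulo the previous prime, so the growth
    index rises by one. *)
Lemma codim_growth_prime_height (Q : prime_idealr S) h :
  prime_height_ge Q h -> codim_growth [set` Q] h.
Proof.
move=> [C [<- Cinc]].
have idC i : is_ideal [set` C i] by case: (prime_setP (C i)).
suff : forall i, (i <= h)%N -> codim_growth [set` C i] i by apply.
elim=> [|i IH] ih; first exact: codim_growth0.
have [CC /nonsubset[f [Cf nCf]]] := Cinc i ih.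
apply: (codim_growth_regular (idC i) (idC _) CC Cf _ (IH (ltnW ih))).
move=> g /=; rewrite prime_idealrM => /orP[fC|//].
by case: nCf.
Qed.

(** If neither factor is in [I], take in each the lowest component outside [I]; modulo [I] their
    product is a component of x y. *)
Lemma hprime_prime I : hideal I -> ~ I 1 ->
  (forall a b d e, a \is d.-homog -> b \is e.-homog -> I (a * b) -> I a \/ I b) ->
  prime_set I.
Proof.
move=> hI I1 hp; have [idI hcI] := hI; split=> // x y Ixy.
have low z : ~ I z -> exists d, ~ I (hc d z) /\ forall e, (e < d)%N -> I (hc e z).
  move=> nIz; have ex : exists d, ~~ `[< I (hc d z) >].
    apply: contrapT => h; apply: nIz; apply: hideal_comps => // d.
    by apply: contrapT => nd; apply: h; exists d; apply/asboolPn.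
  case: (ex_minnP ex) => d /asboolPn nId dmin; exists d; split=> // e ed.
  apply: contrapT => nIe; have := dmin e; rewrite leqNgt ed /=.
  by move=> h; have : false by apply: h; apply/asboolPn.
apply: contrapT => /not_orP[/low[d [nd ld]] /low[e [ne le]]].
suff : I (hc d x * hc e y) by move=> /(hp _ _ d e (pihomogP _ _ _) (pihomogP _ _ _))[].
have := hcI (d + e)%N _ Ixy.
rewrite {1}(pihomog_sumE (leq_maxl (msize x) d.+1)) mulr_suml pihomog_sum.
have dD : (d < maxn (msize x) d.+1)%N by rewrite leq_max ltnSn orbT.
rewrite (bigD1 (Ordinal dD)) //= addrC => h.
have := idealDr idI _ h => {h}; rewrite [hc d x * y]mulrC addnC (pihomogM _ _ (pihomogP _ _ _)).
rewrite mulrC; apply; apply: ideal_sum => // j jd.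
have [jlt|jge] := ltnP j d.
  by apply: hcI; apply: ideal_mulr => //; apply: ld.
have djlt : (d < j)%N.
  by rewrite ltn_neqAle jge andbT; apply: contraNneq jd => dj; apply/eqP/val_inj.
rewrite mulrC; have [jde|dej] := leqP j (e + d).
  rewrite -(subnK jde) (pihomogM _ _ (pihomogP _ _ _)); apply: ideal_mulr => //.
  by apply: le; rewrite ltn_subLR // addnC ltn_add2r.
by rewrite (pihomogM_lt _ (pihomogP _ _ _)) //; apply: ideal0.
Qed.

(** A homogeneous ideal A maximal among those without growth h is prime. If a b is in A, then
    [colon A a] contains A + (b), so the exact sequence of multiplication by a bounds the Hilbert
    function of A by the sum of those of A + (a) and A + (b), which have growth h. *)
Lemma codim_growth_prime I h : hideal I -> ~ codim_growth I h ->
  exists Q : prime_idealr S, I `<=` [set` Q] /\ ~ codim_growth [set` Q] h.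
Proof.
move=> hI nI.
have [|J [[]]|A [[hA nA] IA Amax]] :=
    @noetherian_max _ (@mpoly_noetherian N k) [set J | hideal J /\ ~ codim_growth J h] I.
  by [].
  by move=> [].
have idA := hA.1.
have A1 : ~ A 1 by move=> A1; apply: nA; apply: codim_growth_all.
suff pA : prime_set A by exists (mk_prime pA); rewrite mk_primeE.
apply: hprime_prime => // a b d e ad be Aab.
apply: contrapT => /not_orP[nAa nAb]; apply: nA.
have big z c : z \is c.-homog -> ~ A z -> codim_growth (add_gen A z) h.
  move=> zc nz; apply: contrapT => ng; apply: nz.
  rewrite -(Amax (add_gen A z)); first exact: add_gen_mem.
    exact: add_gen_sub.
  by split=> //; apply: hideal_add zc.
have [Ca CaP] := big _ _ ad nAa; have [Cb CbP] := big _ _ be nAb.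
exists (Ca + Cb)%N => t; rewrite mulnDl; apply: leq_trans (leq_add (CaP t) (CbP t)).
rewrite -mulnDl leq_mul2r; apply/orP; right.
have idAb := add_gen_ideal b idA.
have [td|dt] := ltnP t d; first by rewrite -(hf_low hA ad td) leq_addr.
rewrite -{1}(subnK dt) (hf_exact _ hA ad) subnK // leq_add2l.
apply: leq_trans (hf_mono idAb (leq_subr d t)).
apply: hf_sub => //; first exact: colon_ideal.
apply: add_gen_min; first exact: colon_ideal.
  exact: sub_colon.
by rewrite /colon /= mulrC.
Qed.

End Growth.

(** * Depth *)

Section Depth.
Variables (N : nat) (k : fieldType).
Local Notation S := {mpoly k[N]}.
Implicit Types (I J p : set S) (f g x y z : S) (fs ys gs : seq S) (d t h r : nat).

Definition hprime p : Prop := forall a b d e,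
  a \is d.-homog -> b \is e.-homog -> p (a * b) -> p a \/ p b.

(** No nonzero element of the quotient is killed by all variables: [I] is saturated and, if
    homogeneous, of positive depth ([common_regular]). *)
Definition irrelevant_free I : Prop := forall g, (forall i, I ('X_i * g)) -> I g.

Lemma regular_mod_homog I z d : hideal I -> z \is d.-homog ->
  (forall t g, g \is t.-homog -> I (z * g) -> I g) -> regular_mod I z.
Proof.
move=> [idI hI] zd zr g Izg; apply: hideal_comps => // t.
apply: (zr t); first exact: pihomogP.
by have := hI (t + d)%N _ Izg; rewrite [z * g]mulrC (pihomogM _ _ zd) mulrC.
Qed.

Lemma mdeg_gt0 (m : 'X_{1..N}) : (0 < mdeg m)%N -> exists i, m i != 0%N.
Proof.
move=> m0; apply/existsP; apply: contraLR m0; rewrite negb_exists => /forallP m0.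
have -> : m = 0%MM by apply/mnmP => i; rewrite mnm0E (eqP (negbNE (m0 i))).
by rewrite mdeg0.
Qed.

Lemma irrelevant_mul I y g : is_ideal I -> hpos y ->
  (forall i, I ('X_i * g)) -> I (y * g).
Proof.
move=> idI [d d0 yd] Ig; rewrite [y]mpolyE mulr_suml; apply: ideal_sum_seq => // m my.
have md : mdeg m = d by move/dhomogP: yd => /(_ _ my).
have [i mi] : exists i, m i != 0%N by apply: mdeg_gt0; rewrite md.
rewrite -(submK (_ : U_(i) <= m)%MM) ?lep1mP // mpolyXD scalerAl -mulrA.
exact: ideal_mull.
Qed.

Lemma irrelevant_free_regular I y : is_ideal I -> hpos y -> regular_mod I y ->
  irrelevant_free I.
Proof. by move=> idI yh yr g Ig; apply/yr/(irrelevant_mul idI yh Ig). Qed.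

Lemma hprimeX p a d e : hprime p -> ~ p 1 -> a \is d.-homog -> p (a ^+ e) -> p a.
Proof.
move=> pp p1 ad; elim: e => [//|e IH]; rewrite exprS => /pp h.
by case: (h d (d * e)%N ad (dhomogMn _ ad)) => // /IH.
Qed.

Lemma colon_prime_finite I : hideal I -> exists gs,
  (forall g, g \in gs -> [/\ exists d, g \is d.-homog, ~ I g & hprime (colon I g)]) /\
  forall z d, z \is d.-homog -> (forall g, g \in gs -> ~ I (z * g)) -> regular_mod I z.
Proof.
move=> hI; have idI := hI.1.
pose G := [set g : S | [/\ exists d, g \is d.-homog, ~ I g &
  forall g' d, g' \is d.-homog -> ~ I g' -> colon I g `<=` colon I g' ->
    colon I g' `<=` colon I g]].
have Gprime g : G g -> hprime (colon I g).
  move=> [[t gt] nIg gmax] a b d e ad be; rewrite /colon /= => Iabg.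
  have [|nb] := pselect (I (b * g)); [by right|left].
  apply: (gmax (b * g) _ (dhomogM be gt) nb).
    by move=> x; rewrite /colon /= mulrCA => Ix; apply: ideal_mull.
  by rewrite /colon /= mulrA.
have [gs [gsG gsE]] := noetherian_subset (@mpoly_noetherian N k) G.
exists gs; split=> [g /gsG Gg|z d zd zgs].
  by have [? ? _] := Gg; split=> //; apply: Gprime.
apply: (regular_mod_homog hI zd) => t g0 g0t Izg0; apply: contrapT => nIg0.
have [|_ [g [d' [_ _ ->]]]|_ [[g [e [ge nIg ->]]] g0g gmax]] :=
    @noetherian_max _ (@mpoly_noetherian N k)
      [set X | exists g d, [/\ g \is d.-homog, ~ I g & X = colon I g]] (colon I g0).
- by exists g0, t.
- exact: colon_ideal.
have Gg : G g.
  split=> [||g' d' g'd nIg' gg']; [by exists e|by []|].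
  have -> // : colon I g' = colon I g by apply: gmax => //; exists g', d'.
(* Otherwise each [colon I g1] has a form outside [colon I g]. The product of these forms multiplies
   all of [gs], hence [g], into [I], although [colon I g] is prime. *)
have [g1 g1gs g1g] : exists2 g1, g1 \in gs & colon I g1 `<=` colon I g.
  apply: contrapT => nex.
  have : forall g1, exists w, g1 \in gs ->
      [/\ exists d, w \is d.-homog, colon I g1 w & ~ colon I g w].
    move=> g1; have [g1gs|] := boolP (g1 \in gs); last by exists 0.
    apply: contrapT => nw; apply: nex; exists g1 => //.
    have [[d1 g1d] _ _] := gsG _ g1gs.
    apply: (hideal_sub (hideal_colon hI g1d)) => [|d2 w w2 wg1].
      exact: colon_ideal.
    by apply: contrapT => nwg; apply: nw; exists w => _; split=> //; exists d2.
  move=> /choice[w wP].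
  have prodP hs : {subset hs <= gs} -> let Z := \prod_(g1 <- hs) w g1 in
      [/\ exists d, Z \is d.-homog, ~ colon I g Z & forall g1, g1 \in hs -> I (Z * g1)].
    elim: hs => [|h hs IH] hsgs /=.
      by rewrite big_nil; split=> //; [exists 0%N; apply: dhomog1|rewrite /colon /= mul1r].
    rewrite big_cons.
    have [[d1 wd] wh nwg] := wP h (hsgs _ (mem_head _ _)).
    have [|[d2 Zd] nZ Zhs] := IH; first by move=> x xhs; apply: hsgs; rewrite inE xhs orbT.
    split; first by exists (d1 + d2)%N; apply: dhomogM.
      by move=> /(Gprime g Gg _ _ _ _ wd Zd)[].
    move=> g1; rewrite inE => /predU1P[->|/Zhs Ig1].
      by rewrite mulrAC; apply: ideal_mulr.
    by rewrite -mulrA; apply: ideal_mull.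
  have [_ nZ Zgs] := prodP gs (fun _ => id); apply: nZ.
  have : gens gs g by rewrite -gsE; apply: ideal_gen_sub.
  have idZ := colon_ideal (\prod_(g1 <- gs) w g1) idI.
  rewrite /colon /= mulrC; apply: (gens_min idZ) => g1 /Zgs.
  by rewrite /colon /= mulrC.
apply: (zgs g1 g1gs); have [_ _ g1max] := gsG _ g1gs.
by apply: (g1max g e ge nIg g1g); apply: g0g.
Qed.

Lemma homog_prime_avoidance (ps : seq (set S)) :
  (forall p, p \in ps -> [/\ hideal p, hprime p & exists i, ~ p 'X_i]) ->
  exists z, hpos z /\ forall p, p \in ps -> ~ p z.
Proof.
have [n] := ubnP (size ps); elim: n ps => // n IH [|p ps] /= szn psP.
  by exists 0; split=> //; exists 1%N => //; apply: dhomog0.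
have psP' q : q \in ps -> [/\ hideal q, hprime q & exists i, ~ q 'X_i].
  by move=> qps; apply: psP; rewrite inE qps orbT.
have [hp pp [i pi]] := psP p (mem_head _ _).
have p1 : ~ p 1 by move=> p1; apply: pi; rewrite -[X in p X]mulr1; apply: ideal_mull => //; case: hp.
(* A prime contained in p is dropped from the list, since whatever lies outside p avoids it too. *)
have [[q qps qp]|nq] := pselect (exists2 q, q \in ps & q `<=` p).
  have [||z [zh zP]] := IH (p :: rem q ps).
  - by rewrite /= size_rem // prednK //; case: (ps) qps.
  - move=> q'; rewrite inE => /predU1P[->|/mem_rem/psP'//].
    by apply: psP; rewrite mem_head.
  exists z; split=> // q'; rewrite inE => /predU1P[->|q'ps].
    by apply: zP; rewrite mem_head.
  have [->|q'q] := eqVneq q' q; first by move=> /qp; apply: zP; rewrite mem_head.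
  apply: zP; rewrite inE; apply/orP; right.
  by have := perm_to_rem qps => /perm_mem/(_ q'); rewrite q'ps inE (negbTE q'q).
have [//||z [[d d0 zd] zP]] := IH ps; first by [].
have [pz|npz] := pselect (p z); last first.
  exists z; split; first by exists d.
  by move=> q; rewrite inE => /predU1P[->//|]; apply: zP.
have : exists w, [/\ exists2 e, (0 < e)%N & w \is e.-homog, ~ p w & forall q, q \in ps -> q w].
  have : forall qs : seq (set S), {subset qs <= ps} -> exists w,
      [/\ exists2 e, (0 < e)%N & w \is e.-homog, ~ p w & forall q, q \in qs -> q w].
    elim=> [|q qs IHq] qsps.
      by exists 'X_i; split=> //; exists 1%N => //; rewrite dhomogX /= mdeg1.
    have [|w [[e e0 we] pw wqs]] := IHq.
      by move=> x xqs; apply: qsps; rewrite inE xqs orbT.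
    have qps := qsps q (mem_head _ _).
    have [hq _ _] := psP' q qps.
    have [v [[c vc] qv pv]] : exists v, [/\ exists c, v \is c.-homog, q v & ~ p v].
      apply: contrapT => nv; apply: nq; exists q => //.
      apply: hideal_sub => //; first by case: hp.
      by move=> c v vc qv; apply: contrapT => pv; apply: nv; exists v; split=> //; exists c.
    exists (v * w); split; first by exists (c + e)%N; rewrite ?addn_gt0 ?e0 ?orbT //; apply: dhomogM.
      by move=> /(pp _ _ _ _ vc we)[].
    move=> q'; rewrite inE => /predU1P[->|/[dup] q'qs /wqs q'w].
      by apply: ideal_mulr => //; case: hq.
    apply: ideal_mull => //; have q'ps := qsps q'; rewrite inE q'qs orbT in q'ps.
    by have [[]] := psP' q' (q'ps isT).
  by move=> /(_ ps (fun _ => id)).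
move=> [w [[e e0 we] pw wps]].
(* The exponents give both terms the degree d e. Modulo p only w^d survives, and modulo each other
   prime only z^e. *)
exists (z ^+ e + w ^+ d); split.
  exists (d * e)%N; first by rewrite muln_gt0 d0.
  by apply: dhomogD; [exact: dhomogMn|rewrite mulnC; exact: dhomogMn].
have pX (q : set S) x c : is_ideal q -> (0 < c)%N -> q x -> q (x ^+ c).
  by move=> idq; case: c => // c _ qx; rewrite exprS; apply: ideal_mulr.
move=> q; rewrite inE => /predU1P[->|qps].
  have idp := hp.1; move=> /(idealDr idp (pX _ _ _ idp e0 pz)).
  by move=> /(hprimeX pp p1 we).
have [hq qp [j qj]] := psP' q qps; have idq := hq.1.
rewrite addrC => /(idealDr idq (pX _ _ _ idq d0 (wps _ qps))) /hprimeX h.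
apply: (zP q qps); apply: (h d) => // q1; apply: qj.
by rewrite -[X in q X]mulr1; apply: ideal_mull.
Qed.

(** For an irrelevant-free ideal, none of the primes of [colon_prime_finite] contains all variables,
    so prime avoidance applies to both lists together. *)
Lemma common_regular I J : hideal I -> hideal J -> irrelevant_free I ->
  irrelevant_free J -> exists z, [/\ hpos z, regular_mod I z & regular_mod J z].
Proof.
move=> hI hJ fI fJ.
have [gs [gsP gsr]] := colon_prime_finite hI.
have [gs' [gsP' gsr']] := colon_prime_finite hJ.
have ok K g : hideal K -> irrelevant_free K ->
    [/\ exists d, g \is d.-homog, ~ K g & hprime (colon K g)] ->
    [/\ hideal (colon K g), hprime (colon K g) & exists i, ~ colon K g 'X_i].
  move=> hK fK [[d gd] nKg pK]; split=> //; first exact: hideal_colon gd.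
  apply: contrapT => nex; apply: nKg; apply: fK => i.
  by apply: contrapT => ni; apply: nex; exists i.
have [|z [zh zP]] := @homog_prime_avoidance
    ([seq colon I g | g <- gs] ++ [seq colon J g | g <- gs']).
  move=> q; rewrite mem_cat => /orP[] /mapP[g ggs ->].
    exact/ok/gsP.
  exact/ok/gsP'.
have [d _ zd] := zh; exists z; split=> //.
  apply: (gsr z d zd) => g ggs; apply: (zP (colon I g)).
  by rewrite mem_cat map_f.
apply: (gsr' z d zd) => g ggs; apply: (zP (colon J g)).
by rewrite mem_cat [X in _ || X]map_f ?orbT.
Qed.

Definition depth_ge I r : Prop :=
  exists ys, [/\ size ys = r, forall y, y \in ys -> hpos y & regular_seq I ys].

Lemma depth_ge0 I : depth_ge I 0.
Proof. by exists [::]. Qed.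

Lemma depth_ge_cons I y r : hpos y -> regular_mod I y -> depth_ge (add_gen I y) r ->
  depth_ge I r.+1.
Proof.
move=> yh yr [ys [<- ysh ysr]]; exists (y :: ys); split=> //.
by move=> x; rewrite inE => /predU1P[->//|/ysh].
Qed.

Lemma add_gen_homog I f d t g : hideal I -> f \is d.-homog -> g \is t.-homog ->
  add_gen I f g -> (t < d)%N /\ I g \/
  exists i a, [/\ (d <= t)%N, I i, a \is (t - d).-homog & g = i + a * f].
Proof.
move=> hI fd gt fg; have [td|dt] := ltnP t d.
  by left; split=> //; apply: (add_gen_low hI fd td); split=> //; apply: homs_deg_le.
right; have [i [a [Ii gE]]] := fg; exists (hc t i), (hc (t - d) a); split=> //.
- exact: hI.2.
- exact: pihomogP.
- rewrite -(pihomogM _ _ fd) subnK // -pihomogD -gE.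
  by rewrite (pihomog_homog _ gt) eqxx.
Qed.

Lemma regular_mod_graded I x y e : hideal I -> hpos x -> y \is e.-homog ->
  regular_mod I x -> regular_mod (add_gen I x) y -> regular_mod I y.
Proof.
move=> hI [d d0 xd] ye xr yr; have idI := hI.1; apply: (regular_mod_homog hI ye).
elim/ltn_ind => t IH g gt Iyg.
have := yr g (add_gen_sub x Iyg); move=> /(add_gen_homog hI xd gt)[[]//|].
move=> [i [a [dt Ii ah gE]]].
suff Ia : I a by rewrite gE; apply: idealD => //; apply: ideal_mulr.
apply: (IH (t - d)%N) => //; first by rewrite ltn_subrL d0 (leq_trans d0).
apply: xr; move: Iyg; rewrite gE mulrDr => /(idealDr idI (ideal_mull idI y Ii)).
by rewrite mulrA mulrC.
Qed.

(** Independence of depth from the chosen sequence. A form [w], regular modulo both I + (z) and I +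
    (y1), takes the place of y1: the induction hypothesis is applied to w over I + (y1), and then,
    the factors being swapped, to z over I + (w). *)
Lemma depth_ge_regular I z r : hideal I -> hpos z -> regular_mod I z ->
  depth_ge I r.+1 -> depth_ge (add_gen I z) r.
Proof.
elim: r I z => [|r IH] I z hI zh zr dI; first exact: depth_ge0.
have [[|y1 [|y2 ys]] [//= [szys] ysh [y1r [y2r ysr]]]] := dI.
have y1h : hpos y1 by apply: ysh; rewrite mem_head.
have y2h : hpos y2 by apply: ysh; rewrite !inE eqxx orbT.
have idI := hI.1.
have hadd K x : hideal K -> hpos x -> hideal (add_gen K x).
  by move=> hK [d _ xd]; apply: hideal_add xd.
(* If all variables kill g modulo I + (z), so do y1 and y2: y1 g = u z and y2 g = v z modulo [I].
   Cancelling z gives y2 u = y1 v, so u = y1 w because y1, y2 is regular, and then g = z w. *)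
have fz : irrelevant_free (add_gen I z).
  move=> g Ig; have := irrelevant_mul (add_gen_ideal z idI) y1h Ig.
  move=> [i [u [Ii y1g]]].
  have := irrelevant_mul (add_gen_ideal z idI) y2h Ig; move=> [i' [v [Ii' y2g]]].
  have /y2r[j [w [Ij uE]]] : add_gen I y1 (y2 * u).
    have : I (z * (y2 * u - y1 * v)).
      have -> : z * (y2 * u - y1 * v) = y1 * i' - y2 * i.
        have -> : i = y1 * g - u * z by rewrite y1g addrK.
        have -> : i' = y2 * g - v * z by rewrite y2g addrK.
        rewrite !mulrBr [y1 * (y2 * g)]mulrCA opprB [RHS]addrC addrA subrK.
        by rewrite ![z * _]mulrC -!mulrA.
      by apply: idealB => //; apply: ideal_mull.
    move=> /zr h; exists (y2 * u - y1 * v), v; split=> //.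
    by rewrite [v * y1]mulrC subrK.
  suff : I (g - z * w) by move=> h; exists (g - z * w), w; rewrite [w * z]mulrC subrK.
  apply: y1r; rewrite mulrBr y1g uE.
  have -> : i + (j + w * y1) * z - y1 * (z * w) = i + j * z.
    by rewrite mulrDl addrA -[w * y1 * z]mulrA [w * _]mulrC -mulrA addrK.
  by apply: idealD => //; apply: ideal_mulr.
have fy1 := irrelevant_free_regular (add_gen_ideal y1 idI) y2h y2r.
have [w [wh wz wy]] := common_regular (hadd _ _ hI zh) (hadd _ _ hI y1h) fz fy1.
have [e _ we] := wh.
have wI : regular_mod I w by apply: (regular_mod_graded hI zh we zr wz).
have d1 : depth_ge (add_gen (add_gen I y1) w) r.
  apply: IH => //; first exact: hadd.
  by exists (y2 :: ys); split=> //= [|y yys]; [rewrite szys|apply: ysh; rewrite inE yys orbT].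
have d2 : depth_ge (add_gen I w) r.+1.
  apply: (depth_ge_cons y1h); first exact: regular_mod_swap wy.
  by rewrite add_genC.
apply: (depth_ge_cons wh wz); rewrite add_genC; apply: IH => //; first exact: hadd.
exact: regular_mod_swap wz.
Qed.

Lemma depth_ge_zero : depth_ge [set 0] N.
Proof.
exists [seq 'X_i | i <- enum 'I_N]; split; last exact: regular_seq_vars.
  by rewrite size_map size_enum_ord.
by move=> _ /mapP[i _ ->]; apply: hpos_var.
Qed.

Lemma depth_ge_regular_seq I fs r : hideal I -> (forall f, f \in fs -> hpos f) ->
  regular_seq I fs -> depth_ge I (size fs + r) -> depth_ge (gens_over I fs) r.
Proof.
elim: fs I => //= f fs IH I hI fsh [fr fsr] dI.
have fh := fsh f (mem_head _ _); apply: IH => //.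
- by have [d _ fd] := fh; apply: hideal_add fd.
- by move=> g gfs; apply: fsh; rewrite inE gfs orbT.
- exact: depth_ge_regular.
Qed.

Lemma depth_ge_le I r r' : (r' <= r)%N -> depth_ge I r -> depth_ge I r'.
Proof.
move=> rr [ys [ysz ysh ysr]]; exists (take r' ys); split.
- by rewrite size_takel // ysz.
- by move=> y /mem_take/ysh.
- by have := ysr; rewrite -{1}(cat_take_drop r' ys) => /regular_seq_cat[].
Qed.

(* Unmixedness: no element is annihilated by an ideal of too small dimension. *)
Lemma depth_colon_growth I g d r h : hideal I -> g \is d.-homog -> ~ I g ->
  depth_ge I r -> (N < h + r)%N -> ~ codim_growth (colon I g) h.
Proof.
move=> hI gd nIg [ys [<- ysh ysr]]; elim: ys I g d h hI gd nIg ysh ysr => [|y ys IH] /=.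
  move=> I g d h hI gd nIg _ _; rewrite addn0 ltnNge => /negP Nh.
  move=> /codim_growth_bound cg; apply/Nh/cg; first exact/colon_ideal/hI.1.
  by rewrite /colon /= mul1r.
move=> I g d h hI gd nIg ysh [yr ysr] Nh.
have [e e0 ye] := ysh y (mem_head _ _); have idI := hI.1.
(* As long as g is a multiple a y modulo [I], it is replaced by a, which has smaller degree and, y
   being regular, the same colon ideal. *)
have [g' [d' [g'd nIg' <-]]] : exists g' d',
    [/\ g' \is d'.-homog, ~ add_gen I y g' & colon I g' = colon I g].
  elim/ltn_ind: d g gd nIg => d IHd g gd nIg.
  have [|nyg] := pselect (add_gen I y g); last by exists g, d.
  move=> /(add_gen_homog hI ye gd)[[]//|[i [a [ed Ii ah gE]]]].
  have aE : colon I a = colon I g.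
    rewrite eqEsubset; split=> x; rewrite /colon /= gE mulrDr.
      move=> Ia; apply: idealD => //; first exact: ideal_mull.
      by rewrite mulrA; apply: ideal_mulr.
    move=> /(idealDr idI (ideal_mull idI x Ii)); rewrite mulrA mulrC.
    exact: yr.
  have nIa : ~ I a by move=> Ia; apply: nIg; rewrite gE; apply: idealD => //; apply: ideal_mulr.
  have [|g' [d' [g'd ng' g'E]]] := IHd (d - e)%N _ a ah nIa.
    by rewrite ltn_subrL e0 (leq_trans e0).
  by exists g', d'; rewrite g'E.
move=> cg; have hIy := hideal_add hI ye.
apply: (IH (add_gen I y) g' d' h.+1) => //.
- by move=> x xys; apply: ysh; rewrite inE xys orbT.
- by rewrite addSn -addnS.
apply: (@codim_growth_regular _ _ _ _ y _ (colon_ideal g' idI) (colon_ideal g' hIy.1) _ _ _ cg).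
- by move=> x; rewrite /colon /=; apply: add_gen_sub.
- by rewrite /colon /= mulrC; apply: add_gen_mul.
- exact: regular_mod_colon.
Qed.

(** Parameters of a Cohen-Macaulay quotient are regular. If [f] were a zero divisor, some
    [colon I g] with g outside [I] would contain I + (f) and inherit its growth j + 1, against
    unmixedness. *)
Lemma growth_regular_seq_over I fs j : hideal I -> ~ I 1 -> (j <= N)%N ->
  depth_ge I (N - j) -> (forall f, f \in fs -> hpos f) ->
  codim_growth (gens_over I fs) (j + size fs) -> regular_seq I fs.
Proof.
elim: fs I j => //= f fs IH I j hI I1 jN dI fsh cg.
have fh := fsh f (mem_head _ _); have [d d0 fd] := fh; have idI := hI.1.
have fsh' g : g \in fs -> hpos g by move=> gfs; apply: fsh; rewrite inE gfs orbT.
have hIf := hideal_add hI fd; have If1 := hideal_add_proper hI I1 fh.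
have cgf : codim_growth (add_gen I f) j.+1.
  by apply: (codim_growth_lift_seq hIf fsh'); rewrite addSn -addnS.
have jltN : (j < N)%N by apply: codim_growth_bound cgf => //; exact: hIf.1.
have fr : regular_mod I f.
  apply: (regular_mod_homog hI fd) => t g gt Ifg; apply: contrapT => nIg.
  apply: (depth_colon_growth hI gt nIg dI (h := j.+1)).
    by rewrite addSn subnKC // ltnW.
  apply: codim_growthS cgf; [exact: hIf.1|exact: colon_ideal|].
  by apply: add_gen_min => //; [exact: colon_ideal|exact: sub_colon].
split=> //; apply: (IH _ j.+1) => //; last by rewrite addSn -addnS.
by apply: depth_ge_regular => //; rewrite -subSn.
Qed.

Lemma growth_regular_seq fs : (forall f, f \in fs -> hpos f) ->
  codim_growth (gens fs) (size fs) -> regular_seq [set 0] fs.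
Proof.
move=> fsh cg; apply: (@growth_regular_seq_over _ _ 0) => //.
- exact: hideal_zero.
- by move=> /eqP; rewrite oner_eq0.
- by rewrite subn0; apply: depth_ge_zero.
Qed.

Lemma regular_seq_depth fs r : (forall f, f \in fs -> hpos f) ->
  regular_seq [set 0] fs -> (size fs + r <= N)%N -> depth_ge (gens fs) r.
Proof.
move=> fsh fsr szN; apply: depth_ge_regular_seq => //; first exact: hideal_zero.
exact: depth_ge_le szN depth_ge_zero.
Qed.

End Depth.

(** * Complete intersections *)

Section MinimalGenerators.
Variables (N : nat) (k : fieldType).
Local Notation S := {mpoly k[N]}.
Implicit Types (I J : set S) (f g : S) (fs es : seq S).

Definition irredundant (R : comNzRingType) (fs : seq R) : Prop :=
  forall i, (i < size fs)%N -> ~ gens (take i fs ++ drop i.+1 fs) fs`_i.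

Definition homogs fs : Prop := forall f, f \in fs -> exists d, f \is d.-homog.

Lemma pihomog0E (a : S) : hc 0 a = (a@_0%MM)%:MP.
Proof.
apply/mpolyP => m; rewrite mcoeff_pihomog mcoeffC mdeg_eq0.
by case: eqP => [->|]; rewrite ?mulr1 ?mulr0.
Qed.

Lemma hideal_scaled J f d a : hideal J -> f \is d.-homog -> J (a * f) ->
  a@_0%MM != 0 -> J f.
Proof.
move=> [idJ hJ] fd Jaf a0; have := hJ (0 + d)%N _ Jaf.
rewrite (pihomogM _ _ fd) pihomog0E mul_mpolyC => /(subspZ (ideal_subspace idJ) (a@_0%MM)^-1).
by rewrite scalerA mulVf // scale1r.
Qed.

Lemma mem_take_drop (T : eqType) (s : seq T) (x0 : T) i j : (i < size s)%N ->
  j != i -> nth x0 s i \in take j s ++ drop j.+1 s.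
Proof.
move=> si ji; rewrite mem_cat; have [ij|ji'] := ltnP i j.
  by apply/orP; left; rewrite -(nth_take x0 ij) mem_nth // size_take_min leq_min ij.
have jlt : (j < i)%N by rewrite ltn_neqAle ji.
apply/orP; right; rewrite -{1}(subnKC jlt) -nth_drop mem_nth // size_drop.
by rewrite ltn_sub2r // (leq_ltn_trans jlt).
Qed.

(** Graded Nakayama, where [es] may be inhomogeneous. Write [fs] in terms of [es] and keep constant
    terms: with too many [fs] there is a linear relation v among the rows. Substituting back gives
    sum v_l f_l = sum q_l f_l with q_l(0) = 0, so some f_i, multiplied by a polynomial with nonzero
    constant term, lies in the ideal of the others; its component in degree deg f_i shows
    redundancy. *)
Lemma irredundant_size_le fs es : homogs fs -> irredundant fs -> gens fs = gens es ->
  (size fs <= size es)%N.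
Proof.
move=> fsh irr fsE; rewrite leqNgt; apply/negP => lt.
have /choice[a aE] : forall i : 'I_(size fs), exists a : 'I_(size es) -> S,
    fs`_i = \sum_j a j * es`_j.
  by move=> i; apply: gens_lin; rewrite -fsE; apply/gens_mem/mem_nth.
have /choice[b bE] : forall j : 'I_(size es), exists b : 'I_(size fs) -> S,
    es`_j = \sum_i b i * fs`_i.
  by move=> j; apply: gens_lin; rewrite fsE; apply/gens_mem/mem_nth.
pose C := \matrix_(i < size fs, j < size es) (a i j)@_0%MM.
have : kermx C != 0.
  rewrite -mxrank_eq0 mxrank_ker subn_eq0 -ltnNge.
  exact: leq_ltn_trans (rank_leq_col _) lt.
case/rowV0Pn => v /sub_kermxP vC v0.
have [i vi] : exists i, v ord0 i != 0.
  apply: contrapT => h; case/negP: v0; apply/eqP/rowP => i; rewrite mxE.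
  by apply: contrapT => /eqP vi; apply: h; exists i.
pose p j := \sum_i (v ord0 i)%:MP * a i j.
have p0 j : (p j)@_0%MM = 0.
  have /matrixP/(_ ord0 j) := vC; rewrite !mxE => <-.
  rewrite raddf_sum /=; apply: eq_bigr => l _.
  by rewrite mcoeffCM mxE.
pose q l := \sum_j p j * b j l.
have q0 l : (q l)@_0%MM = 0.
  rewrite raddf_sum big1 //= => j _.
  by rewrite (rmorphM (mcoeff 0%MM)) /= p0 mul0r.
have E : \sum_l (v ord0 l)%:MP * fs`_l = \sum_l q l * fs`_l.
  under eq_bigr do rewrite aE mulr_sumr; rewrite exchange_big /=.
  under [RHS]eq_bigr do rewrite mulr_suml; rewrite [RHS]exchange_big /=.
  apply: eq_bigr => j _; under [RHS]eq_bigr do rewrite -mulrA; rewrite -mulr_sumr -bE.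
  by rewrite mulr_suml; apply: eq_bigr => l _; rewrite mulrA.
set O := gens (take i fs ++ drop i.+1 fs).
have hO : hideal O.
  apply: hideal_gens => f; rewrite mem_cat => /orP[/mem_take|/mem_drop]; exact: fsh.
have [d fd] := fsh _ (mem_nth 0 (ltn_ord i)).
apply: (irr i (ltn_ord i)); apply: (hideal_scaled hO fd (a := (v ord0 i)%:MP - q i)).
  have : \sum_l ((v ord0 l)%:MP - q l) * fs`_l = 0.
    by under eq_bigr do rewrite mulrBl; rewrite sumrB E subrr.
  rewrite (bigD1 i) //= => /eqP; rewrite addr_eq0 => /eqP ->.
  apply: idealN; first exact: hO.1.
  apply: ideal_sum => [|l li]; first exact: hO.1.
  apply: ideal_mull; first exact: hO.1.
  by apply/gens_mem/mem_take_drop; rewrite // eq_sym.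
by rewrite mcoeffB mcoeffC eqxx mulr1 q0 subr0.
Qed.

Lemma irredundant_gens_exist J : hideal J ->
  exists fs, [/\ homogs fs, irredundant fs & J = gens fs].
Proof.
move=> [idJ hJ]; pose P r := `[< exists fs, [/\ homogs fs, size fs = r & J = gens fs] >].
have exP : exists r, P r.
  have [gs JE] := mpoly_noetherian idJ.
  pose fs := [seq hc d g | g <- gs, d <- iota 0 (msize g)].
  exists (size fs); apply/asboolP; exists fs; split=> //.
    by move=> f /allpairsPdep[g [d [_ _ ->]]]; exists d; apply: pihomogP.
  rewrite eqEsubset; split; last first.
    apply: gens_min => // f /allpairsPdep[g [d [ggs _ ->]]].
    by apply: hJ; rewrite JE; apply: gens_mem.
  rewrite [X in X `<=` _]JE; apply: gens_min => [|g ggs]; first exact: gens_ideal.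
  rewrite (pihomog_sumE (leqnn (msize g))); apply: ideal_sum => [|d _].
    exact: gens_ideal.
  apply/gens_mem/allpairsPdep; exists g, (nat_of_ord d); split=> //.
  by rewrite mem_iota add0n ltn_ord.
case: (ex_minnP exP) => r /asboolP[fs [fsh szfs JE]] rmin.
exists fs; split=> // i ilt irr.
suff : P r.-1.
  by move=> /rmin; rewrite leqNgt => /negP; apply; rewrite ltn_predL -szfs (leq_trans _ ilt).
apply/asboolP; exists (take i fs ++ drop i.+1 fs); split.
- by move=> f; rewrite mem_cat => /orP[/mem_take|/mem_drop]; apply: fsh.
- by rewrite size_cat size_drop size_takel ?(ltnW ilt) // -szfs -[in RHS](subnKC ilt).
- rewrite JE eqEsubset; split; apply: gens_min; try exact: gens_ideal.
    move=> f ffs; have [->|fi] := eqVneq f fs`_i; first exact: irr.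
    have h : (index f fs < size fs)%N by rewrite index_mem.
    rewrite -(nth_index 0 ffs); apply/gens_mem/mem_take_drop => //.
    by apply: contraNneq fi => ->; rewrite nth_index.
  by move=> f; rewrite mem_cat => /orP[/mem_take|/mem_drop]; apply: gens_mem.
Qed.

Lemma homog_proper_hpos J f : is_ideal J -> ~ J 1 -> J f ->
  (exists d, f \is d.-homog) -> hpos f.
Proof.
move=> idJ J1 Jf [[|d] fd]; last by exists d.+1.
have fE : f = (f@_0%MM)%:MP by rewrite -pihomog0E (pihomog_homog _ fd).
have [f0|f0] := eqVneq (f@_0%MM) 0.
  by exists 1%N => //; rewrite fE f0; apply: dhomog0.
case: J1; have := subspZ (ideal_subspace idJ) (f@_0%MM)^-1 Jf.
by rewrite {2}fE -mul_mpolyC -rmorphM /= mulVf // rmorph1.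
Qed.

Definition regular_ci J : Prop :=
  exists fs, [/\ forall f, f \in fs -> hpos f, regular_seq [set 0] fs & J = gens fs].

Lemma gens_proper fs : (forall f, f \in fs -> hpos f) -> ~ gens fs 1.
Proof.
move=> fsh; apply: hideal_gens_over_proper => //; first exact: hideal_zero.
by move=> /eqP; rewrite oner_eq0.
Qed.

(** Krull's height bound in terms of growth: otherwise lifting through all of [fs] would give the
    zero ideal growth 1. *)
Lemma gens_codim_growth fs h : (forall f, f \in fs -> hpos f) ->
  codim_growth (gens fs) h -> (h <= size fs)%N.
Proof.
move=> fsh cg; rewrite leqNgt; apply/negP => lt.
apply: (@codim_growth_zero N k).
apply: (codim_growth_lift_seq (@hideal_zero N k) fsh).
exact: codim_growth_le cg.
Qed.

Lemma regular_seq_growth fs : regular_seq [set 0] fs -> codim_growth (gens fs) (size fs).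
Proof.
move=> fsr; have idz := @ideal_zero S.
exact: (codim_growth_regular_seq idz fsr (codim_growth0 idz)).
Qed.

(** Failure of growth is always visible at one prime ([codim_growth_prime]). Hence heights of all
    primes over [J] force growth h, and irredundant homogeneous generators, at most h in number, are
    regular. Conversely, the regular sequence bounds heights below, and the failure of growth one
    beyond its length yields the prime that bounds them above. *)
Lemma complete_intersectionP J : hideal J -> complete_intersection J <-> regular_ci J.
Proof.
move=> hJ; split.
  move=> [idJ J1 [h [[[e JE] _] [Jh _]]]].
  have cg : codim_growth J h.
    apply: contrapT => /(codim_growth_prime hJ)[Q [JQ nQ]].
    exact/nQ/codim_growth_prime_height/Jh.
  have [fs [fsh irr JE']] := irredundant_gens_exist hJ.
  have fsp f : f \in fs -> hpos f.
    move=> ffs; apply: (homog_proper_hpos idJ J1); last exact: fsh.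
    by rewrite JE'; apply: gens_mem.
  exists fs; split=> //; apply: growth_regular_seq => //; rewrite -JE'.
  apply: codim_growth_le cg.
  have := irredundant_size_le fsh irr (es := [seq e i | i : 'I_h]).
  rewrite size_map size_enum_ord; apply.
  by rewrite -gens_range -JE.
move=> [fs [fsh fsr JE]]; split; first exact: hJ.1.
  by rewrite JE; apply: gens_proper.
exists (size fs); split; split.
- by rewrite JE; apply: generated_by_gens.
- move=> s [e JE'].
  have [gs [gsh irr JE'']] := irredundant_gens_exist hJ.
  have le : (size gs <= s)%N.
    have := irredundant_size_le gsh irr (es := [seq e i | i : 'I_s]).
    rewrite size_map size_enum_ord; apply.
    by rewrite -gens_range -JE' JE''.
  apply: leq_trans le; apply: gens_codim_growth.
    move=> g ggs; apply: (homog_proper_hpos hJ.1); last exact: gsh.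
      by rewrite JE; apply: gens_proper.
    by rewrite JE''; apply: gens_mem.
  by rewrite -JE'' JE; apply: regular_seq_growth.
- by move=> Q; rewrite JE; apply: prime_height_regular.
- have [|Q [JQ nQ]] := codim_growth_prime hJ (h := (size fs).+1).
    by rewrite JE => /(gens_codim_growth fsh); rewrite ltnn.
  by exists Q; split=> // /codim_growth_prime_height.
Qed.

End MinimalGenerators.

(** * Gluing fractions in depth two *)

Section DepthTwo.
Variables (N : nat) (k : fieldType).
Local Notation S := {mpoly k[N]}.
Implicit Types (J : set S) (f g p w : S) (e : nat).

Lemma irrelevant_free_monomials J e f : irrelevant_free J ->
  (forall m : 'X_{1..N}, mdeg m = e -> J ('X_[m] * f)) -> J f.
Proof.
move=> fJ; elim: e f => [|e IH] f Jf.
  by have := Jf 0%MM mdeg0; rewrite mpolyX0 mul1r.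
apply: IH => m me; apply: fJ => i.
by rewrite mulrA -mpolyXD; apply: Jf; rewrite mdegD mdeg1 me.
Qed.

(** The fractions u a / x^a agree modulo [J]; each monomial of [p] has degree at least e, so it
    absorbs a denominator x^a, and [p] times the common fraction is a polynomial. *)
Lemma family_combination J e (u : 'X_{1..N} -> S) p : is_ideal J ->
  (forall a b, mdeg a = e -> mdeg b = e -> J ('X_[b] * u a - 'X_[a] * u b)) ->
  (forall m, m \in msupp p -> (e <= mdeg m)%N) ->
  exists w, forall b, mdeg b = e -> J ('X_[b] * w - p * u b).
Proof.
move=> idJ Ju pe.
have /choice[ab abP] : forall m : 'X_{1..N}, exists ab : 'X_{1..N} * 'X_{1..N},
    (e <= mdeg m)%N -> m = (ab.1 + ab.2)%MM /\ mdeg ab.1 = e.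
  move=> m; have [em|_] := leqP e (mdeg m); last by exists (0%MM, 0%MM).
  by have [a [b [mE ae]]] := monomial_splitting em; exists (a, b).
exists (\sum_(m <- msupp p) p@_m *: 'X_[(ab m).2] * u (ab m).1) => b be.
rewrite mulr_sumr {3}[p]mpolyE mulr_suml -sumrB.
apply: ideal_sum_seq => // m mp; have [mE ae] := abP m (pe m mp).
rewrite [X in _ - X](_ : _ =
  p@_m *: 'X_[(ab m).2] * ('X_[(ab m).1] * u b)); last first.
  by rewrite {2}mE mpolyXD -!scalerAl mulrA ['X_[(ab m).1] * _]mulrC.
by rewrite mulrCA -mulrBr; apply: ideal_mull => //; apply: Ju.
Qed.

(* Vanishing of the first local cohomology of the quotient by [J]: a family of
   compatible fractions [u a / x^a] is given by one polynomial. *)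
Lemma depth_two_family J e (u : 'X_{1..N} -> S) : hideal J -> depth_ge J 2 ->
  (forall a b, mdeg a = e -> mdeg b = e -> J ('X_[b] * u a - 'X_[a] * u b)) ->
  exists w, forall a, mdeg a = e -> J (u a - 'X_[a] * w).
Proof.
move=> hJ [ys [sz ysh ysr]] Ju.
case: ys sz ysh ysr => [|y1 [|y2 [|//]]] //= _ ysh [y1r [y2r _]].
have idJ := hJ.1.
have y1h : hpos y1 by apply: ysh; rewrite mem_head.
have [d1 d10 y1d] := y1h.
have [d2 d20 y2d] : hpos y2 by apply: ysh; rewrite !inE eqxx orbT.
have fJ := irrelevant_free_regular idJ y1h y1r.
have high (y : S) d : (0 < d)%N -> y \is d.-homog ->
    forall m, m \in msupp (y ^+ e) -> (e <= mdeg m)%N.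
  move=> d0 yd m my; have /dhomogP/(_ m my) /= -> := dhomogMn e yd.
  by rewrite leq_pmull.
(* w1 and w2 represent the common fraction times the powers p1 of y1 and p2 of y2. From p2 w1 = p1
   w2 modulo [J] and regularity, w2 = p2 w and w1 = p1 w, so w is the fraction itself. *)
have [w1 w1P] := family_combination idJ Ju (high _ _ d10 y1d).
have [w2 w2P] := family_combination idJ Ju (high _ _ d20 y2d).
set p1 := y1 ^+ e in w1P; set p2 := y2 ^+ e in w2P.
have p2r := regular_modX y2r (b := e).
have p2J : regular_mod J p2.
  exact: (regular_mod_graded hJ y1h (dhomogMn e y2d) y1r p2r).
have p1J2 : regular_mod (add_gen J p2) p1.
  by apply: regular_modX; apply: regular_mod_swap p2r.
have p1J : regular_mod J p1 by apply: regular_modX.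
have J12 : J (p2 * w1 - p1 * w2).
  apply: (irrelevant_free_monomials fJ (e := e)) => b be.
  have := idealB idJ (ideal_mull idJ p2 (w1P b be)) (ideal_mull idJ p1 (w2P b be)).
  congr J; rewrite !mulrBr [p1 * (p2 * _)]mulrCA opprB addrA subrK.
  by rewrite [p2 * ('X_[b] * _)]mulrCA [p1 * ('X_[b] * _)]mulrCA.
have /p1J2[j [w [Jj w2E]]] : add_gen J p2 (p1 * w2).
  exists (- (p2 * w1 - p1 * w2)), w1; split; first exact: idealN.
  by rewrite opprB [w1 * p2]mulrC subrK.
exists w => a ae; apply: p1J.
have J1 : J (w1 - p1 * w).
  apply: p2J; have := idealD idJ J12 (ideal_mull idJ p1 Jj).
  congr J; rewrite w2E !mulrDr [w * p2]mulrC [p1 * (p2 * w)]mulrCA opprD.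
  by rewrite addrA addrAC subrK mulrN.
have := idealB idJ (ideal_mull idJ 'X_[a] J1) (w1P a ae).
congr J; rewrite !mulrBr opprB [p1 * ('X_[a] * w)]mulrCA.
by rewrite addrC addrA subrK.
Qed.

End DepthTwo.

(** * Hilbert functions from standard monomials *)

Section HilbertFunctions.
Variable N : nat.

Definition monos t : seq 'X_{1..N} :=
  [seq val m | m <- enum {: 'X_{1..N < t.+1}} & mdeg (val m) == t].

Lemma monos_uniq t : uniq (monos t).
Proof. by rewrite (map_inj_uniq val_inj) filter_uniq ?enum_uniq. Qed.

Lemma mem_monos t m : (m \in monos t) = (mdeg m == t).
Proof.
apply/mapP/eqP => [[m' + ->]|mt]; first by rewrite mem_filter => /andP[/eqP].
have mlt : (mdeg m < t.+1)%N by rewrite mt.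
by exists (BMultinom mlt) => //; rewrite mem_filter /= mt eqxx mem_enum.
Qed.

Lemma homog_monosE (R : comNzRingType) (f : {mpoly R[N]}) (ms : seq 'X_{1..N}) :
  uniq ms -> (forall m, m \in msupp f -> m \in ms) ->
  f = \sum_(i < size ms) f@_(nth 0%MM ms i) *: 'X_[nth 0%MM ms i].
Proof.
move=> ums fms.
have -> : \sum_(i < size ms) f@_(nth 0%MM ms i) *: 'X_[nth 0%MM ms i] =
    \sum_(m <- ms) f@_m *: 'X_[m].
  by rewrite (big_nth 0%MM) big_mkord.
apply/mpolyP => m; rewrite raddf_sum /=.
under eq_bigr do rewrite mcoeffZ mcoeffX.
have [mms|mms] := boolP (m \in ms).
  rewrite (bigD1_seq m) //= eqxx mulr1 big1 ?addr0 // => m' /negbTE->.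
  by rewrite mulr0.
rewrite big1_seq => [|m' /andP[_ m'ms]].
  by apply/memN_msupp_eq0; apply: contra mms; apply: fms.
by case: eqP mms => [<-|_ _]; rewrite ?m'ms ?mulr0.
Qed.

Lemma mcoeff_monos_sum (R : comNzRingType) (ms : seq 'X_{1..N}) (c : 'I_(size ms) -> R)
    (j : 'I_(size ms)) : uniq ms ->
  (\sum_l c l *: 'X_[nth 0%MM ms l])@_(nth 0%MM ms j) = c j.
Proof.
move=> ums; rewrite raddf_sum (bigD1 j) //= big1 ?addr0 => [|l lj].
  by rewrite mcoeffZ mcoeffX eqxx mulr1.
rewrite mcoeffZ mcoeffX nth_uniq // (_ : _ == _ = false) ?mulr0 //.
by apply: contraNF lj => /eqP lj; apply/eqP/val_inj.
Qed.

Lemma msupp_monos_sum (R : comNzRingType) (ms : seq 'X_{1..N}) (c : 'I_(size ms) -> R) m :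
  m \in msupp (\sum_j c j *: 'X_[nth 0%MM ms j]) -> m \in ms.
Proof.
rewrite mcoeff_msupp raddf_sum /=; apply: contraNT => mms; apply/eqP.
rewrite big1 // => j _; rewrite mcoeffZ mcoeffX.
by case: eqP mms => [<-|_ _]; rewrite ?mem_nth ?mulr0.
Qed.

Variable k : fieldType.
Local Notation S := {mpoly k[N]}.
Implicit Types (I J : set S) (B : seq 'X_{1..N}) (t : nat).

Lemma gf_standard_le J B t : is_ideal J ->
  (forall f : S, f \is t.-homog -> exists r : S, [/\ J (f - r), r \is t.-homog & std_supp B r]) ->
  (gf J t <= size [seq m <- monos t | standard B m])%N.
Proof.
move=> idJ div; apply: (@qdim_le_span _ _ _ _ _
  (fun i => 'X_[nth 0%MM [seq m <- monos t | standard B m] i] : S)).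
  exact: ideal_subspace.
move=> f /div[r [Jr rt rB]].
exists (fun i => r@_(nth 0%MM [seq m <- monos t | standard B m] i)).
rewrite -homog_monosE //; first by rewrite filter_uniq // monos_uniq.
move=> m mr; rewrite mem_filter rB // mem_monos.
by have /dhomogP/(_ m mr) /= -> := rt.
Qed.

Lemma gf_standard_ge J B t : is_ideal J ->
  (forall f : S, J f -> std_supp B f -> f = 0) ->
  (size [seq m <- monos t | standard B m] <= gf J t)%N.
Proof.
move=> idJ indep; set ms := [seq m <- monos t | standard B m].
have ums : uniq ms by rewrite filter_uniq // monos_uniq.
apply: (@qdim_ge_free _ _ _ _ _ (fun i : 'I_(size ms) => 'X_[nth 0%MM ms i] : S)).
- exact: ideal_subspace.
- exact: finmod_homs.
- move=> i; rewrite /homs /= dhomogX /=.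
  by have := mem_nth 0%MM (ltn_ord i); rewrite mem_filter mem_monos => /andP[].
move=> c Jc i; have c0 := indep _ Jc.
have := mcoeff_monos_sum c i ums; rewrite c0 ?mcoeff0 // => m /msupp_monos_sum.
by rewrite mem_filter => /andP[].
Qed.

Lemma gf_standard J B G t : hideal J -> std_basis J B G ->
  gf J t = size [seq m <- monos t | standard B m].
Proof.
move=> hJ sb; have idJ := hJ.1; apply/eqP; rewrite eqn_leq; apply/andP; split.
  apply: gf_standard_le => // f ft.
  have [r [Jr rt rP]] :=
    division_homog idJ (stdb_mem sb) (stdb_lead sb) (stdb_le sb) hJ ft.
  by exists r; split=> // m /rP /andP[].
by apply: gf_standard_ge => //; apply: stdb_indep sb.
Qed.

Lemma gf_zero t : gf [set (0 : S)] t = size (monos t).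
Proof.
have allstd : [seq m <- monos t | standard [::] m] = monos t by apply/all_filterP/allP.
rewrite -allstd; apply/eqP; rewrite eqn_leq; apply/andP; split.
  apply: gf_standard_le => [|f ft]; first exact: ideal_zero.
  by exists f; rewrite subrr.
by apply: gf_standard_ge => //; apply: ideal_zero.
Qed.

End HilbertFunctions.

(** * Regularity from a comparison of Hilbert functions *)

Section HilbertComparison.
Variables (N : nat) (k F : fieldType).
Variables (r : nat) (d : nat -> nat) (fs : seq {mpoly F[N]}) (gs : seq {mpoly k[N]}).
Hypothesis d0 : forall i, (i < r)%N -> (0 < d i)%N.
Hypotheses (szf : size fs = r) (szg : size gs = r).
Hypothesis fsd : forall i, (i < r)%N -> fs`_i \is (d i).-homog.
Hypothesis gsd : forall i, (i < r)%N -> gs`_i \is (d i).-homog.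
Hypothesis gsr : regular_seq [set 0] gs.
Hypothesis le : forall t, (gf (gens fs) t <= gf (gens gs) t)%N.

Let I i := gens (take i fs).
Let K i := gens (take i gs).

Let hideal_take (L : fieldType) (hs : seq {mpoly L[N]}) i : size hs = r ->
  (forall i, (i < r)%N -> hs`_i \is (d i).-homog) -> hideal (gens (take i hs)).
Proof.
move=> szh hsd; apply: hideal_gens => f /mem_take fhs.
by exists (d (index f hs)); rewrite -{1}(nth_index 0 fhs) hsd // -szh index_mem.
Qed.

Let hI i : hideal (I i). Proof. exact: hideal_take. Qed.
Let hK i : hideal (K i). Proof. exact: hideal_take. Qed.

Let takeS (L : fieldType) (hs : seq {mpoly L[N]}) i : (i < size hs)%N ->
  gens (take i.+1 hs) = add_gen (gens (take i hs)) hs`_i.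
Proof. by move=> ilt; rewrite (take_nth 0) // /gens gens_over_rcons. Qed.

Let gs_regular i : (i < r)%N -> regular_mod (K i) gs`_i.
Proof.
move=> ilt; have := gsr; rewrite -{1}(cat_take_drop i gs) regular_seq_cat => -[_].
by rewrite (drop_nth 0) ?szg //= => -[].
Qed.

Let gfK i t : (i < r)%N -> (d i <= t)%N ->
  gf (K i) t = (gf (K i.+1) t + gf (K i) (t - d i))%N.
Proof.
move=> ilt dt; rewrite -{1}(subnK dt) (gf_exact _ (hK i) (gsd ilt)) subnK //.
rewrite /K takeS ?szg //; congr addn; congr gf.
rewrite eqEsubset; split; last by apply: sub_colon; case: (hK i).
by move=> x; rewrite /colon /= mulrC => /(gs_regular ilt).
Qed.

Let gfI i t : (i < r)%N -> (d i <= t)%N ->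
  gf (I i) t = (gf (I i.+1) t + gf (colon (I i) fs`_i) (t - d i))%N.
Proof.
move=> ilt dt; rewrite -{1}(subnK dt) (gf_exact _ (hI i) (fsd ilt)) subnK //.
by rewrite /I takeS ?szf.
Qed.

Let colon_le i s : (gf (colon (I i) fs`_i) s <= gf (I i) s)%N.
Proof.
apply: qdimS => //.
- by apply: ideal_subspace; case: (hI i).
- by apply: ideal_subspace; apply: colon_ideal; case: (hI i).
- by apply: finmod_homs; case: (hI i).
- by apply: sub_colon; case: (hI i).
Qed.

(** Strong induction on t. The lower bound climbs from i = 0, where both ideals vanish; the upper
    bound descends from i = r, where it is the hypothesis [le]. Each step involves a shift by the
    positive degree [d i], and there equality is already known. *)
Let gfIK t i : (i <= r)%N -> gf (I i) t = gf (K i) t.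
Proof.
elim/ltn_ind: t i => t IH.
have up i : (i <= r)%N -> (gf (K i) t <= gf (I i) t)%N.
  elim: i => [|i IHi] ilt; first by rewrite /I /K !take0 !gf_zero.
  have [td|dt] := ltnP t (d i).
    rewrite /I /K !takeS ?szf ?szg // (gf_low (hI i) (fsd ilt)) //.
    by rewrite (gf_low (hK i) (gsd ilt)) //; apply/IHi/ltnW.
  have := IHi (ltnW ilt); rewrite gfK // (gfI ilt dt) => h.
  rewrite -(leq_add2r (gf (K i) (t - d i))); apply: leq_trans h _.
  rewrite leq_add2l -IH ?(ltnW ilt) ?colon_le //.
  by rewrite ltn_subrL d0 // (leq_trans _ dt) // d0.
have down j : (j <= r)%N -> (gf (I (r - j)) t <= gf (K (r - j)) t)%N.
  elim: j => [|j IHj] jlt.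
    by rewrite subn0 /I /K -{1}szf -szg !take_size.
  set i := (r - j.+1)%N; have iE : (r - j = i.+1)%N by rewrite /i subnSK.
  have ilt : (i < r)%N by rewrite -iE leq_subr.
  have := IHj (ltnW jlt); rewrite iE => h.
  have [td|dt] := ltnP t (d i).
    rewrite /I /K !takeS ?szf ?szg // (gf_low (hI i) (fsd ilt)) // in h.
    by rewrite (gf_low (hK i) (gsd ilt)) in h.
  rewrite (gfK ilt dt) (gfI ilt dt); apply: leq_add => //.
  rewrite -IH ?(ltnW ilt) ?colon_le //.
  by rewrite ltn_subrL d0 // (leq_trans _ dt) // d0.
move=> i ilt; apply/eqP; rewrite eqn_leq up // andbT.
by have := down _ (leq_subr i r); rewrite subKn.
Qed.

(** Equality for both i and i + 1 leaves no room between [I i] and its colon ideal by the next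
    form. *)
Lemma hilbert_regular_seq : regular_seq [set 0] fs.
Proof.
have reg i : (i < r)%N -> regular_mod (I i) fs`_i.
  move=> ilt; apply: (regular_mod_homog (hI i) (fsd ilt)) => t g gt Ig.
  have idI := (hI i).1.
  apply: (@qdim_sub_eq _ _ (homs t) (I i) (colon (I i) fs`_i)) => //.
  - exact: homs_subspace.
  - exact: ideal_subspace.
  - exact/ideal_subspace/colon_ideal.
  - exact: finmod_homs.
  - exact: sub_colon.
  - have dt := leq_addl t (d i).
    have := gfIK (t + d i) (ltnW ilt).
    rewrite (gfI ilt dt) (gfK ilt dt) gfIK // addnK => /addnI.
    by rewrite -(gfIK t (ltnW ilt)) /gf => ->.
  - by rewrite /colon /= mulrC.
suff : forall i, (i <= r)%N -> regular_seq [set 0] (take i fs).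
  by move=> /(_ _ (leqnn _)); rewrite -szf take_size.
elim=> [|i IH] ilt; first by rewrite take0.
rewrite (take_nth 0) ?szf // -cats1 regular_seq_cat; split; first exact/IH/ltnW.
by split=> //; apply: reg.
Qed.

Lemma hilbert_regular_gf t : gf (gens fs) t = gf (gens gs) t.
Proof. by have := gfIK t (leqnn _); rewrite /I /K -{1}szf -szg !take_size. Qed.

End HilbertComparison.

(** * Saturation and base change *)

Section Saturation.
Variables (n : nat) (A : comNzRingType).
Local Notation S := {mpoly A[n.+1]}.
Implicit Types (I J : set S) (f g : S).

(** The colon ideal of [I] by the e-th power of the irrelevant ideal; the saturation is their
    increasing union. *)
Definition mono_colon I e : set S :=
  [set f | forall m : 'X_{1..n.+1}, mdeg m = e -> I ('X_[m] * f)].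

Lemma mono_colon_ideal I e : is_ideal I -> is_ideal (mono_colon I e).
Proof.
move=> idI; split.
- by move=> m _; rewrite mulr0; apply: ideal0.
- by move=> x y hx hy m me; rewrite mulrDr; apply: idealD => //; [apply: hx|apply: hy].
- by move=> a x hx m me; rewrite mulrCA; apply: ideal_mull => //; apply: hx.
Qed.

Lemma mono_colonS I e e' : is_ideal I -> (e <= e')%N -> mono_colon I e `<=` mono_colon I e'.
Proof.
move=> idI ee f h m me; have em : (e <= mdeg m)%N by rewrite me.
have [a [b [-> ae]]] := monomial_splitting em.
by rewrite addmC mpolyXD -mulrA; apply: ideal_mull => //; apply: h.
Qed.

Lemma saturation_ideal I : is_ideal I -> is_ideal (saturation I).
Proof.
move=> idI; split.
- by exists 0%N => m _; rewrite mulr0; apply: ideal0.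
- move=> x y [e hx] [e' hy]; exists (maxn e e').
  exact: (idealD (mono_colon_ideal _ idI) (mono_colonS idI (leq_maxl e e') hx)
    (mono_colonS idI (leq_maxr e e') hy)).
- move=> a x [e hx]; exists e.
  exact: (ideal_mull (mono_colon_ideal e idI) a hx).
Qed.

Lemma saturation_sub I : I `<=` saturation I.
Proof.
by move=> f If; exists 0%N => m /eqP; rewrite mdeg_eq0 => /eqP->; rewrite mpolyX0 mul1r.
Qed.

Lemma saturation_hideal I : hideal I -> hideal (saturation I).
Proof.
move=> [idI hI]; split; first exact: saturation_ideal.
move=> d f [e h]; exists e => m me; rewrite mulrC -(pihomogM _ _ (homogX _ _)).
by apply: hI; rewrite mulrC; apply: h.
Qed.

Lemma homogeneous_hideal I : homogeneous I -> hideal I.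
Proof. by move=> [E Eh ->]; apply: hideal_gen. Qed.

End Saturation.

Section SaturationField.
Variables (n : nat) (k : fieldType).
Local Notation S := {mpoly k[n.+1]}.
Implicit Types (I J : set S) (f g : S).

Lemma saturation_irrelevant_free I : is_ideal I -> irrelevant_free (saturation I).
Proof.
move=> idI g /choice[e eP].
(* One variable of the monomial carries g into the saturation; the remaining degree is the maximal
   exponent needed. *)
exists (\max_i e i).+1 => m me.
have [i mi] : exists i, m i != 0%N by apply: mdeg_gt0; rewrite me.
have mE : m = ((m - U_(i)) + U_(i))%MM by rewrite submK // lep1mP.
rewrite mE mpolyXD -mulrA.
have := mono_colonS idI (leq_bigmax (F := e) i) (eP i); apply.
by apply/eqP; rewrite -(eqn_add2r 1) -{1}(mdeg1 i) -mdegD -mE me addn1.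
Qed.

Lemma irrelevant_free_saturation I : irrelevant_free I -> saturation I = I.
Proof.
move=> fI; rewrite eqEsubset; split; last exact: saturation_sub.
by move=> f [e h]; apply: irrelevant_free_monomials h.
Qed.

Lemma saturation_id I : is_ideal I -> saturation (saturation I) = saturation I.
Proof.
by move=> idI; apply: irrelevant_free_saturation; apply: saturation_irrelevant_free.
Qed.

Lemma saturation_uniform I : is_ideal I -> exists e, saturation I `<=` mono_colon I e.
Proof.
move=> idI; have [fs fsE] := mpoly_noetherian (saturation_ideal idI).
suff [e eP] : exists e, forall f, f \in fs -> mono_colon I e f.
  by exists e; rewrite fsE; apply: gens_min => //; apply: mono_colon_ideal.
have : forall f, f \in fs -> saturation I f by move=> f; rewrite fsE; apply: gens_mem.
elim: (fs) => [|f gs IH] fsI; first by exists 0%N.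
have [|e eP] := IH; first by move=> g ggs; apply: fsI; rewrite inE ggs orbT.
have [e' e'P] := fsI f (mem_head _ _).
exists (maxn e e') => g; rewrite inE => /predU1P[->|/eP].
  exact: (mono_colonS idI (leq_maxr e e')).
exact: (mono_colonS idI (leq_maxl e e')).
Qed.

Lemma saturation_high I : hideal I ->
  exists d0, forall d f, (d0 <= d)%N -> f \is d.-homog -> saturation I f -> I f.
Proof.
move=> hI; have idI := hI.1; have [e eP] := saturation_uniform idI.
have [fs [fsh _ fsE]] := irredundant_gens_exist (saturation_hideal hI).
(* From this degree on, the multiplier of every nonzero generator has degree at least [e]. *)
exists ((\max_(f <- fs) msize f) + e)%N => d f dlt fd.
rewrite fsE => /gens_lin[a fE].
have -> : f = hc d f by rewrite (pihomog_homog _ fd) eqxx.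
rewrite fE pihomog_sum; apply: ideal_sum => // i _.
have gfs : fs`_i \in fs by apply: mem_nth.
have [g0|g0] := eqVneq fs`_i 0; first by rewrite g0 mulr0 raddf0; apply: ideal0.
have [c gc] := fsh _ gfs.
have clt : (c < \max_(f <- fs) msize f)%N.
  apply: leq_trans (leq_bigmax_seq _ gfs isT) => /=.
  by rewrite -(mlead_deg g0) (dhomogP _ _ _ gc) ?mlead_supp.
have cd : (c <= d)%N by rewrite (leq_trans _ dlt) // (leq_trans (ltnW clt)) ?leq_addr.
have ec : (e <= d - c)%N by rewrite leq_subRL // (leq_trans _ dlt) // leq_add2r ltnW.
rewrite -{1}(subnK cd) (pihomogM _ _ gc).
rewrite [hc _ _]mpolyE mulr_suml; apply: ideal_sum_seq => // m mp.
have me : (e <= mdeg m)%N.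
  by rewrite (dhomogP _ _ _ (pihomogP mdeg _ _) m mp).
have [b [b' [-> be]]] := monomial_splitting me.
rewrite -scalerAl -mul_mpolyC addmC mpolyXD -mulrA; apply: ideal_mull => //.
apply: ideal_mull => //; apply: eP => //.
by rewrite fsE; apply: gens_mem.
Qed.

Lemma saturation_le_high I J d0 : hideal I -> is_ideal J ->
  (forall d f, (d0 <= d)%N -> f \is d.-homog -> I f -> J f) ->
  saturation I `<=` saturation J.
Proof.
move=> hI idJ IJ; apply: hideal_sub; first exact: saturation_hideal.
  exact: saturation_ideal.
move=> d f fd [e h]; exists (maxn e d0) => m me.
apply: (IJ (mdeg m + d)%N).
- by rewrite me (leq_trans (leq_maxr e d0)) ?leq_addr.
- by apply: dhomogM => //; apply: homogX.
- by apply: (mono_colonS hI.1 (leq_maxl e d0)).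
Qed.

End SaturationField.

(** * Linear functionals on a field extension *)

Section LinearFunctionals.
Variables (k L : fieldType) (phi : {rmorphism k -> L}).

(** Functionals on [L], linear over [k], take the place of a basis of the possibly infinite
    extension. *)
Record functional := Functional {
  functional_fun :> L -> k;
  functionalD : forall x y, functional_fun (x + y) = functional_fun x + functional_fun y;
  functionalZ : forall c x, functional_fun (phi c * x) = c * functional_fun x }.

Lemma functional0 (l : functional) : l 0 = 0.
Proof. by have := functionalZ l 0 0; rewrite mulr0 mul0r. Qed.

Lemma functional_sum (l : functional) (I : Type) (r : seq I) (P : pred I) F :
  l (\sum_(i <- r | P i) F i) = \sum_(i <- r | P i) l (F i).
Proof. exact: (big_morph l (functionalD l) (functional0 l)). Qed.

(** A maximal subspace [W] missing 1 is a complement of the base field, and [l v] is the scalar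
    congruent to v modulo [W]. *)
Lemma retraction_exists : exists l : functional, l 1 = 1.
Proof.
pose P (W : set L) := [/\ W 0, forall x y, W x -> W y -> W (x + y),
  forall c x, W x -> W (phi c * x) & ~ W 1].
have [||W [[W0 WD WZ W1] _ Wmax]] := @Zorn_chains L P [set 0].
- split=> //=; first by move=> x y -> ->; rewrite addr0.
    by move=> c x ->; rewrite mulr0.
  by move=> /eqP; rewrite oner_eq0.
- move=> F [X0 FX0] FP Ftot; split.
  + by exists X0 => //; case: (FP _ FX0).
  + move=> x y [X FX Xx] [Y FY Yy]; have [XY|YX] := Ftot _ _ FX FY.
      by exists Y => //; case: (FP _ FY) => _ + _ _; apply => //; apply: XY.
    by exists X => //; case: (FP _ FX) => _ + _ _; apply => //; apply: YX.
  + by move=> c x [X FX Xx]; exists X => //; case: (FP _ FX) => _ _ + _; apply.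
  + by move=> [X FX X1]; case: (FP _ FX).
have WN x : W x -> W (- x) by move=> /(WZ (-1)); rewrite rmorphN1 mulN1r.
have uniq c c' v : W (v - phi c) -> W (v - phi c') -> c = c'.
  move=> Wc /WN Wc'; apply: contrapT => /eqP; rewrite -subr_eq0 => cc; apply: W1.
  have := WZ (c - c')^-1 _ (WN _ (WD _ _ Wc Wc')).
  have -> : - (v - phi c - (v - phi c')) = phi (c - c').
    by rewrite opprB rmorphB opprB addrC addrA subrK.
  by rewrite -rmorphM mulVf // rmorph1.
have /choice[l lP] : forall v, exists c, W (v - phi c).
  move=> v; apply: contrapT => nv.
  have nWv : ~ W v by move=> Wv; apply: nv; exists 0; rewrite rmorph0 subr0.
  pose W' := [set x | exists a c, W a /\ x = a + phi c * v].
  suff : P W'.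
    move=> PW'; apply: nWv; rewrite -(Wmax W') //.
      by exists 0, 1; rewrite rmorph1 mul1r add0r.
    by move=> x Wx; exists x, 0; rewrite rmorph0 mul0r addr0.
  split.
  - by exists 0, 0; rewrite rmorph0 mul0r addr0.
  - move=> _ _ [a [c [Wa ->]]] [b [c' [Wb ->]]]; exists (a + b), (c + c').
    by split; [apply: WD|rewrite rmorphD mulrDl addrACA].
  - move=> c _ [a [c' [Wa ->]]]; exists (phi c * a), (c * c').
    by split; [apply: WZ|rewrite rmorphM mulrDr mulrA].
  - move=> [a [c [Wa E]]]; apply: nv; exists c^-1.
    have c0 : c != 0 by apply: contra_notN W1 => /eqP c0; rewrite E c0 rmorph0 mul0r addr0.
    have := WN _ (WZ c^-1 _ Wa); congr W.
    have -> : a = 1 - phi c * v by rewrite E addrK.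
    by rewrite mulrBr mulrA -rmorphM mulVf // rmorph1 mul1r mulr1 opprB.
have lD x y : l (x + y) = l x + l y.
  apply: (uniq _ _ (x + y)) => //.
  by rewrite rmorphD opprD addrACA; apply: WD.
have lZ c x : l (phi c * x) = c * l x.
  by apply: (uniq _ _ (phi c * x)) => //; rewrite rmorphM -mulrBr; apply: WZ.
exists (Functional lD lZ) => /=.
by apply: (uniq _ _ 1) => //; rewrite rmorph1 subrr.
Qed.

Lemma functional_exists z : z != 0 -> exists l : functional, l z = 1.
Proof.
move=> z0; have [l l1] := retraction_exists.
have lD x y : l (z^-1 * (x + y)) = l (z^-1 * x) + l (z^-1 * y).
  by rewrite mulrDr functionalD.
have lZ c x : l (z^-1 * (phi c * x)) = c * l (z^-1 * x).
  by rewrite mulrCA functionalZ.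
by exists (Functional lD lZ); rewrite /= mulVf.
Qed.

(** As in Gram-Schmidt: if the current sum E does not fix z, a functional equal to 1 on z - E z,
    composed with 1 - E, is paired with z - E z. Vectors already fixed by E stay fixed. *)
Lemma functional_basis (zs : seq L) : exists ps : seq (L * functional),
  forall z, z \in zs -> z = \sum_(p <- ps) p.1 * phi (p.2 z).
Proof.
elim: zs => [|z zs [ps psP]]; first by exists [::].
pose E x := \sum_(p <- ps) p.1 * phi (p.2 x).
have ED x y : E (x + y) = E x + E y.
  by rewrite -big_split; apply: eq_bigr => p _; rewrite functionalD rmorphD mulrDr.
have EZ c x : E (phi c * x) = phi c * E x.
  by rewrite mulr_sumr; apply: eq_bigr => p _; rewrite functionalZ rmorphM mulrCA.
have [z0|z0] := eqVneq (z - E z) 0.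
  by exists ps => x; rewrite inE => /predU1P[->|/psP//]; apply/eqP; rewrite -subr_eq0 z0.
have [l lz] := functional_exists z0.
have lD x y : l (x + y - E (x + y)) = l (x - E x) + l (y - E y).
  by rewrite ED opprD addrACA; apply: functionalD.
have lZ c x : l (phi c * x - E (phi c * x)) = c * l (x - E x).
  by rewrite EZ -mulrBr; apply: functionalZ.
exists ((z - E z, Functional lD lZ) :: ps) => x; rewrite inE big_cons /=.
move=> /predU1P[->|/psP xE]; first by rewrite lz rmorph1 mulr1 subrK.
have Ex : E x = x by rewrite /E -xE.
by rewrite Ex subrr functional0 rmorph0 mulr0 add0r -/(E x) Ex.
Qed.

End LinearFunctionals.

(** * Base change of ideals *)

Section BaseChangeRing.
Variables (N : nat) (A B : comNzRingType) (phi : {rmorphism A -> B}).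

Lemma mcoeff_map m (f : {mpoly A[N]}) : (map_mpoly phi f)@_m = phi f@_m.
Proof. exact: mcoeff_map_mpoly. Qed.

Lemma map_mpoly_homog d (f : {mpoly A[N]}) : f \is d.-homog -> map_mpoly phi f \is d.-homog.
Proof.
move=> fd; apply/dhomogP => m; rewrite mcoeff_msupp mcoeff_map => fm.
apply: (dhomogP _ _ _ fd); rewrite mcoeff_msupp.
by apply: contraNneq fm => ->; rewrite rmorph0.
Qed.

Lemma map_mpolyXm (m : 'X_{1..N}) : map_mpoly phi 'X_[m] = 'X_[m].
Proof.
apply/mpolyP => m'; rewrite mcoeff_map !mcoeffX.
by case: (m == m'); rewrite ?rmorph0 ?rmorph1.
Qed.

Lemma map_mpoly_pihomog d (f : {mpoly A[N]}) :
  map_mpoly phi (hc d f) = hc d (map_mpoly phi f).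
Proof.
apply/mpolyP => m; rewrite mcoeff_map !mcoeff_pihomog mcoeff_map.
by case: ifP => // _; rewrite rmorph0.
Qed.

Lemma ideal_gen_map (E : set {mpoly A[N]}) :
  ideal_gen (map_mpoly phi @` ideal_gen E) = ideal_gen (map_mpoly phi @` E).
Proof.
rewrite eqEsubset; split; apply: ideal_gen_min; try exact: ideal_gen_ideal.
  move=> _ [_ [r [a [e [Ee ->]]]] <-]; rewrite raddf_sum /=; apply: ideal_sum.
    exact: ideal_gen_ideal.
  move=> i _; rewrite rmorphM; apply: ideal_mull; first exact: ideal_gen_ideal.
  by apply: ideal_gen_sub; exists (e i).
by move=> _ [f Ef <-]; apply: ideal_gen_sub; exists f => //; apply: ideal_gen_sub.
Qed.

Lemma ideal_gen_map_gens (fs : seq {mpoly A[N]}) :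
  ideal_gen (map_mpoly phi @` gens fs) = gens (map (map_mpoly phi) fs).
Proof.
rewrite !gens_genE ideal_gen_map; congr ideal_gen; rewrite eqEsubset; split=> f.
  by move=> [g gfs <-]; apply: map_f.
by move=> /= /mapP[g gfs ->]; exists g.
Qed.

End BaseChangeRing.

Section BaseChange.
Variables (n : nat) (A B : comNzRingType) (phi : {rmorphism A -> B}).
Implicit Types (I : set {mpoly A[n.+1]}).

Lemma base_change_ideal I : is_ideal (base_change phi I).
Proof. exact: ideal_gen_ideal. Qed.

Lemma base_change_mem I f : I f -> base_change phi I (map_mpoly phi f).
Proof. by move=> If; apply: ideal_gen_sub; exists f. Qed.

Lemma base_change_min I J : is_ideal J -> (forall f, I f -> J (map_mpoly phi f)) ->
  base_change phi I `<=` J.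
Proof.
by move=> idJ IJ; apply: ideal_gen_min => // _ [f If <-]; apply: IJ.
Qed.

Lemma base_change_gens (fs : seq {mpoly A[n.+1]}) :
  base_change phi (gens fs) = gens (map (map_mpoly phi) fs).
Proof. exact: ideal_gen_map_gens. Qed.

Lemma base_change_hideal I : hideal I -> hideal (base_change phi I).
Proof.
move=> [idI hI].
suff -> : base_change phi I = ideal_gen [set map_mpoly phi f | f in
    [set f | I f /\ exists d, f \is d.-homog]].
  by apply: hideal_gen => _ [f [_ [d fd]] <-]; exists d; apply: map_mpoly_homog.
rewrite eqEsubset; split; last first.
  apply: ideal_gen_min; first exact: ideal_gen_ideal.
  by move=> _ [f [If _] <-]; apply: base_change_mem.
apply: base_change_min => [|f If]; first exact: ideal_gen_ideal.
rewrite (pihomog_sumE (leqnn (msize f))) raddf_sum /=.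
apply: ideal_sum => [|d _]; first exact: ideal_gen_ideal.
apply: ideal_gen_sub; exists (hc d f) => //; split; first exact: hI.
by exists (nat_of_ord d); apply: pihomogP.
Qed.

End BaseChange.

Lemma map_mpoly_compose (N : nat) (A B C : comNzRingType) (phi : {rmorphism A -> B})
    (psi : {rmorphism B -> C}) (theta : {rmorphism A -> C}) :
  (forall a, theta a = psi (phi a)) ->
  forall f : {mpoly A[N]}, map_mpoly psi (map_mpoly phi f) = map_mpoly theta f.
Proof. by move=> tE f; apply/mpolyP => m; rewrite !mcoeff_map tE. Qed.

Lemma base_change_compose (n : nat) (A B C : comNzRingType) (phi : {rmorphism A -> B})
    (psi : {rmorphism B -> C}) (theta : {rmorphism A -> C}) (I : set {mpoly A[n.+1]}) :
  (forall a, theta a = psi (phi a)) ->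
  base_change psi (base_change phi I) = base_change theta I.
Proof.
move=> tE; rewrite /base_change ideal_gen_map; congr ideal_gen.
rewrite eqEsubset; split=> f.
  by move=> [_ [g Ig <-] <-]; exists g => //; rewrite (map_mpoly_compose tE).
by move=> [g Ig <-]; exists (map_mpoly phi g); [exists g|rewrite (map_mpoly_compose tE)].
Qed.

Section BaseChangeField.
Variables (n : nat) (k L : fieldType) (phi : {rmorphism k -> L}).
Local Notation S := {mpoly k[n.+1]}.
Local Notation T := {mpoly L[n.+1]}.
Local Notation bc := (base_change phi).
Implicit Types (I J : set S) (l : functional phi).

Definition apply_coefs l (F : T) : S := \sum_(m <- msupp F) l F@_m *: 'X_[m].

Lemma mcoeff_apply_coefs l F m : (apply_coefs l F)@_m = l F@_m.
Proof.
rewrite /apply_coefs raddf_sum /=; under eq_bigr do rewrite mcoeffZ mcoeffX.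
have [mF|mF] := boolP (m \in msupp F); last first.
  rewrite (memN_msupp_eq0 mF) functional0 big1_seq // => m' /andP[_ m'F].
  by case: eqP mF => [<-|]; rewrite ?m'F ?mulr0.
rewrite (bigD1_seq m) ?msupp_uniq //= eqxx mulr1 big1 ?addr0 // => m' /negbTE->.
by rewrite mulr0.
Qed.

Lemma apply_coefs_sum l (I : Type) (r : seq I) (P : pred I) (F : I -> T) :
  apply_coefs l (\sum_(i <- r | P i) F i) = \sum_(i <- r | P i) apply_coefs l (F i).
Proof.
apply/mpolyP => m; rewrite mcoeff_apply_coefs !raddf_sum /= functional_sum.
by apply: eq_bigr => i _; rewrite mcoeff_apply_coefs.
Qed.

Lemma apply_coefsM l (g : S) F : apply_coefs l (map_mpoly phi g * F) = g * apply_coefs l F.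
Proof.
apply/mpolyP => m; rewrite mcoeff_apply_coefs !mcoeffM functional_sum.
by apply: eq_bigr => -[m1 m2] _; rewrite mcoeff_map functionalZ mcoeff_apply_coefs.
Qed.

(** [apply_coefs l] is linear over the polynomial ring of [k], hence sends the extended ideal into
    [I]. Conversely [functional_basis], for the finitely many coefficients of [F], writes [F] as a
    combination of the polynomials [apply_coefs l F]. *)
Lemma base_changeP I F : is_ideal I ->
  base_change phi I F <-> forall l, I (apply_coefs l F).
Proof.
move=> idI; split.
  move=> [r [a [e [Ee ->]]]] l; rewrite apply_coefs_sum; apply: ideal_sum => // i _.
  have [g Ig <-] := Ee i; rewrite mulrC apply_coefsM.
  exact: ideal_mulr.
move=> IF; have [ps psP] := functional_basis phi [seq F@_m | m <- msupp F].
have -> : F = \sum_(p <- ps) p.1 *: map_mpoly phi (apply_coefs p.2 F).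
  apply/mpolyP => m; rewrite raddf_sum /=.
  have [mF|mF] := boolP (m \in msupp F).
    rewrite {1}(psP F@_m); last exact: map_f.
    by apply: eq_bigr => p _; rewrite mcoeffZ mcoeff_map mcoeff_apply_coefs.
  rewrite big1 ?memN_msupp_eq0 // => p _.
  by rewrite mcoeffZ mcoeff_map mcoeff_apply_coefs memN_msupp_eq0 // functional0 rmorph0 mulr0.
apply: ideal_sum => [|p _]; first exact: base_change_ideal.
rewrite -mul_mpolyC; apply: ideal_mull; first exact: base_change_ideal.
exact: base_change_mem.
Qed.

Lemma base_change_descent I f : is_ideal I -> bc I (map_mpoly phi f) -> I f.
Proof.
move=> idI /(base_changeP _ idI) h; have [l l1] := retraction_exists phi.
have := h l; congr I; apply/mpolyP => m.
by rewrite mcoeff_apply_coefs mcoeff_map -[phi _]mulr1 functionalZ l1 mulr1.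
Qed.

Lemma base_change_inj I J : is_ideal I -> is_ideal J -> bc I = bc J -> I = J.
Proof.
move=> idI idJ E; rewrite eqEsubset; split=> f If.
  by apply: base_change_descent => //; rewrite -E; apply: base_change_mem.
by apply: base_change_descent => //; rewrite E; apply: base_change_mem.
Qed.

Lemma saturation_base_change I : is_ideal I -> saturation (bc I) = bc (saturation I).
Proof.
move=> idI; rewrite eqEsubset; split.
  move=> F [e h]; apply/(base_changeP _ (saturation_ideal idI)) => l.
  exists e => m me; have /(base_changeP _ idI)/(_ l) := h m me.
  by rewrite -(map_mpolyXm phi) apply_coefsM.
apply: base_change_min => [|f [e h]]; first exact/saturation_ideal/base_change_ideal.
exists e => m me; rewrite -(map_mpolyXm phi) -rmorphM /=.
exact/base_change_mem/h.
Qed.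

Lemma base_change_add_gen I f : is_ideal I ->
  bc (add_gen I f) = add_gen (bc I) (map_mpoly phi f).
Proof.
move=> idI; have idB := base_change_ideal phi I.
rewrite eqEsubset; split.
  apply: base_change_min => [|_ [i [a [Ii ->]]]]; first exact: add_gen_ideal.
  by exists (map_mpoly phi i), (map_mpoly phi a); rewrite rmorphD rmorphM; split=> //; apply: base_change_mem.
apply: add_gen_min; first exact: base_change_ideal.
  apply: base_change_min => [|g Ig]; first exact: base_change_ideal.
  by apply/base_change_mem/add_gen_sub.
exact/base_change_mem/add_gen_mem.
Qed.

Lemma base_change_zero : bc [set (0 : S)] = [set (0 : T)].
Proof.
rewrite eqEsubset; split; last by move=> _ ->; apply: ideal0; apply: base_change_ideal.
by apply: base_change_min => [|f ->]; [exact: ideal_zero|rewrite /= rmorph0].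
Qed.

Lemma regular_mod_base_change I f : is_ideal I ->
  regular_mod (bc I) (map_mpoly phi f) <-> regular_mod I f.
Proof.
move=> idI; split=> fr g.
  move=> Ifg; apply: base_change_descent => //; apply: fr.
  by rewrite -rmorphM /=; apply: base_change_mem.
move=> /(base_changeP _ idI) h; apply/(base_changeP _ idI) => l.
by apply: fr; rewrite -apply_coefsM.
Qed.

Lemma regular_seq_base_change (fs : seq S) :
  regular_seq [set 0] (map (map_mpoly phi) fs) <-> regular_seq [set 0] fs.
Proof.
rewrite -base_change_zero; have := @ideal_zero S.
elim: fs [set 0] => //= f fs IH I idI.
rewrite -base_change_add_gen // IH ?regular_mod_base_change //.
exact: add_gen_ideal.
Qed.

Lemma hpos_map (f : S) : hpos f -> hpos (map_mpoly phi f).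
Proof. by move=> [d d0 fd]; exists d => //; apply: map_mpoly_homog. Qed.

(** For the descent, irredundant generators of [J] stay irredundant over [L], so there are at most
    as many as in the regular sequence there; the growth of the ideal then makes them regular. *)
Lemma regular_ci_base_change J : hideal J -> regular_ci (bc J) <-> regular_ci J.
Proof.
move=> hJ; have idJ := hJ.1; split; last first.
  move=> [fs [fsh fsr ->]]; exists (map (map_mpoly phi) fs); split.
  - by move=> _ /mapP[f /fsh fh ->]; apply: hpos_map.
  - exact/regular_seq_base_change.
  - exact: base_change_gens.
move=> [gs [gsh gsr JE]].
have [fs [fsh irr JE']] := irredundant_gens_exist hJ.
have J1 : ~ J 1.
  move=> J1; apply: (gens_proper gsh); rewrite -JE -(rmorph1 (map_mpoly phi)).
  exact: base_change_mem.
have fsp f : f \in fs -> hpos f.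
  move=> ffs; apply: (homog_proper_hpos idJ J1); last exact: fsh.
  by rewrite JE'; apply: gens_mem.
exists fs; split=> //; apply/regular_seq_base_change; apply: growth_regular_seq.
  by move=> _ /mapP[f /fsp fh ->]; apply: hpos_map.
rewrite -base_change_gens -JE' JE.
apply: codim_growth_le (regular_seq_growth gsr).
apply: irredundant_size_le.
- by move=> _ /mapP[f /fsh[d fd] ->]; exists d; apply: map_mpoly_homog.
- move=> i; rewrite size_map => ilt.
  rewrite -map_take -map_drop -map_cat (nth_map 0) // -base_change_gens.
  move=> /base_change_descent h; apply: (irr i ilt); apply: h.
  exact: gens_ideal.
- by rewrite -base_change_gens -JE' JE.
Qed.

End BaseChangeField.

Section StrictCompleteIntersections.
Variable n : nat.

Lemma strict_complete_intersectionP (k : fieldType) (I : set {mpoly k[n.+1]}) :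
  hideal I -> strict_complete_intersection I <-> regular_ci (saturation I).
Proof. by move=> hI; apply/complete_intersectionP/saturation_hideal. Qed.

Lemma strict_complete_intersection_base_change (k L : fieldType)
    (phi : {rmorphism k -> L}) (I : set {mpoly k[n.+1]}) : hideal I ->
  strict_complete_intersection (base_change phi I) <-> strict_complete_intersection I.
Proof.
move=> hI; rewrite !strict_complete_intersectionP //; last exact: base_change_hideal.
rewrite saturation_base_change ?regular_ci_base_change //; last exact: hI.1.
exact: saturation_hideal.
Qed.

End StrictCompleteIntersections.

(** * Specialization of matrices *)

Lemma unit_minor_exists (K : fieldType) (a b : nat) (M : 'M[K]_(a, b)) :
  exists (f : 'I_(\rank M) -> 'I_a) (g : 'I_(\rank M) -> 'I_b), mxsub f g M \in unitmx.
Proof.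
have full : row_full (rowsub (maxrankfun M) M)^T.
  by rewrite /row_full mxrank_tr; apply: maxrowsub_free.
exists (maxrankfun M), (fullrankfun full).
have -> : mxsub (maxrankfun M) (fullrankfun full) M =
    (rowsub (fullrankfun full) (rowsub (maxrankfun M) M)^T)^T.
  by apply/matrixP => i j; rewrite !mxE.
by rewrite unitmx_tr; apply: fullrowsub_unit.
Qed.

Lemma unit_minor_rank (K : fieldType) (a b r : nat) (M : 'M[K]_(a, b))
  (f : 'I_r -> 'I_a) (g : 'I_r -> 'I_b) : mxsub f g M \in unitmx ->
  (r <= \rank M)%N /\ (r <= \rank (colsub g M))%N.
Proof.
rewrite -row_free_unit => /eqP rk.
have col : (r <= \rank (colsub g M))%N.
  rewrite -[X in (X <= _)%N]rk mxsubrc rowsubE; exact: mxrankM_maxr.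
split=> //; apply: leq_trans col _.
have -> : colsub g M = M *m colsub g 1%:M by rewrite mulmx_colsub mulmx1.
exact: mxrankM_maxl.
Qed.

Section Specialization.
Variables (A : comNzRingType) (F k : fieldType).
Variables (pi1 : {rmorphism A -> F}) (pi2 : {rmorphism A -> k}).
Hypothesis ker_sub : forall a, pi1 a = 0 -> pi2 a = 0.
Hypothesis frac2 : forall z, exists a s, pi2 s != 0 /\ pi2 s * z = pi2 a.

Lemma specialize_unit a : pi2 a != 0 -> pi1 a != 0.
Proof. by apply: contra_neq => /ker_sub. Qed.

Lemma minor_lift a b (Z : 'M[A]_(a, b)) : exists f g,
  pi2 (\det (mxsub f g Z : 'M_(\rank (map_mx pi2 Z)))) != 0.
Proof.
have [f [g]] := unit_minor_exists (map_mx pi2 Z).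
rewrite -map_mxsub unitmxE det_map_mx unitfE => dne.
by exists f, g.
Qed.

(** A minor that is nonzero at the special point [pi2] is nonzero at [pi1], whose kernel is
    smaller. *)
Lemma rank_semicontinuous a b (Z : 'M[A]_(a, b)) :
  (\rank (map_mx pi2 Z) <= \rank (map_mx pi1 Z))%N.
Proof.
have [f [g dne]] := minor_lift Z.
have : mxsub f g (map_mx pi1 Z) \in unitmx.
  by rewrite -map_mxsub unitmxE det_map_mx unitfE specialize_unit.
by case/unit_minor_rank.
Qed.

Lemma clear_denominators a (v : 'rV[k]_a) : exists (w : 'rV[A]_a) s,
  pi2 s != 0 /\ map_mx pi2 w = pi2 s *: v.
Proof.
have /choice[n /choice[d dP]] := fun i => frac2 (v ord0 i).
exists (\row_i (n i * \prod_(j | j != i) d j)), (\prod_j d j); split.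
  by rewrite rmorph_prod prodf_seq_neq0; apply/allP => i _; apply/implyP => _; case: (dP i).
apply/rowP => i; rewrite !mxE [in RHS](bigD1 i) //= !rmorphM.
by have [_ <-] := dP i; rewrite mulrAC.
Qed.

(** Cramer's rule. With an invertible minor D on rows f and columns g, det D times a lift of v is
    corrected by a combination of the rows f, through the adjugate, so as to kill the columns g. At
    [pi1] the rank is no larger, so these columns control all the others; at [pi2] the correction
    vanishes. *)
Lemma kernel_lift a b (Z : 'M[A]_(a, b)) (v : 'rV[k]_a) :
  \rank (map_mx pi1 Z) = \rank (map_mx pi2 Z) -> v *m map_mx pi2 Z = 0 ->
  exists (w : 'rV[A]_a) s,
    [/\ pi2 s != 0, map_mx pi1 (w *m Z) = 0 & map_mx pi2 w = pi2 s *: v].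
Proof.
move=> rE vZ; have [f [g dne]] := minor_lift Z.
set D := mxsub f g Z in dne; have [w0 [s [s0 w0E]]] := clear_denominators v.
pose c := colsub g (w0 *m Z); pose x := c *m \adj D.
pose w := \det D *: w0 - x *m rowsub f 1%:M.
have wZg : colsub g (w *m Z) = 0.
  rewrite mulmxBl -scalemxAl -mulmxA mul_rowsub_mx mul1mx.
  have -> : colsub g (\det D *: (w0 *m Z) - x *m rowsub f Z) =
      \det D *: c - x *m colsub g (rowsub f Z).
    by rewrite mulmx_colsub; apply/matrixP => i j; rewrite !mxE.
  rewrite -mxsubcr -/D /x -mulmxA mul_adj_mx mul_mx_scalar.
  by rewrite subrr.
exists w, (\det D * s); split.
- by rewrite rmorphM mulf_neq0.
- have /unit_minor_rank[_] : mxsub f g (map_mx pi1 Z) \in unitmx.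
    by rewrite -map_mxsub unitmxE det_map_mx unitfE specialize_unit.
  rewrite -{1}rE => rle.
  have colE p (M : 'M[F]_(p, b)) : colsub g M = M *m colsub g 1%:M.
    by rewrite mulmx_colsub mulmx1.
  rewrite colE in rle.
  have := mxrank_mul_ker (map_mx pi1 Z) (colsub g 1%:M).
  have : (\rank (map_mx pi1 Z *m colsub g 1%:M) <= \rank (map_mx pi1 Z))%N.
    exact: mxrankM_maxl.
  move=> le; have -> := (anti_leq (introT andP (conj le rle))).
  rewrite -[RHS]addn0 => /addnI/eqP; rewrite mxrank_eq0 => /eqP cap0.
  apply/eqP; rewrite -submx0 -cap0 sub_capmx map_mxM submxMl /=.
  apply/sub_kermxP; rewrite -map_mxM -colE -map_mxsub wZg.
  exact: map_mx0.
- rewrite map_mxB map_mxZ map_mxM w0E.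
  have -> : map_mx pi2 x = 0.
    by rewrite map_mxM map_mxsub map_mxM w0E -scalemxAl vZ scaler0 mxsub_const mul0mx.
  by rewrite mul0mx subr0 scalerA rmorphM.
Qed.

(* A complex that is exact in the middle over the special point: the kernel of
   its first map is then compatible with specialization. *)
Lemma exact_kernel_lift a b c (Z : 'M[A]_(a, b)) (Y : 'M[A]_(b, c)) (v : 'rV[k]_a) :
  map_mx pi1 (Z *m Y) = 0 ->
  (forall y : 'rV[k]_b, y *m map_mx pi2 Y = 0 -> (y <= map_mx pi2 Z)%MS) ->
  v *m map_mx pi2 Z = 0 ->
  exists (w : 'rV[A]_a) s,
    [/\ pi2 s != 0, map_mx pi1 (w *m Z) = 0 & map_mx pi2 w = pi2 s *: v].
Proof.
move=> ZY ex; apply: kernel_lift.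
(* At [pi1] the rank of [Z] is at most b minus the rank of [Y], hence at most the dimension of the
   kernel of [Y] at [pi2], which by exactness is at most the rank of [Z] there. *)
apply/eqP; rewrite eqn_leq rank_semicontinuous andbT.
have kerle : (kermx (map_mx pi2 Y) <= map_mx pi2 Z)%MS.
  by apply/row_subP => i; apply: ex; rewrite -row_mul mulmx_ker row0.
apply: leq_trans (mxrankS kerle); rewrite mxrank_ker.
rewrite map_mxM in ZY; have := mulmx0_rank_max ZY.
move=> le; rewrite leq_subRL ?rank_leq_row // addnC.
by apply: leq_trans le; rewrite leq_add2l rank_semicontinuous.
Qed.

(** [R] is a projection along the row space of [E], multiplied by an invertible minor to clear
    denominators. It turns membership in that row space into linear equations over [A]. *)
Lemma reduction_matrix r b (E : 'M[A]_(r, b)) : row_free (map_mx pi2 E) ->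
  exists R : 'M[A]_b, E *m R = 0 /\
    forall y : 'rV[k]_b, y *m map_mx pi2 R = 0 -> (y <= map_mx pi2 E)%MS.
Proof.
move=> free; have full : row_full (map_mx pi2 E)^T by rewrite /row_full mxrank_tr.
pose g := fullrankfun full; pose D := colsub g E.
have dne : pi2 (\det D) != 0.
  have := fullrowsub_unit full; rewrite -unitmx_tr trmx_mxsub trmxK.
  by rewrite -[mxsub _ _ _]/(colsub g (map_mx pi2 E)) -map_mxsub unitmxE det_map_mx unitfE.
have subE p (B : comNzRingType) (M : 'M[B]_(p, b)) : colsub g M = M *m colsub g (1%:M : 'M[B]_b).
  by rewrite mulmx_colsub mulmx1.
exists (\det D *: 1%:M - colsub g 1%:M *m \adj D *m E); split.
  rewrite mulmxBr -scalemxAr mulmx1 !mulmxA -subE mul_mx_adj mul_scalar_mx.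
  by rewrite subrr.
move=> y; rewrite map_mxB mulmxBr map_mxZ map_mx1 -scalemxAr mulmx1 => /eqP.
rewrite subr_eq0 => /eqP yE.
have -> : y = (pi2 (\det D))^-1 *: (pi2 (\det D) *: y) by rewrite scalerA mulVf ?scale1r.
by rewrite yE map_mxM mulmxA scalemx_sub // submxMl.
Qed.

Lemma exact_kernel_lift_fun (I J K : finType) (Z : I -> J -> A) (Y : J -> K -> A) (v : I -> k) :
  (forall i l, \sum_j pi1 (Z i j) * pi1 (Y j l) = 0) ->
  (forall y : J -> k, (forall l, \sum_j y j * pi2 (Y j l) = 0) ->
     exists u : I -> k, forall j, y j = \sum_i u i * pi2 (Z i j)) ->
  (forall j, \sum_i v i * pi2 (Z i j) = 0) ->
  exists (w : I -> A) s, [/\ pi2 s != 0, forall j, \sum_i pi1 (w i) * pi1 (Z i j) = 0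
    & forall i, pi2 (w i) = pi2 s * v i].
Proof.
move=> ZY ex vZ.
pose Zm := \matrix_(i < #|I|, j < #|J|) Z (enum_val i) (enum_val j).
pose Ym := \matrix_(i < #|J|, j < #|K|) Y (enum_val i) (enum_val j).
have sumE (T : finType) (B : nmodType) (G : T -> B) : \sum_(i < #|T|) G (enum_val i) = \sum_i G i.
  by rewrite -(big_enum_val G).
have [|||w [s [s0 wZ wE]]] := @exact_kernel_lift _ _ _ Zm Ym (\row_i v (enum_val i)).
- apply/matrixP => i l; rewrite !mxE raddf_sum /= -[RHS](ZY (enum_val i) (enum_val l)) -[RHS]sumE.
  by apply: eq_bigr => j _; rewrite !mxE rmorphM.
- move=> y yY; have [|u uP] := ex (fun j => y ord0 (enum_rank j)).
    move=> l; have /matrixP/(_ ord0 (enum_rank l)) := yY; rewrite !mxE => yl.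
    rewrite -[RHS]yl -[LHS]sumE; apply: eq_bigr => j _.
    by rewrite !mxE enum_valK enum_rankK.
  apply/submxP; exists (\row_i u (enum_val i)); apply/rowP => j; rewrite !mxE.
  rewrite -{1}(enum_valK j) uP -[LHS]sumE; apply: eq_bigr => i _.
  by rewrite !mxE.
- apply/rowP => j; rewrite !mxE -[RHS](vZ (enum_val j)) -[RHS]sumE.
  by apply: eq_bigr => i _; rewrite !mxE.
exists (fun i => w ord0 (enum_rank i)), s; split=> // [j|i].
  have /matrixP/(_ ord0 (enum_rank j)) := wZ; rewrite !mxE raddf_sum /= => wj.
  rewrite -[RHS]wj -[LHS]sumE; apply: eq_bigr => i _.
  by rewrite !mxE enum_valK enum_rankK rmorphM.
have /matrixP/(_ ord0 (enum_rank i)) := wE; rewrite !mxE => ->.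
by rewrite enum_rankK.
Qed.

End Specialization.

(** * Hilbert polynomials *)

Section HilbertPolynomials.
Variables (n : nat) (k : fieldType).
Local Notation N := n.+1.
Local Notation S := {mpoly k[n.+1]}.
Implicit Types (I J K : set S) (p : {poly rat}).

Lemma quotient_dim_gf I d r : is_ideal I -> quotient_dim I d r -> gf I d = r.
Proof.
by move=> idI [b [bh bs bf]]; apply: (qdim_eq (ideal_subspace idI)); exists b.
Qed.

Lemma gf_quotient_dim I d : is_ideal I -> quotient_dim I d (gf I d).
Proof.
move=> idI; have [b [bh bs bf]] := qdimP (ideal_subspace idI) (finmod_homs d idI).
by exists b.
Qed.

Lemma has_hilbert_polyP I p : is_ideal I ->
  has_hilbert_poly I p <-> exists d0, forall d, (d0 <= d)%N -> p.[d%:R] = (gf I d)%:R.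
Proof.
move=> idI; split=> -[d0 h]; exists d0 => d /h.
  by move=> [r /(quotient_dim_gf idI) ->].
by move=> pE; exists (gf I d) => //; apply: gf_quotient_dim.
Qed.

Lemma gf_congr I J t : is_ideal I -> is_ideal J ->
  (forall f, f \is t.-homog -> I f <-> J f) -> gf I t = gf J t.
Proof.
move=> idI idJ IJ; apply: qdim_eq; first exact: ideal_subspace.
have [b [bh bs bf]] := qdimP (ideal_subspace idJ) (finmod_homs t idJ).
have sh := @homs_subspace n.+1 k t.
exists b; split=> // [v vt|c].
  have [c Jc] := bs v vt; exists c; apply/IJ => //.
  by apply: (subspB sh) => //; apply: subsp_comb.
by move=> /IJ h; apply: bf; apply: h; apply: (subsp_comb _ sh).
Qed.

Lemma gf_saturation I : hideal I -> exists d0, forall d, (d0 <= d)%N ->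
  gf (saturation I) d = gf I d.
Proof.
move=> hI; have [d0 h] := saturation_high hI; exists d0 => d dd.
apply: gf_congr; [exact/saturation_ideal/hI.1|exact: hI.1|].
by move=> f fd; split; [exact: (h d f dd fd)|exact: saturation_sub].
Qed.

Lemma saturation_eq_of_gf I K d0 : hideal I -> hideal K -> irrelevant_free K ->
  K `<=` saturation I -> (forall d, (d0 <= d)%N -> (gf K d <= gf I d)%N) ->
  K = saturation I.
Proof.
move=> hI hK fK KI le; rewrite eqEsubset; split=> //.
rewrite -[X in _ `<=` X](irrelevant_free_saturation fK).
have [d1 h1] := gf_saturation hI.
apply: (@saturation_le_high _ _ _ _ (maxn d0 d1)) => //; first exact: hK.1.
move=> d f dd fd If.
apply: (@qdim_sub_eq _ _ (homs d) K (saturation I)) => //.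
- exact: homs_subspace.
- exact/ideal_subspace/hK.1.
- exact/ideal_subspace/saturation_ideal/hI.1.
- exact/finmod_homs/hK.1.
- have := le d (leq_trans (leq_maxl d0 d1) dd).
  by rewrite -(h1 d (leq_trans (leq_maxr d0 d1) dd)).
- exact: saturation_sub.
Qed.

Lemma hfS_ge J t : hideal J -> (hf J t + gf J t.+1 <= hf J t.+1)%N.
Proof.
move=> hJ; have idJ := hJ.1; have sJ := ideal_subspace idJ.
have [b [bt bs bf]] := qdimP sJ (finmod_deg_le t idJ).
have [c [ct cs cf]] := qdimP sJ (finmod_homs t.+1 idJ).
apply: (@qdim_ge_free _ _ _ _ _ (cat_fam b c)) => //; first exact: finmod_deg_le.
  move=> i; rewrite /cat_fam; case: split => j; last exact/homs_deg_le/ct.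
  exact/deg_leS/bt.
move=> a; rewrite cat_fam_sum => Ja.
have sdt := @deg_le_subspace n.+1 k t.
have sht := @homs_subspace n.+1 k t.+1.
have Jc : J (\sum_i a (rshift (qdim (deg_le t) J) i) *: c i).
  have := hJ.2 t.+1 _ Ja; rewrite pihomogD.
  rewrite [X in J (_ + X)](pihomog_homog _ (subsp_comb _ sht ct)) eqxx.
  rewrite (_ : hc _ _ = 0) ?add0r //; apply/mpolyP => m.
  rewrite mcoeff_pihomog mcoeff0; case: eqP => // mt.
  apply/memN_msupp_eq0/msize_mdeg_ge; rewrite mt.
  exact: (subsp_comb _ sdt bt).
have Jb := subspB sJ Ja Jc; rewrite addrK in Jb.
by move=> i; rewrite -(splitK i); case: split => j /=; [apply: bf Jb j|apply: cf Jc j].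
Qed.

Lemma hf_sum_ge J t s : hideal J ->
  (\sum_(j < s) gf J (t + j).+1 <= hf J (t + s))%N.
Proof.
move=> hJ; elim: s => [|s IH]; first by rewrite big_ord0.
rewrite big_ord_recr addnS; apply: leq_trans (hfS_ge _ hJ).
by rewrite leq_add2r.
Qed.

(** With n or more forms the affine Hilbert function grows at most linearly. It dominates sums of
    graded values, so these could not eventually all exceed [C]; but a nonconstant polynomial takes
    only finitely often a value in 0, ..., C. *)
Lemma hilbert_poly_codim fs p d0 : (forall f, f \in fs -> hpos f) ->
  regular_seq [set (0 : S)] fs -> (1 < size p)%N ->
  (forall d, (d0 <= d)%N -> p.[d%:R] = (gf (gens fs) d)%:R) -> (size fs < n)%N.
Proof.
move=> fsh fsr p1 pE; rewrite ltnNge; apply/negP => nfs.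
have hJ : hideal (gens fs) by apply: hideal_gens => f /fsh/hpos_homog.
have [C CP] := codim_growth_le nfs (regular_seq_growth fsr).
have hfle t : (hf (gens fs) t <= C * t.+1)%N.
  have := CP t; rewrite expnS mulnA leq_mul2r expn_eq0 /=.
  by [].
(* The roots of [q] include every large degree where the graded value is at most [C]. *)
pose q := \prod_(v < C.+1) (p - (v%:R)%:P).
have q0 : q != 0.
  apply/prodf_neq0 => v _; rewrite subr_eq0; apply: contraTneq p1 => ->.
  by rewrite -leqNgt size_polyC; case: (_ != 0).
have big d : (d0 <= d)%N -> ~~ root q d%:R -> (C < gf (gens fs) d)%N.
  move=> dd; apply: contraR; rewrite -leqNgt => le.
  rewrite /root horner_prod; apply/prodf_eq0.
  exists (inord (gf (gens fs) d)) => //.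
  by rewrite hornerD hornerN hornerC inordK // pE // subrr.
(* Chosen so that the upper bound for T + 1 summands equals (C + 1) T, less than (C + 1)(T + 1). *)
pose T := ((size q) * C.+1 + C * d0.+2)%N.
have cnt s : (s * C.+1 <= (size q) * C.+1 + \sum_(j < s) gf (gens fs) (d0 + j).+1)%N.
  pose rs := [seq (d0 + j).+1 | j <- iota 0 s].
  have few : (count (fun d => root q d%:R) rs <= size q)%N.
    rewrite -size_filter; set ws := [seq d <- rs | root q d%:R].
    have : all (root q) [seq (d%:R : rat) | d <- ws].
      by apply/allP => _ /mapP[d + ->]; rewrite mem_filter => /andP[].
    move=> /(max_poly_roots q0); rewrite size_map => h; apply/ltnW/h.
    rewrite map_inj_uniq ?filter_uniq ?map_inj_uniq ?iota_uniq //.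
      by move=> i j [] /addnI.
    by move=> i j /eqP; rewrite Num.Theory.eqr_nat => /eqP.
  have : (s * C.+1 <= count (fun d => root q d%:R) rs * C.+1 +
                     \sum_(d <- rs) gf (gens fs) d)%N.
    have -> : s = size rs by rewrite size_map size_iota.
    have : {in rs, forall d, (d0 <= d)%N}.
      by move=> d /mapP[j _ ->]; rewrite leqW // leq_addr.
    elim: rs {few} => [|d ws IH] dws; first by rewrite big_nil.
    rewrite big_cons /= mulSn mulnDl addnACA; apply: leq_add.
      have [rd|/big h] := boolP (root q d%:R); first by rewrite mul1n leq_addr.
      by rewrite mul0n add0n; apply: h; apply: dws; rewrite mem_head.
    by apply: IH => e ews; apply: dws; rewrite inE ews orbT.
  rewrite big_map => h.
  apply: leq_trans h _; apply: leq_add; first by rewrite leq_mul2r few orbT.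
  by rewrite -[X in iota 0 X]subn0 -/(index_iota 0 s) big_mkord.
have := cnt T.+1; rewrite leqNgt => /negP; apply.
apply: (@leq_ltn_trans ((size q) * C.+1 + C * (d0 + T.+1).+1)%N).
  by rewrite leq_add2l; apply: leq_trans (hf_sum_ge _ _ hJ) (hfle _).
have -> : ((d0 + T.+1).+1 = d0.+2 + T)%N by rewrite addnS !addSn.
by rewrite mulnDr addnA -/T -mulSn mulnC ltn_mul2r ltnSn.
Qed.

End HilbertPolynomials.

Lemma free_qdim_span (k : fieldType) (T : lmodType k) (V W : set T) (b : 'I_(qdim V W) -> T) :
  subspace V -> subspace W -> finmod V W -> (forall i, V (b i)) -> free_mod W b ->
  span_mod V W b.
Proof.
move=> sV sW fV Vb fb.
pose U := [set v | exists c : 'I_(qdim V W) -> k, W (v - \sum_i c i *: b i)].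
have sU : subspace U.
  split.
  - exists (fun=> 0); rewrite big1 ?subr0; first exact: subsp0.
    by move=> i _; rewrite scale0r.
  - move=> x y [c Wc] [c' Wc']; exists (fun i => c i + c' i).
    under eq_bigr do rewrite scalerDl.
    by rewrite big_split opprD addrACA; apply: subspD.
  - move=> a x [c Wc]; exists (fun i => a * c i).
    under eq_bigr do rewrite -scalerA.
    by rewrite -scaler_sumr -scalerBr; apply: subspZ.
have WU : W `<=` U.
  move=> x Wx; exists (fun=> 0); rewrite big1 ?subr0 // => i _.
  by rewrite scale0r.
have Ub i : U (b i).
  exists (fun j => (j == i)%:R); rewrite (bigD1 i) //= eqxx scale1r big1 ?addr0 ?subrr.
    exact: subsp0.
  by move=> j /negbTE->; rewrite scale0r.
have fU : finmod V U by apply: finmodS fV.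
move=> v Vv; apply: (qdim_eq0 sU fU _ Vv).
have := qdimD sV sU sW WU fV => E.
apply/eqP; rewrite -leqn0 -(leq_add2r (qdim (V `&` U) W)) -E add0n.
apply: qdim_ge_free fb => //.
by apply: finmodS fV => // x [].
Qed.

(** * Coordinates in a graded piece *)

Section GradedCoordinates.
Variables (N : nat) (t : nat).

Lemma homog_coefs_eq0 (R : comNzRingType) (f : {mpoly R[N]}) : f \is t.-homog ->
  (forall j : 'I_(size (monos N t)), f@_(nth 0%MM (monos N t) j) = 0) -> f = 0.
Proof.
move=> ft f0; apply/mpolyP => m; rewrite mcoeff0; apply/eqP; rewrite mcoeff_eq0.
apply/negP => /[dup] mf; rewrite mcoeff_msupp => /negP; apply; apply/eqP.
have mt : m \in monos N t by rewrite mem_monos; apply/eqP/(dhomogP _ _ _ ft).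
have h : (index m (monos N t) < size (monos N t))%N by rewrite index_mem.
by have := f0 (Ordinal h); rewrite /= nth_index.
Qed.

Lemma homog_coefsE (R : comNzRingType) (f : {mpoly R[N]}) : f \is t.-homog ->
  \sum_(j < size (monos N t)) f@_(nth 0%MM (monos N t) j) *: 'X_[nth 0%MM (monos N t) j] = f.
Proof.
move=> ft; rewrite -homog_monosE ?monos_uniq // => m mf.
by rewrite mem_monos; apply/eqP/(dhomogP _ _ _ ft).
Qed.

Lemma mono_homog (R : comNzRingType) (j : 'I_(size (monos N t))) :
  'X_[nth 0%MM (monos N t) j] \is [in R[N], t.-homog].
Proof. by rewrite dhomogX /= -mem_monos mem_nth. Qed.

Lemma mono_deg (j : 'I_(size (monos N t))) : mdeg (nth 0%MM (monos N t) j) = t.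
Proof. by apply/eqP; rewrite -mem_monos mem_nth. Qed.

Definition coef_mx (R : comNzRingType) r (E : 'I_r -> {mpoly R[N]}) :=
  \matrix_(l < r, j < size (monos N t)) (E l)@_(nth 0%MM (monos N t) j).

Lemma coef_mx_comb (R : comNzRingType) r (E : 'I_r -> {mpoly R[N]}) (c : 'rV[R]_r) j :
  (c *m coef_mx E) ord0 j = (\sum_l c ord0 l *: E l)@_(nth 0%MM (monos N t) j).
Proof.
by rewrite !mxE raddf_sum /=; apply: eq_bigr => l _; rewrite !mxE mcoeffZ.
Qed.

Lemma homog_comb (k : comNzRingType) r (E : 'I_r -> {mpoly k[N]}) (c : 'I_r -> k) :
  (forall l, E l \is t.-homog) -> \sum_l c l *: E l \is t.-homog.
Proof. by move=> Et; apply: rpred_sum => l _; apply: dhomogZ. Qed.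

Lemma free_coef_mx (k : fieldType) r (E : 'I_r -> {mpoly k[N]}) :
  (forall l, E l \is t.-homog) -> free_mod [set 0] E <-> row_free (coef_mx E).
Proof.
move=> Et; rewrite -kermx_eq0; split=> [fE|/eqP ker0].
  apply/eqP/row_matrixP => i; rewrite row0; apply/rowP => l; rewrite [RHS]mxE.
  apply: (fE (fun l => row i (kermx (coef_mx E)) ord0 l)).
  apply: homog_coefs_eq0 => [|j]; first exact: homog_comb.
  by rewrite -coef_mx_comb -row_mul mulmx_ker !mxE.
move=> c /= c0 l.
have : (\row_l c l <= kermx (coef_mx E))%MS.
  apply/sub_kermxP/rowP => j; rewrite coef_mx_comb.
  under eq_bigr do rewrite mxE.
  by rewrite c0 mcoeff0 mxE.
by rewrite ker0 submx0 => /eqP/rowP/(_ l); rewrite !mxE.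
Qed.

End GradedCoordinates.

(** * Graded pieces of a family at two points *)

Section Lattices.
Variables (n : nat) (A : comNzRingType).
Local Notation N := n.+1.
Implicit Types (I : set {mpoly A[n.+1]}) (t : nat).

(** Images of the forms of degree t in [I] already span the degree t part of the extended ideal, so
    a basis can be chosen among them and lifted to [A]. *)
Lemma lattice (k : fieldType) (pi : {rmorphism A -> k}) I t : hideal I ->
  exists r (E : 'I_r -> {mpoly A[n.+1]}),
    [/\ forall l, I (E l) /\ E l \is t.-homog,
        free_mod [set 0] (map_mpoly pi \o E),
        forall g, g \is t.-homog -> base_change pi I g ->
          exists c : 'I_r -> k, g = \sum_l c l *: map_mpoly pi (E l)
      & (gf (base_change pi I) t + r)%N = size (monos N t)].
Proof.
move=> hI; have idB := base_change_ideal pi I; have idz := @ideal_zero {mpoly k[n.+1]}.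
have sz := ideal_subspace idz; have sB := ideal_subspace idB.
have sh := @homs_subspace n.+1 k t.
pose V := [set g | exists u, [/\ I u, u \is t.-homog & g = map_mpoly pi u]].
have [s [e se]] := finmod_homs t idz.
have Vh : V `<=` homs t by move=> _ [u [_ ut ->]]; apply: map_mpoly_homog.
have [r _ [b [Vb sb fb]]] := qdim_exists sz (span_modS Vh (@subset_refl _ _) se).
have /choice[E EP] := Vb.
have bE : map_mpoly pi \o E = b by apply/funext => l /=; case: (EP l) => _ _ ->.
have spanB g : g \is t.-homog -> base_change pi I g ->
    exists c : 'I_r -> k, g = \sum_l c l *: map_mpoly pi (E l).
  move=> gt [s' [a [w [Iw gE]]]].
  pose U := [set g | exists c : 'I_r -> k, g = \sum_l c l *: map_mpoly pi (E l)].
  have sU : subspace U.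
    split.
    - by exists (fun=> 0); rewrite big1 // => l _; rewrite scale0r.
    - move=> _ _ [c ->] [c' ->]; exists (fun l => c l + c' l).
      by rewrite -big_split; apply: eq_bigr => l _; rewrite scalerDl.
    - move=> z _ [c ->]; exists (fun l => z * c l).
      by rewrite scaler_sumr; apply: eq_bigr => l _; rewrite scalerA.
  suff : U g by [].
  have -> : g = hc t g by rewrite (pihomog_homog _ gt) eqxx.
  rewrite gE pihomog_sum; apply: subsp_sum => // i _.
  have [u Iu <-] := Iw i; rewrite [a i]mpolyE mulr_suml pihomog_sum.
  apply: subsp_sum => // m _; rewrite -scalerAl linearZ; apply: subspZ => //.
  rewrite -(map_mpolyXm pi) -rmorphM /= -map_mpoly_pihomog.
  have [|c] := sb (map_mpoly pi (hc t ('X_[m] * u))).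
    exists (hc t ('X_[m] * u)); split=> //; last exact: pihomogP.
    by apply: hI.2; apply: ideal_mull => //; apply: hI.1.
  by move=> /= /eqP; rewrite subr_eq0 => /eqP ->; exists c; rewrite -bE.
exists r, E; split=> //; last 1 first.
- rewrite -(gf_zero N k) /gf [RHS](qdimD sh sB sz) //; last exact: finmod_homs.
    congr addn; apply/esym/(qdim_eq sz); exists b; split=> //.
      move=> l; split; first exact/Vh/Vb.
      by have [u [Iu _ ->]] := Vb l; apply: base_change_mem.
    move=> g [gt gI]; have [c gE] := spanB g gt gI; exists c.
    by rewrite [X in X - _]gE -bE /= subrr.
  by move=> _ ->; apply: ideal0.
- by move=> l; have [? ? _] := EP l.
- by rewrite bE.
Qed.

Variables (F k : fieldType) (pi1 : {rmorphism A -> F}) (pi2 : {rmorphism A -> k}).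
Hypothesis ker_sub : forall a, pi1 a = 0 -> pi2 a = 0.

Lemma free_specialize t r (E : 'I_r -> {mpoly A[n.+1]}) : (forall l, E l \is t.-homog) ->
  free_mod [set 0] (map_mpoly pi2 \o E) -> free_mod [set 0] (map_mpoly pi1 \o E).
Proof.
move=> Et.
have mapE (L : fieldType) (pi : {rmorphism A -> L}) :
    coef_mx t (map_mpoly pi \o E) = map_mx pi (coef_mx t E).
  by apply/matrixP => l j; rewrite !mxE /= mcoeff_map.
rewrite !(free_coef_mx (t := t)) //; try by move=> l; apply: map_mpoly_homog.
rewrite !mapE /row_free => /eqP rk; rewrite eqn_leq rank_leq_row /= -[X in (X <= _)%N]rk.
exact: rank_semicontinuous.
Qed.

Lemma qdim_homsI (L : fieldType) (J : set {mpoly L[n.+1]}) t : is_ideal J ->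
  (gf J t + qdim (homs t `&` J) [set (0 : {mpoly L[n.+1]})%R])%N = size (monos N t).
Proof.
move=> idJ; have idz := @ideal_zero {mpoly L[n.+1]}.
rewrite -(gf_zero N L) /gf.
rewrite [RHS](qdimD (@homs_subspace _ _ t) (ideal_subspace idJ) (ideal_subspace idz)) //.
  by move=> _ ->; apply: ideal0.
exact: finmod_homs.
Qed.

Lemma finmod_homsI (L : fieldType) (J : set {mpoly L[n.+1]}) t :
  finmod (homs t `&` J) [set 0].
Proof.
by apply: finmodS (finmod_homs t (@ideal_zero {mpoly L[n.+1]})) => // x [].
Qed.

Lemma lattice_generic I t r (E : 'I_r -> {mpoly A[n.+1]}) :
  (forall l, I (E l) /\ E l \is t.-homog) -> free_mod [set 0] (map_mpoly pi1 \o E) ->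
  (r <= qdim (homs t `&` base_change pi1 I) [set (0 : {mpoly F[n.+1]})%R])%N.
Proof.
move=> EP fE; apply: qdim_ge_free fE; first exact/ideal_subspace/ideal_zero.
  exact: finmod_homsI.
move=> l; have [Il lt] := EP l; split; first exact: map_mpoly_homog.
exact: base_change_mem.
Qed.

(** A lattice chosen at [pi2] stays independent at [pi1], so the ideal is at least as large
    there. *)
Lemma gf_semicontinuous I t : hideal I ->
  (gf (base_change pi1 I) t <= gf (base_change pi2 I) t)%N.
Proof.
move=> hI; have [r [E [EP fE _ rE]]] := lattice pi2 t hI.
have := lattice_generic EP (free_specialize (fun l => (EP l).2) fE).
rewrite -(leq_add2l (gf (base_change pi1 I) t)) qdim_homsI; last exact: base_change_ideal.
by rewrite -rE leq_add2r.
Qed.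

Lemma lattice_generic_span I t r (E : 'I_r -> {mpoly A[n.+1]}) :
  (forall l, I (E l) /\ E l \is t.-homog) -> free_mod [set 0] (map_mpoly pi2 \o E) ->
  (gf (base_change pi1 I) t + r)%N = size (monos N t) ->
  forall g, g \is t.-homog -> base_change pi1 I g ->
    exists c : 'I_r -> F, g = \sum_l c l *: map_mpoly pi1 (E l).
Proof.
move=> EP fE rE g gt gI.
have idB := base_change_ideal pi1 I.
have rq : r = qdim (homs t `&` base_change pi1 I) [set 0].
  by apply/eqP; rewrite -(eqn_add2l (gf (base_change pi1 I) t)) rE qdim_homsI.
have fE1 := free_specialize (fun l => (EP l).2) fE.
subst r; have sz := ideal_subspace (@ideal_zero {mpoly F[n.+1]}).
have sV := subspI (@homs_subspace _ _ t) (ideal_subspace idB).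
have [|c] := free_qdim_span sV sz (finmod_homsI _ _) _ fE1 (conj gt gI).
  move=> l; have [Il lt] := EP l; split; first exact: map_mpoly_homog.
  exact: base_change_mem.
by move=> /= /eqP; rewrite subr_eq0 => /eqP; exists c.
Qed.

End Lattices.

(** * Generization *)

Section Lifting.
Variables (n : nat) (A : comNzRingType) (F k : fieldType).
Local Notation N := n.+1.
Variables (pi1 : {rmorphism A -> F}) (pi2 : {rmorphism A -> k}).
Hypothesis ker_sub : forall a, pi1 a = 0 -> pi2 a = 0.
Hypothesis frac2 : forall z, exists a s, pi2 s != 0 /\ pi2 s * z = pi2 a.
Variables (I : set {mpoly A[n.+1]}) (J : set {mpoly k[n.+1]}) (t0 : nat).
Hypotheses (hI : hideal I) (hJ : hideal J) (dJ : depth_ge J 2).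
Hypothesis IJ : base_change pi2 I `<=` J.
Hypothesis JI : forall t f, (t0 <= t)%N -> f \is t.-homog -> J f -> base_change pi2 I f.
Variable d : nat.

Local Notation m := (d + t0)%N.
Local Notation mon t j := ('X_[nth 0%MM (monos n.+1 t) j]).
Local Notation idx t := 'I_(size (monos n.+1 t)).

Variables (r : nat) (E : 'I_r -> {mpoly A[n.+1]}).
Hypothesis EP : forall l, I (E l) /\ E l \is m.-homog.
Hypothesis spanE : forall g, g \is m.-homog -> base_change pi2 I g ->
  exists c : 'I_r -> k, g = \sum_l c l *: map_mpoly pi2 (E l).

(** The first map of the complex. Its target is a sum of copies of the forms of degree m, one for
    each monomial x^a of degree t0. A form g of degree d goes to the family of products x^a g, and
    each [E l] can be put in any single coordinate; the kernel thus encodes forms g with all x^a g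
    in the span of the lattice. *)
Let Z (i : idx d + idx t0 * 'I_r) (a : idx t0) : {mpoly A[n.+1]} :=
  match i with
  | inl b => mon t0 a * mon d b
  | inr bl => if a == bl.1 then E bl.2 else 0
  end.

Let Z_homog i a : Z i a \is m.-homog.
Proof.
case: i => [b|[b l]] /=; last by case: ifP => _; [case: (EP l)|exact: dhomog0].
by rewrite mulrC dhomogM ?mono_homog.
Qed.

Let Z_sum (B : comNzRingType) (phi : {rmorphism A -> B}) (u : idx d + idx t0 * 'I_r -> B) a :
  \sum_i u i *: map_mpoly phi (Z i a) =
  mon t0 a * (\sum_b u (inl b) *: mon d b) + \sum_l u (inr (a, l)) *: map_mpoly phi (E l).
Proof.
rewrite big_sumType /=; congr (_ + _).
  rewrite mulr_sumr; apply: eq_bigr => b _.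
  by rewrite rmorphM /= !map_mpolyXm scalerAr.
pose G b l := u (inr (b, l)) *: map_mpoly phi (if a == b then E l else 0).
rewrite (eq_bigr (fun p => G p.1 p.2)); last by case.
rewrite -(pair_bigA _ G) /G /=.
rewrite (bigD1 a) //= [X in _ + X]big1 ?addr0.
  by apply: eq_bigr => l _; rewrite eqxx.
move=> b /negbTE ba; apply: big1 => l _.
by rewrite eq_sym ba rmorph0 scaler0.
Qed.

Variables (r' : nat) (E' : 'I_r' -> {mpoly A[n.+1]}).
Hypothesis EP' : forall l, I (E' l) /\ E' l \is (m + t0).-homog.
Hypothesis spanE' : forall g, g \is (m + t0).-homog -> base_change pi1 I g ->
  exists c : 'I_r' -> F, g = \sum_l c l *: map_mpoly pi1 (E' l).
Variable R : 'M[A]_(size (monos n.+1 (m + t0))).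
Hypothesis E'R : coef_mx (m + t0) E' *m R = 0.
Hypothesis kerR : forall y : 'rV_(size (monos n.+1 (m + t0))), y *m map_mx pi2 R = 0 ->
  (y <= map_mx pi2 (coef_mx (m + t0) E'))%MS.

Let syzygy (B : comNzRingType) (z : idx t0 -> {mpoly B[n.+1]}) (b c : idx t0) : {mpoly B[n.+1]} :=
  mon t0 c * z b - mon t0 b * z c.

Let point (aj : idx t0 * idx m) (a : idx t0) : {mpoly A[n.+1]} :=
  if a == aj.1 then mon m aj.2 else 0.

(** The second map: all syzygies x^c z_b - x^b z_c, reduced by [R] modulo the lattice [E']. It tests
    whether the fractions z_a / x^a are compatible. *)
Let Y (aj : idx t0 * idx m) (bcl : idx t0 * idx t0 * idx (m + t0)) : A :=
  \sum_(l < size (monos n.+1 (m + t0))) (syzygy (point aj) bcl.1.1 bcl.1.2)@_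
    (nth 0%MM (monos n.+1 (m + t0)) l) * R l bcl.2.

Let row (B : comNzRingType) (q : {mpoly B[n.+1]}) : 'rV_(size (monos n.+1 (m + t0))) :=
  coef_mx (m + t0) (fun _ : 'I_1 => q).

Let Y_sum (B : comNzRingType) (phi : {rmorphism A -> B})
    (z : idx t0 -> {mpoly B[n.+1]}) (bcl : idx t0 * idx t0 * idx (m + t0)) :
  (forall a, z a \is m.-homog) ->
  \sum_(aj : idx t0 * idx m) (z aj.1)@_(nth 0%MM (monos n.+1 m) aj.2) * phi (Y aj bcl) =
  (row (syzygy z bcl.1.1 bcl.1.2) *m map_mx phi R) ord0 bcl.2.
Proof.
move=> zh; rewrite mxE.
under eq_bigr do rewrite /Y rmorph_sum mulr_sumr /=.
rewrite exchange_big; apply: eq_bigr => l _; rewrite !mxE.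
under eq_bigr do rewrite rmorphM mulrA.
rewrite -mulr_suml; congr (_ * _).
have -> : syzygy z bcl.1.1 bcl.1.2 =
    \sum_(aj : idx t0 * idx m) (z aj.1)@_(nth 0%MM (monos n.+1 m) aj.2) *:
    map_mpoly phi (syzygy (point aj) bcl.1.1 bcl.1.2).
  have termE x p : x *: map_mpoly phi (syzygy (point p) bcl.1.1 bcl.1.2) =
      mon t0 bcl.1.2 * (x *: map_mpoly phi (point p bcl.1.1)) -
      mon t0 bcl.1.1 * (x *: map_mpoly phi (point p bcl.1.2)).
    by rewrite /syzygy rmorphB !rmorphM /= !map_mpolyXm scalerBr !scalerAr.
  rewrite (eq_bigr _ (fun aj _ => termE _ aj)) sumrB -!mulr_sumr.
  have sumz b : \sum_(aj : idx t0 * idx m) (z aj.1)@_(nth 0%MM (monos n.+1 m) aj.2) *: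
      map_mpoly phi (point aj b) = z b.
    rewrite -(pair_bigA _ (fun (a : idx t0) (j : idx m) =>
      (z a)@_(nth 0%MM (monos n.+1 m) j) *:
      map_mpoly phi (if b == a then mon m j else 0))) /= (bigD1 b) //= eqxx.
    rewrite [X in _ + X]big1 ?addr0.
      under eq_bigr do rewrite map_mpolyXm.
      exact: homog_coefsE.
    by move=> a /negbTE; rewrite eq_sym => ->; apply: big1 => j _; rewrite rmorph0 scaler0.
  by rewrite !sumz.
rewrite raddf_sum /=; apply: eq_bigr => aj _.
by rewrite mcoeffZ mcoeff_map.
Qed.

Let syzygy_homog (B : comNzRingType) (z : idx t0 -> {mpoly B[n.+1]}) b c :
  (forall a, z a \is m.-homog) -> syzygy z b c \is (m + t0).-homog.
Proof.
by move=> zh; rewrite rpredB // mulrC dhomogM ?mono_homog.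
Qed.

(** The complex condition at [pi1]: syzygies of a row of [Z] come from [I], hence lie in the span of
    [E'], which [R] kills. *)
Let row_mul_eq0 i b c :
  row (syzygy (fun a => map_mpoly pi1 (Z i a)) b c) *m map_mx pi1 R = 0.
Proof.
have zh a : map_mpoly pi1 (Z i a) \is m.-homog by apply: map_mpoly_homog.
have idI := hI.1; have idB := base_change_ideal pi1 I.
have [|u uE] := spanE' (syzygy_homog b c zh).
  have -> : syzygy (fun a => map_mpoly pi1 (Z i a)) b c = map_mpoly pi1 (syzygy (Z i) b c).
    by rewrite /syzygy rmorphB !rmorphM /= !map_mpolyXm.
  apply: base_change_mem; rewrite /syzygy; case: i {zh} => [b'|[b' l]] /=.
    by rewrite mulrCA subrr; apply: ideal0.
  have [El _] := EP l.
  by apply: (idealB idI); apply: (ideal_mull idI); case: ifP => _ //; apply: ideal0.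
have -> : row (syzygy (fun a => map_mpoly pi1 (Z i a)) b c) =
    (\row_l u l) *m map_mx pi1 (coef_mx (m + t0) E').
  apply/rowP => j; rewrite !mxE uE raddf_sum /=; apply: eq_bigr => l _.
  by rewrite !mxE mcoeffZ mcoeff_map.
by rewrite -mulmxA -map_mxM E'R map_mx0 mulmx0.
Qed.

(** Exactness in the middle at [pi2]. A family killed by [Y] is compatible modulo [J], so depth two
    yields w with z_a - x^a w in [J]; in degree m, which is at least t0, this difference is in the
    span of [E]. *)
Let syzygy_exact (z : idx t0 -> {mpoly k[n.+1]}) : (forall a, z a \is m.-homog) ->
  (forall b c, row (syzygy z b c) *m map_mx pi2 R = 0) ->
  exists u, forall a, z a = \sum_i u i *: map_mpoly pi2 (Z i a).
Proof.
move=> zh z0; have idB := base_change_ideal pi2 I.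
have Isyz b c : base_change pi2 I (syzygy z b c).
  have /submxP[u uE] := kerR (z0 b c).
  have -> : syzygy z b c = \sum_l u ord0 l *: map_mpoly pi2 (E' l).
    apply/eqP; rewrite -subr_eq0; apply/eqP.
    apply: (@homog_coefs_eq0 _ (m + t0)) => [|j].
      rewrite rpredB ?syzygy_homog //; apply: homog_comb => l.
      by apply: map_mpoly_homog; case: (EP' l).
    rewrite mcoeffB; have /rowP/(_ j) := uE; rewrite mxE [RHS]mxE => ->.
    rewrite raddf_sum /= -sumrB; apply: big1 => l _.
    by rewrite !mxE mcoeffZ mcoeff_map subrr.
  apply: ideal_sum => // l _; rewrite -mul_mpolyC; apply: ideal_mull => //.
  by apply: base_change_mem; case: (EP' l).
pose zz (a : 'X_{1..n.+1}) : {mpoly k[n.+1]} :=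
  if insub (index a (monos n.+1 t0)) is Some i then z i else 0.
have zzE (a : idx t0) : zz (nth 0%MM (monos n.+1 t0) a) = z a.
  rewrite /zz index_uniq ?monos_uniq ?ltn_ord // insubT ?ltn_ord // => h.
  by congr z; apply: val_inj.
have idxP a : mdeg a = t0 -> exists i : idx t0, a = nth 0%MM (monos n.+1 t0) i.
  move=> /eqP; rewrite -mem_monos => ma.
  have h : (index a (monos n.+1 t0) < size (monos n.+1 t0))%N by rewrite index_mem.
  by exists (Ordinal h); rewrite /= nth_index.
have [|w wP] := @depth_two_family _ _ J t0 zz hJ dJ.
  by move=> a b /idxP[i ->] /idxP[j ->]; rewrite !zzE; apply: IJ; apply: Isyz.
have {}wP a : exists c : 'I_r -> k,
    z a - mon t0 a * hc d w = \sum_l c l *: map_mpoly pi2 (E l).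
  have zw : z a - mon t0 a * hc d w \is m.-homog.
    by rewrite rpredB // mulrC dhomogM ?mono_homog //; apply: pihomogP.
  apply: spanE => //; apply: JI zw _; first exact: leq_addl.
  have := hJ.2 m _ (wP _ (mono_deg a)); rewrite zzE raddfB /= (pihomog_homog _ (zh a)) eqxx.
  by rewrite mulrC (pihomogM _ _ (mono_homog _ _)) mulrC.
have /choice[c cP] := wP.
exists (fun i : idx d + idx t0 * 'I_r => match i with
  inl b => (hc d w)@_(nth 0%MM (monos n.+1 d) b) | inr bl => c bl.1 bl.2 end).
move=> a; rewrite Z_sum homog_coefsE; last exact: pihomogP.
by rewrite -cP addrC subrK.
Qed.

Lemma lift_homog_lattices f : f \is d.-homog -> J f -> exists g s,
  [/\ g \is d.-homog, pi2 s != 0, map_mpoly pi2 g = pi2 s *: f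
    & saturation (base_change pi1 I) (map_mpoly pi1 g)].
Proof.
move=> fd Jf.
have /choice[c cP] : forall a : idx t0, exists c : 'I_r -> k,
    mon t0 a * f = \sum_l c l *: map_mpoly pi2 (E l).
  move=> a; have xf : mon t0 a * f \is m.-homog by rewrite mulrC dhomogM ?mono_homog.
  apply: spanE => //; apply: JI xf _; first exact: leq_addl.
  by apply: ideal_mull => //; apply: hJ.1.
(* Each x^a f has degree at least t0, hence is a combination [c a] of the lattice; f together with -
   c is a kernel vector at [pi2]. *)
pose v (i : idx d + idx t0 * 'I_r) := match i with
  inl b => f@_(nth 0%MM (monos n.+1 d) b) | inr bl => - c bl.1 bl.2 end.
pose Zc i (aj : idx t0 * idx m) := (Z i aj.1)@_(nth 0%MM (monos n.+1 m) aj.2).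
have Zc_sum (B : comNzRingType) (phi : {rmorphism A -> B}) u (aj : idx t0 * idx m) :
    \sum_i u i * phi (Zc i aj) =
    (\sum_i u i *: map_mpoly phi (Z i aj.1))@_(nth 0%MM (monos n.+1 m) aj.2).
  by rewrite raddf_sum /=; apply: eq_bigr => i _; rewrite mcoeffZ mcoeff_map.
have [|||w [s [s0 w0 wE]]] := @exact_kernel_lift_fun _ _ _ _ _ ker_sub frac2 _ _ _ Zc Y v.
- move=> i bcl.
  have zh a : map_mpoly pi1 (Z i a) \is m.-homog by apply: map_mpoly_homog.
  have := Y_sum pi1 bcl zh; rewrite row_mul_eq0 mxE => E0; rewrite -[RHS]E0.
  by apply: eq_bigr => aj _; rewrite mcoeff_map.
- move=> y y0.
  pose z (a : idx t0) : {mpoly k[n.+1]} := \sum_j y (a, j) *: mon m j.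
  have zh a : z a \is m.-homog by apply: homog_comb => j; apply: mono_homog.
  have zE (a : idx t0) (j : idx m) : (z a)@_(nth 0%MM (monos n.+1 m) j) = y (a, j).
    by rewrite /z mcoeff_monos_sum ?monos_uniq.
  have [|u uE] := syzygy_exact zh.
    move=> b c'; apply/rowP => l; rewrite [RHS]mxE -(y0 (b, c', l)).
    rewrite -(Y_sum pi2 (b, c', l) zh); apply: eq_bigr => -[a j] _.
    by rewrite zE.
  by exists u => -[a j]; rewrite Zc_sum -uE zE.
- move=> [a j]; rewrite Zc_sum Z_sum homog_coefsE //= cP -big_split big1 ?mcoeff0 // => l _.
  by rewrite /= scaleNr subrr.
exists (\sum_b w (inl b) *: mon d b), s; split=> //.
- by apply: homog_comb => b; apply: mono_homog.
- rewrite raddf_sum -[in RHS](homog_coefsE fd) scaler_sumr; apply: eq_bigr => b _.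
  by rewrite /= map_mpolyZ map_mpolyXm wE scalerA.
exists t0 => a /eqP; rewrite -mem_monos => ma.
have h : (index a (monos n.+1 t0) < size (monos n.+1 t0))%N by rewrite index_mem.
rewrite -(nth_index 0%MM ma) -/(nat_of_ord (Ordinal h)).
have : \sum_i pi1 (w i) *: map_mpoly pi1 (Z i (Ordinal h)) = 0.
  apply: (@homog_coefs_eq0 _ m) => [|j].
    by apply: rpred_sum => i _; apply/dhomogZ/map_mpoly_homog.
  by rewrite -(Zc_sum _ _ _ (Ordinal h, j)) w0.
rewrite Z_sum => /eqP; rewrite addr_eq0 => /eqP.
have -> : map_mpoly pi1 (\sum_b w (inl b) *: mon d b) = \sum_b pi1 (w (inl b)) *: mon d b.
  by rewrite raddf_sum; apply: eq_bigr => b _; rewrite /= map_mpolyZ map_mpolyXm.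
move=> ->; have idB := base_change_ideal pi1 I.
apply: (idealN idB); apply: (ideal_sum idB) => l _; rewrite -mul_mpolyC.
by apply: (ideal_mull idB); apply: base_change_mem; case: (EP l).
Qed.

End Lifting.

Section Generization.
Variable n : nat.

(** At most n forms in n + 1 variables leave depth at least one, so the ideal of [fs] is itself
    saturated and can be compared with the saturation in large degrees. *)
Lemma regular_ci_saturation (k : fieldType) (fs : seq {mpoly k[n.+1]}) I d0 :
  (forall f, f \in fs -> hpos f) -> regular_seq [set 0] fs -> (size fs <= n)%N ->
  hideal I -> (forall f, f \in fs -> saturation I f) ->
  (forall t, (d0 <= t)%N -> (gf (gens fs) t <= gf I t)%N) -> regular_ci (saturation I).
Proof.
move=> fsh fsr szn hI fsI le; exists fs; split=> //; apply/esym.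
apply: (saturation_eq_of_gf hI _ _ _ le).
- by apply: hideal_gens => f /fsh/hpos_homog.
- have [|ys [szy ysh]] := @regular_seq_depth _ _ fs 1 fsh fsr; first by rewrite addn1.
  case: ys szy ysh => [//|y ys] _ ysh [yr _].
  apply: irrelevant_free_regular yr; first exact: gens_ideal.
  exact/ysh/mem_head.
- by apply: gens_min => //; apply/saturation_ideal/hI.1.
Qed.

Variables (A : comNzRingType) (F k : fieldType).
Variables (pi1 : {rmorphism A -> F}) (pi2 : {rmorphism A -> k}).
Hypothesis ker_sub : forall a, pi1 a = 0 -> pi2 a = 0.
Hypothesis frac2 : forall z, exists a s, pi2 s != 0 /\ pi2 s * z = pi2 a.
Variable I : set {mpoly A[n.+1]}.
Hypothesis hI : hideal I.

Lemma lift_homog J t0 d f : hideal J -> depth_ge J 2 ->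
  base_change pi2 I `<=` J ->
  (forall t f, (t0 <= t)%N -> f \is t.-homog -> J f -> base_change pi2 I f) ->
  (forall t, (t0 <= t)%N -> gf (base_change pi1 I) t = gf (base_change pi2 I) t) ->
  f \is d.-homog -> J f -> exists g s,
  [/\ g \is d.-homog, pi2 s != 0, map_mpoly pi2 g = pi2 s *: f
    & saturation (base_change pi1 I) (map_mpoly pi1 g)].
Proof.
move=> hJ dJ IJ JI gfE fd Jf.
have [r [E [EP _ spanE _]]] := lattice pi2 (d + t0) hI.
have [r' [E' [EP' fE' _ rE']]] := lattice pi2 (d + t0 + t0) hI.
have spanE' := lattice_generic_span ker_sub EP' fE'.
rewrite gfE ?leq_addl // in spanE'.
have [|R [E'R kerR]] := @reduction_matrix _ _ pi2 _ _ (coef_mx (d + t0 + t0) E').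
  move: fE'; rewrite (free_coef_mx (t := d + t0 + t0)).
    by congr (is_true (row_free _)); apply/matrixP => l j; rewrite !mxE /= mcoeff_map.
  by move=> l; apply: map_mpoly_homog; case: (EP' l).
exact: (lift_homog_lattices ker_sub frac2 hI hJ dJ IJ JI EP spanE EP' (spanE' rE') E'R kerR).
Qed.

(* The generators of the saturated special fiber lift to the saturated general
   fiber because the former has depth two; comparing Hilbert functions shows that
   the lifts form a regular sequence and generate. *)
Lemma regular_ci_generization (p : {poly rat}) : (1 < size p)%N ->
  has_hilbert_poly (base_change pi1 I) p -> has_hilbert_poly (base_change pi2 I) p ->
  regular_ci (saturation (base_change pi2 I)) -> regular_ci (saturation (base_change pi1 I)).
Proof.
move=> p1; have hI1 := base_change_hideal pi1 hI; have hI2 := base_change_hideal pi2 hI.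
move=> /(has_hilbert_polyP _ hI1.1)[d1 p1E] /(has_hilbert_polyP _ hI2.1)[d2 p2E].
move=> [gs [gsh gsr JE]].
have [d3 d3P] := saturation_high hI2; have [d4 d4P] := gf_saturation hI2.
pose t0 := (d1 + d2 + d3 + d4)%N.
have le t : (t0 <= t)%N -> [/\ (d1 <= t)%N, (d2 <= t)%N, (d3 <= t)%N & (d4 <= t)%N].
  move=> tt; split; apply: leq_trans tt.
  - by rewrite /t0 -!addnA leq_addr.
  - by rewrite /t0 -!addnA addnCA leq_addr.
  - by rewrite /t0 addnAC leq_addl.
  - exact: leq_addl.
(* This is where nonconstancy of [p] enters: fewer than n forms leave depth two. *)
have szn : (size gs < n)%N.
  apply: (hilbert_poly_codim gsh gsr p1 (d0 := t0)) => t /le[_ ? _ ?].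
  by rewrite -JE d4P // p2E.
have gfE t : (t0 <= t)%N -> gf (base_change pi1 I) t = gf (base_change pi2 I) t.
  move=> /le[? ? _ _]; apply/eqP; rewrite -(Num.Theory.eqr_nat rat).
  by rewrite -p1E // p2E.
have /choice[es esP] : forall i, exists ds, (i < size gs)%N ->
    [/\ (0 < ds.1.1)%N, gs`_i \is ds.1.1.-homog, ds.1.2 \is ds.1.1.-homog, pi2 ds.2 != 0
      & map_mpoly pi2 ds.1.2 = pi2 ds.2 *: gs`_i /\
        saturation (base_change pi1 I) (map_mpoly pi1 ds.1.2)].
  move=> i; have [ilt|] := ltnP i (size gs); last by exists (0%N, 0, 0).
  have [d d0 gd] := gsh _ (mem_nth 0 ilt).
  have [|||||||g [s [gd' s0 gE gI]]] := @lift_homog (gens gs) t0 d gs`_i.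
  - by apply: hideal_gens => f /gsh/hpos_homog.
  - by apply: regular_seq_depth => //; rewrite addn2 ltnS.
  - by rewrite -JE; apply: saturation_sub.
  - by move=> t f /le[_ _ tt _] ft; rewrite -JE; apply: d3P tt ft.
  - exact: gfE.
  - exact: gd.
  - exact/gens_mem/mem_nth.
  by exists (d, g, s).
pose d i := (es i).1.1; pose hs := mkseq (fun i => (es i).1.2) (size gs).
have nthE (L : fieldType) (pi : {rmorphism A -> L}) i : (i < size gs)%N ->
    (map (map_mpoly pi) hs)`_i = map_mpoly pi (es i).1.2.
  by move=> ilt; rewrite (nth_map 0) ?size_mkseq // nth_mkseq.
have hsd (L : fieldType) (pi : {rmorphism A -> L}) i : (i < size gs)%N ->
    (map (map_mpoly pi) hs)`_i \is (d i).-homog.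
  by move=> ilt; rewrite nthE //; apply: map_mpoly_homog; case: (esP i ilt).
have szh (L : fieldType) (pi : {rmorphism A -> L}) : size (map (map_mpoly pi) hs) = size gs.
  by rewrite size_map size_mkseq.
have hsh (L : fieldType) (pi : {rmorphism A -> L}) f : f \in map (map_mpoly pi) hs -> hpos f.
  move=> /(nthP 0)[i + <-]; rewrite szh => ilt; exists (d i); last exact: hsd.
  by case: (esP i ilt).
have gensE : gens (map (map_mpoly pi2) hs) = gens gs.
  rewrite eqEsubset; split; apply: gens_min; try exact: gens_ideal.
    move=> _ /(nthP 0)[i + <-]; rewrite szh => ilt; rewrite nthE //.
    have [_ _ _ _ [-> _]] := esP i ilt; rewrite -mul_mpolyC.
    by apply: ideal_mull; [exact: gens_ideal|apply/gens_mem/mem_nth].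
  move=> _ /(nthP 0)[i ilt <-]; have [_ _ _ s0 [E _]] := esP i ilt.
  have -> : gs`_i = (pi2 (es i).2)^-1%:MP * (map (map_mpoly pi2) hs)`_i.
    by rewrite nthE // E mul_mpolyC scalerA mulVf ?scale1r.
  by apply: ideal_mull; [exact: gens_ideal|apply/gens_mem/mem_nth; rewrite szh].
(* The number of generators and the growth of the ideal decide regularity, so rescaling is
   harmless. *)
have hsr2 : regular_seq [set 0] (map (map_mpoly pi2) hs).
  apply: growth_regular_seq; first exact: hsh.
  by rewrite gensE szh; apply: regular_seq_growth.
have hhs : hideal (gens hs).
  apply: hideal_gens => _ /mapP[i + ->]; rewrite mem_iota => /esP[_ _ hd _ _].
  by exists (d i).
have gfle t : (gf (gens (map (map_mpoly pi1) hs)) t <= gf (gens (map (map_mpoly pi2) hs)) t)%N.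
  by rewrite -!base_change_gens; apply: gf_semicontinuous.
have d0 i : (i < size gs)%N -> (0 < d i)%N by move=> /esP[].
have hsr1 := hilbert_regular_seq d0 (szh _ pi1) (szh _ pi2) (hsd _ pi1) (hsd _ pi2) hsr2 gfle.
apply: (regular_ci_saturation (d0 := t0)) hsr1 _ hI1 _ _.
- exact: hsh.
- by rewrite szh ltnW.
- move=> _ /(nthP 0)[i + <-]; rewrite szh => ilt; rewrite nthE //.
  by have [_ _ _ _ []] := esP i ilt.
- move=> t tt.
  rewrite (hilbert_regular_gf d0 (szh _ pi1) (szh _ pi2) (hsd _ pi1) (hsd _ pi2) hsr2 gfle).
  by rewrite gensE -JE d4P ?gfE //; case: (le t tt).
Qed.

End Generization.

(** * Spreading out *)

Lemma fraction_denominator (R : idomainType) (z : {fraction R}) : exists x y,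
  y != 0 /\ FracField.tofrac y * z = FracField.tofrac x.
Proof.
elim/quotW: z => r; exists \n_r, \d_r; split; first exact: denom_ratioP.
unlock FracField.tofrac; rewrite -[LHS]FracField.pi_mul; apply/eqmodP => /=.
rewrite FracField.equivfE /FracField.mulf !numden_Ratio ?mulf_neq0 ?denom_ratioP ?oner_neq0 //.
by rewrite mulr1 mul1r.
Qed.

Section ResidueFields.
Variable A : comNzRingType.
Implicit Types (P Q : prime_idealr A).

Lemma residue_map_eq0 P a : (residue_map P a == 0) = (a \in P).
Proof.
rewrite /residue_map /= tofrac_eq0 -(rmorph0 (residue_proj P)) /residue_proj.
by rewrite -Quotient.idealrBE subr0.
Qed.

Lemma residue_frac P (z : residue_field P) : exists a s,
  residue_map P s != 0 /\ residue_map P s * z = residue_map P a.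
Proof.
have lift (x : residue_dom P) : exists a, x = residue_proj P a.
  by exists (repr x); rewrite /residue_proj reprK.
have [x [y [y0 E]]] := fraction_denominator z.
have [a aE] := lift x; have [s sE] := lift y.
by exists a, s; rewrite /residue_map /= -aE -sE tofrac_eq0.
Qed.

Lemma residue_map_sub P Q : [set` P] `<=` [set` Q] ->
  forall a, residue_map P a = 0 -> residue_map Q a = 0.
Proof.
move=> PQ a /eqP; rewrite residue_map_eq0 => /PQ aQ.
by apply/eqP; rewrite residue_map_eq0.
Qed.

End ResidueFields.

Section OpenNeighbourhood.
Variables (n : nat) (A : comNzRingType) (F : fieldType) (pi1 : {rmorphism A -> F}).
Hypothesis frac1 : forall z, exists a s, pi1 s != 0 /\ pi1 s * z = pi1 a.

Lemma clear_denominators_mpoly N (f : {mpoly F[N]}) : exists g s,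
  pi1 s != 0 /\ map_mpoly pi1 g = pi1 s *: f.
Proof.
rewrite [f]mpolyE; apply: (big_ind (fun f => exists g s,
  pi1 s != 0 /\ map_mpoly pi1 g = pi1 s *: f)).
- by exists 0, 1; rewrite rmorph1 oner_eq0 rmorph0 scaler0.
- move=> f1 f2 [g1 [s1 [s10 E1]]] [g2 [s2 [s20 E2]]].
  exists (s2 *: g1 + s1 *: g2), (s1 * s2); rewrite rmorphM mulf_neq0 //; split=> //.
  by rewrite rmorphD /= !map_mpolyZ E1 E2 !scalerA [pi1 s2 * _]mulrC scalerDr.
- move=> m _; have [a [s [s0 E]]] := frac1 f@_m.
  by exists (a *: 'X_[m]), s; rewrite map_mpolyZ map_mpolyXm -E scalerA.
Qed.

Lemma base_change_clear I f : is_ideal I -> base_change pi1 I f -> exists u a,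
  [/\ I u, pi1 a != 0 & map_mpoly (n := n.+1) pi1 u = pi1 a *: f].
Proof.
move=> idI; apply: (@base_change_min _ _ _ pi1 I [set f | exists u a,
  [/\ I u, pi1 a != 0 & map_mpoly pi1 u = pi1 a *: f]]); last first.
  by move=> u Iu; exists u, 1; rewrite rmorph1 oner_eq0 scale1r.
split.
- by exists 0, 1; rewrite rmorph1 oner_eq0 rmorph0 scaler0; split=> //; apply: ideal0.
- move=> f1 f2 [u1 [a1 [Iu1 a10 E1]]] [u2 [a2 [Iu2 a20 E2]]].
  exists (a2 *: u1 + a1 *: u2), (a1 * a2); rewrite rmorphM mulf_neq0 //; split=> //.
    by apply: idealD => //; rewrite -mul_mpolyC; apply: ideal_mull.
  by rewrite rmorphD /= !map_mpolyZ E1 E2 !scalerA [pi1 a2 * _]mulrC scalerDr.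
- move=> h f1 [u [a [Iu a0 E]]]; have [h' [s [s0 hE]]] := clear_denominators_mpoly h.
  exists (h' * u), (s * a); rewrite rmorphM mulf_neq0 //; split=> //.
    exact: ideal_mull.
  by rewrite rmorphM /= hE E -scalerAl -scalerAr scalerA.
Qed.

Section Transfer.
Variables (k : fieldType) (pi2 : {rmorphism A -> k}).
Hypothesis ker_sub : forall a, pi1 a = 0 -> pi2 a = 0.

Lemma map_mpoly_transfer N (f g : {mpoly A[N]}) :
  map_mpoly pi1 f = map_mpoly pi1 g -> map_mpoly pi2 f = map_mpoly pi2 g.
Proof.
move=> E; apply/mpolyP => m; rewrite !mcoeff_map; apply/eqP.
rewrite -subr_eq0 -rmorphB; apply/eqP/ker_sub.
by rewrite rmorphB -!mcoeff_map E subrr.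
Qed.

End Transfer.

(* After inverting finitely many elements, the generators and a standard basis
   of the fiber at [pi1] spread out, and the latter bounds the Hilbert functions. *)
Lemma regular_ci_open I (p : {poly rat}) : hideal I -> (1 < size p)%N ->
  has_hilbert_poly (base_change pi1 I) p -> regular_ci (saturation (base_change pi1 I)) ->
  exists g, pi1 g != 0 /\ forall (k : fieldType) (pi2 : {rmorphism A -> k}),
    (forall a, pi1 a = 0 -> pi2 a = 0) -> pi2 g != 0 ->
    has_hilbert_poly (base_change (n := n) pi2 I) p ->
    regular_ci (saturation (base_change pi2 I)).
Proof.
move=> hI p1 hp1 [fs [fsh fsr JE]]; have idI := hI.1.
have hI1 := base_change_hideal pi1 hI.
have /(has_hilbert_polyP _ hI1.1)[d1 p1E] := hp1.
have [d2 d2P] := gf_saturation hI1.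
have gf1 t : (maxn d1 d2 <= t)%N -> p.[t%:R] = (gf (gens fs) t)%:R.
  by rewrite geq_max => /andP[? ?]; rewrite -JE d2P // p1E.
have szn := hilbert_poly_codim fsh fsr p1 gf1.
have /choice[fd fdP] : forall i, exists fd, (i < size fs)%N ->
    [/\ (0 < fd.2)%N, fs`_i \is fd.2.-homog, fd.1 \is fd.2.-homog
      & exists2 s, pi1 s != 0 & map_mpoly pi1 fd.1 = pi1 s *: fs`_i].
  move=> i; have [ilt|] := ltnP i (size fs); last by exists (0, 0%N).
  have [d d0 fsd] := fsh _ (mem_nth 0 ilt).
  have [g [s [s0 gE]]] := clear_denominators_mpoly fs`_i.
  exists (hc d g, d) => _; split=> //; first exact: pihomogP.
  exists s => //=; rewrite map_mpoly_pihomog gE linearZ /=.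
  by rewrite (pihomog_homog _ fsd) eqxx.
pose hs := mkseq (fun i => (fd i).1) (size fs); pose d i := (fd i).2.
have d0 i : (i < size fs)%N -> (0 < d i)%N by move=> /fdP[].
have szh (L : fieldType) (pi : {rmorphism A -> L}) : size (map (map_mpoly pi) hs) = size fs.
  by rewrite size_map size_mkseq.
have nthE (L : fieldType) (pi : {rmorphism A -> L}) i : (i < size fs)%N ->
    (map (map_mpoly pi) hs)`_i = map_mpoly pi (fd i).1.
  by move=> ilt; rewrite (nth_map 0) ?size_mkseq // nth_mkseq.
have hsd (L : fieldType) (pi : {rmorphism A -> L}) i : (i < size fs)%N ->
    (map (map_mpoly pi) hs)`_i \is (d i).-homog.
  by move=> ilt; rewrite nthE //; apply: map_mpoly_homog; case: (fdP i ilt).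
have hsh (L : fieldType) (pi : {rmorphism A -> L}) f : f \in map (map_mpoly pi) hs -> hpos f.
  move=> /(nthP 0)[i + <-]; rewrite szh => ilt; exists (d i); last exact: hsd.
  exact: d0.
have gensE : gens (map (map_mpoly pi1) hs) = gens fs.
  rewrite eqEsubset; split; apply: gens_min; try exact: gens_ideal.
    move=> _ /(nthP 0)[i + <-]; rewrite szh => ilt; rewrite nthE //.
    have [_ _ _ [s _ ->]] := fdP i ilt; rewrite -mul_mpolyC.
    by apply: ideal_mull; [exact: gens_ideal|apply/gens_mem/mem_nth].
  move=> _ /(nthP 0)[i ilt <-]; have [_ _ _ [s s0 E]] := fdP i ilt.
  have -> : fs`_i = (pi1 s)^-1%:MP * (map (map_mpoly pi1) hs)`_i.
    by rewrite nthE // E mul_mpolyC scalerA mulVf ?scale1r.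
  by apply: ideal_mull; [exact: gens_ideal|apply/gens_mem/mem_nth; rewrite szh].
have hsr1 : regular_seq [set 0] (map (map_mpoly pi1) hs).
  apply: growth_regular_seq; first exact: hsh.
  by rewrite gensE szh; apply: regular_seq_growth.
have hsI i : (i < size fs)%N -> saturation (base_change pi1 I) (map_mpoly pi1 (fd i).1).
  move=> ilt; rewrite JE -gensE -nthE //.
  by apply/gens_mem/mem_nth; rewrite szh.
have /choice[e eP] : forall i, exists e, (i < size fs)%N ->
    mono_colon (base_change pi1 I) e (map_mpoly pi1 (fd i).1).
  by move=> i; have [/hsI[e eP]|_] := ltnP i (size fs); [exists e|exists 0%N].
have /choice[a aP] : forall im : nat * 'X_{1..n.+1}, exists a, pi1 a != 0 /\
    ((im.1 < size fs)%N -> mdeg im.2 = e im.1 ->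
     exists2 u, I u & map_mpoly pi1 u = map_mpoly pi1 (a *: ('X_[im.2] * (fd im.1).1))).
  move=> [i m]; have [ilt|_] := ltnP i (size fs); last by exists 1; rewrite rmorph1 oner_eq0.
  have [me|me] := eqVneq (mdeg m) (e i); last first.
    by exists 1; rewrite rmorph1 oner_eq0; split=> //= _ /eqP; rewrite (negbTE me).
  have [u [a [Iu a0 uE]]] := base_change_clear idI (eP i ilt m me).
  exists a; split=> // _ _; exists u => //.
  by rewrite uE /= map_mpolyZ rmorphM /= map_mpolyXm.
have [B [G sb]] := std_basis_exists (gens_ideal fs).
have hgens : is_ideal (gens hs) by apply: gens_ideal.
have /choice[c cP] : forall b, exists c, pi1 c != 0 /\ (b \in B ->
    exists2 u, gens hs u & map_mpoly pi1 u = pi1 c *: G b).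
  move=> b; have [bB|_] := boolP (b \in B); last by exists 1; rewrite rmorph1 oner_eq0.
  have := stdb_mem sb bB; rewrite -gensE -base_change_gens.
  by move=> /(base_change_clear hgens)[u [c [hu c0 uE]]]; exists c; split=> // _; exists u.
(* Inverting the factors [a] keeps the products of the i-th generator with all monomials of degree
   [e i] in the fiber ideal; inverting the factors [c] keeps the standard basis monic and inside the
   ideal of the generators. *)
exists (\prod_(i < size fs) \prod_(m <- monos n.+1 (e i)) a (val i, m) * \prod_(b <- B) c b).
split.
  rewrite rmorphM !rmorph_prod mulf_neq0 //; last first.
    by rewrite prodf_seq_neq0; apply/allP => b _; case: (cP b).
  apply/prodf_neq0 => i _; rewrite rmorph_prod prodf_seq_neq0; apply/allP => m _.
  by case: (aP (val i, m)).
move=> k pi2 ker_sub; rewrite rmorphM mulf_eq0 negb_or !rmorph_prod => /andP[a0 c0] hp2.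
have hI2 := base_change_hideal pi2 hI; have idI2 := hI2.1.
have /(has_hilbert_polyP _ idI2)[d3 p2E] := hp2.
have a2 i m : (i < size fs)%N -> mdeg m = e i -> pi2 (a (i, m)) != 0.
  move=> ilt me; have /prodf_neq0/(_ (Ordinal ilt) isT) := a0.
  rewrite rmorph_prod prodf_seq_neq0 => /allP/(_ m); apply.
  by rewrite mem_monos me.
have c2 b : b \in B -> pi2 (c b) != 0.
  by move=> bB; move: c0; rewrite prodf_seq_neq0 => /allP/(_ b bB).
have id2 := gens_ideal (map (map_mpoly pi2) hs).
have hh2 : hideal (gens (map (map_mpoly pi2) hs)).
  by apply: hideal_gens => f /hsh/hpos_homog.
have /choice[G' G'P] : forall b, exists g, b \in B ->
    [/\ gens (map (map_mpoly pi2) hs) g, g@_b = 1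
      & forall m, m \in msupp g -> (m <= b)%O].
  move=> b; have [bB|] := boolP (b \in B); last by exists 0.
  have [c10 /(_ bB)[u hu uE]] := cP b.
  have uc m : pi1 u@_m = pi1 (c b) * (G b)@_m by rewrite -mcoeff_map uE mcoeffZ.
  exists ((pi2 (c b))^-1 *: map_mpoly pi2 u) => _; split.
  - rewrite -mul_mpolyC; apply: ideal_mull => //; rewrite -base_change_gens.
    exact: base_change_mem.
  - rewrite mcoeffZ mcoeff_map; suff -> : pi2 u@_b = pi2 (c b) by rewrite mulVf ?c2.
    apply/eqP; rewrite -subr_eq0 -rmorphB; apply/eqP/ker_sub.
    by rewrite rmorphB uc (stdb_lead sb bB) mulr1 subrr.
  - move=> m; rewrite mcoeff_msupp mcoeffZ mcoeff_map => um; apply: (stdb_le sb bB).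
    rewrite mcoeff_msupp; apply: contraNneq um => Gm.
    by rewrite (ker_sub u@_m) ?mulr0 // uc Gm mulr0.
(* Division by the spread-out basis shows that the standard monomials still span at [pi2], which is
   the upper bound required. *)
have gfle t : (gf (gens (map (map_mpoly pi2) hs)) t <= gf (gens (map (map_mpoly pi1) hs)) t)%N.
  have hg : hideal (gens fs) by apply: hideal_gens => f /fsh/hpos_homog.
  rewrite gensE (gf_standard _ hg sb); apply: gf_standard_le => // f ft.
  have [r [Jr rt rP]] := division_homog id2 (fun b bB => let: And3 x _ _ := G'P b bB in x)
    (fun b bB => let: And3 _ x _ := G'P b bB in x)
    (fun b m bB => (let: And3 _ _ x := G'P b bB in x) m) hh2 ft.
  by exists r; split=> // m /rP/andP[].
have hsr2 := hilbert_regular_seq d0 (szh _ pi2) (szh _ pi1) (hsd _ pi2) (hsd _ pi1) hsr1 gfle.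
apply: (regular_ci_saturation (d0 := maxn (maxn d1 d2) d3)) hsr2 _ hI2 _ _.
- exact: hsh.
- by rewrite szh ltnW.
- move=> _ /(nthP 0)[i + <-]; rewrite szh => ilt; rewrite nthE //.
  exists (e i) => m me; have [_ /(_ ilt me)[u Iu /(map_mpoly_transfer ker_sub) uE]] := aP (i, m).
  have -> : 'X_[m] * map_mpoly pi2 (fd i).1 = (pi2 (a (i, m)))^-1%:MP * map_mpoly pi2 u.
    rewrite uE /= map_mpolyZ rmorphM /= map_mpolyXm mul_mpolyC scalerA mulVf ?scale1r //.
    exact: a2.
  by apply: ideal_mull => //; apply: base_change_mem.
- move=> t; rewrite geq_max => /andP[t12 t3].
  rewrite (hilbert_regular_gf d0 (szh _ pi2) (szh _ pi1) (hsd _ pi2) (hsd _ pi1) hsr1 gfle).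
  by rewrite gensE -(Num.Theory.ler_nat rat) -gf1 // p2E.
Qed.

End OpenNeighbourhood.

(** * Openness in the spectrum *)

Lemma noetherian_image (R B : comNzRingType) (phi : {rmorphism R -> B}) :
  noetherian R -> (forall b, exists a, b = phi a) -> noetherian B.
Proof.
move=> nR phi_surj J idJ.
have idJ' : is_ideal (phi @^-1` J).
  split=> /=; first by rewrite rmorph0; apply: ideal0.
    by move=> x y Jx Jy; rewrite rmorphD; apply: idealD.
  by move=> a x Jx; rewrite rmorphM; apply: ideal_mull.
have [fs fsE] := nR _ idJ'; exists (map phi fs).
rewrite eqEsubset; split; last first.
  apply: gens_min => // _ /mapP[f ffs ->].
  by have := gens_mem ffs; rewrite -fsE.
move=> b Jb; have [a bE] := phi_surj b; subst b.
have : (phi @^-1` J) a by [].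
rewrite fsE; apply: (@gens_min _ fs (phi @^-1` gens (map phi fs))).
  split=> /=; first by rewrite rmorph0; apply: ideal0; apply: gens_ideal.
    by move=> x y Jx Jy; rewrite rmorphD; apply: idealD => //; apply: gens_ideal.
  by move=> c x Jx; rewrite rmorphM; apply: ideal_mull => //; apply: gens_ideal.
by move=> f ffs /=; apply/gens_mem/map_f.
Qed.

Lemma fg_noetherian (K : fieldType) (A : fg_algebra K) : noetherian A.
Proof.
apply: (@noetherian_image _ (fg_ring A) (\pi_({ideal_quot (fg_relations A)})%qT)).
  exact: mpoly_noetherian.
by move=> b; exists (repr (b : {ideal_quot (fg_relations A)})); apply/esym/reprK.
Qed.

(* For [U] stable under generization and locally open in the closure of each of
   its points: if [P] lies in [U] and contains the ideal [aa] of functions vanishing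
   outside [U], a minimal prime [q] of [aa] below [P] is in [U], and [s * q] is in
   [aa] for some [s] not in [q]; then [s * g] vanishes outside [U], a contradiction. *)
Lemma Spec_open_criterion (A : comNzRingType) (U : set (Spec A)) : noetherian A ->
  (forall q Q : prime_idealr A, [set` q] `<=` [set` Q] -> U Q -> U q) ->
  (forall q : prime_idealr A, U q -> exists2 g, g \notin q &
    forall Q : prime_idealr A, [set` q] `<=` [set` Q] -> g \notin Q -> U Q) ->
  Spec_open U.
Proof.
move=> nA gen loc; pose aa := [set a | forall Q : prime_idealr A, ~ U Q -> a \in Q].
have idaa : is_ideal aa.
  split; first by move=> Q _; exact: idealr0.
    by move=> x y ax ay Q nQ; rewrite rpredD ?ax ?ay.
  by move=> a x ax Q nQ; apply: idealMr; apply: ax.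
exists aa; rewrite eqEsubset; split=> [P UP|P [a aaa aP]]; last first.
  by apply: contrapT => /aaa; rewrite (negbTE aP).
apply: contrapT => nP.
have aaP a : aa a -> a \in (P : prime_idealr A).
  by move=> aaa; apply: contrapT => /negP aP; apply: nP; exists a.
(* The minimal prime is obtained as the complement of a maximal multiplicative set that misses [aa]
   and contains the complement of [P]. *)
pose mult (M : set A) := [/\ M 1, forall x y, M x -> M y -> M (x * y) & forall x, aa x -> ~ M x].
have [||M [[M1 MM aM] PM Mmax]] := @Zorn_chains A mult [set a | a \notin (P : prime_idealr A)].
- split=> [|x y /= xP yP|x /aaP /= ->//] /=; first by rewrite idealr1.
  by rewrite prime_idealrM negb_or xP.
- move=> C [X0 CX0] Cm Ctot; split.
  + by exists X0 => //; case: (Cm _ CX0).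
  + move=> x y [X CX Xx] [Y CY Yy]; have [XY|YX] := Ctot _ _ CX CY.
      by exists Y => //; case: (Cm _ CY) => _ + _; apply => //; apply: XY.
    by exists X => //; case: (Cm _ CX) => _ + _; apply => //; apply: YX.
  + by move=> x ax [X CX Xx]; case: (Cm _ CX) => _ _ /(_ x ax).
have [q [aq qM]] := prime_avoiding idaa M1 MM aM.
have Mq x : M x <-> x \notin q.
  split=> [Mx|]; first by apply/negP => /qM.
  suff -> : M = [set x | x \notin q] by [].
  apply/esym/Mmax => [z Mz|]; first by apply/negP => /qM.
  split=> /=; first by rewrite idealr1.
    by move=> x' y xq yq; rewrite prime_idealrM negb_or xq.
  by move=> x' /aq /= ->.
have qP : [set` q] `<=` [set` (P : prime_idealr A)].
  by move=> x xq; apply: contrapT => /negP /PM /Mq; rewrite xq.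
have [g gq gU] := loc q (gen _ _ qP UP).
have power y : y \in q -> exists2 t, t \notin q & aa (t * y).
  move=> yq; have nMy : ~ M y by move/qM.
  suff [t [e [Mt at']]] : exists t e, M t /\ aa (t * y ^+ e).
    exists t; first exact/Mq.
    move=> Q nQ; have := at' Q nQ; rewrite !prime_idealrM => /orP[->//|yQ].
    apply/orP; right; elim: e yQ {at'} => [|e IH]; first by rewrite expr0 idealr1.
    by rewrite exprS prime_idealrM => /orP[].
  apply: contrapT => no; apply: nMy.
  suff <- : [set x | exists t e, M t /\ x = t * y ^+ e] = M.
    by exists 1, 1%N; rewrite mul1r.
  apply: Mmax => [x Mx|]; first by exists x, 0%N; rewrite mulr1.
  split=> /=; first by exists 1, 0%N; rewrite mulr1.
    move=> _ _ [t [e [Mt ->]]] [t' [e' [Mt' ->]]]; exists (t * t'), (e + e')%N.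
    by split; [apply: MM|rewrite exprD mulrACA].
  by move=> z az [t [e [Mt xE]]]; apply: no; exists t, e; rewrite -xE.
have [qI _ _] := prime_setP q; have [ys ysE] := nA _ qI.
have /choice[t tP] : forall y, exists t, t \notin q /\ (y \in q -> aa (t * y)).
  move=> y; have [yq|_] := boolP (y \in q); last by exists 1; rewrite idealr1.
  by have [t tq aty] := power y yq; exists t.
pose s := \prod_(y <- ys) t y.
have sq : s \notin q.
  rewrite /s; elim: (ys) => [|y zs IH]; first by rewrite big_nil idealr1.
  by rewrite big_cons prime_idealrM negb_or IH andbT; case: (tP y).
have sa y : y \in q -> aa (y * s).
  have : [set` q] `<=` colon aa s.
    rewrite ysE; apply: gens_min => [|z zys]; first exact: colon_ideal.
    rewrite /colon /= /s (big_rem z) //= mulrA; apply: (ideal_mulr idaa).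
    rewrite mulrC; apply: (tP z).2.
    by have := gens_mem zys; rewrite -ysE.
  by move=> h yq; apply: h.
have /aq : aa (s * g).
  move=> Q nQ; rewrite prime_idealrM; apply/orP.
  have [gQ|gQ] := boolP (g \in Q); [by right|left].
  apply: contrapT => sQ; apply/nQ/gU => // y yq.
  by have := sa y yq Q nQ; rewrite prime_idealrM => /orP[|/sQ].
by rewrite /= prime_idealrM (negbTE sq) (negbTE gq).
Qed.

(** * Flat families from monic standard bases *)

Section QuotientModule.
Variables (A : comNzRingType) (V : lmodType A) (W : set V).
Hypotheses (W0 : W 0) (WD : forall x y, W x -> W y -> W (x + y)).
Hypothesis WZ : forall a x, W x -> W (a *: x).

(** The closure proofs are arguments so that the equivalence and module structures can be attached
    to the quotient. *)
Definition qmod_rel of W 0 & (forall x y, W x -> W y -> W (x + y)) &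
  (forall a x, W x -> W (a *: x)) : rel V := fun x y => `[< W (x - y) >].
Local Notation rel := (qmod_rel W0 WD WZ).
Local Open Scope quotient_scope.

Lemma qmod_relP x y : reflect (W (x - y)) (rel x y).
Proof. exact: asboolP. Qed.

Let WN x : W x -> W (- x).
Proof. by move=> /(WZ (-1)); rewrite scaleN1r. Qed.

Lemma qmod_equiv : equiv_class_of rel.
Proof.
split=> [x|x y|y x z].
- by apply/qmod_relP; rewrite subrr.
- by apply/qmod_relP/qmod_relP => /WN; rewrite opprB.
- move=> /qmod_relP xy /qmod_relP yz; apply/qmod_relP.
  by have := WD xy yz; rewrite addrA subrK.
Qed.

Canonical qmod_equiv_rel := EquivRelPack qmod_equiv.

Definition qmod : Type := {eq_quot rel}.
HB.instance Definition _ := Choice.on qmod.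

Definition qmod_pi (x : V) : qmod := \pi_({eq_quot rel})%qT x.

Lemma qmod_piP x y : qmod_pi x = qmod_pi y <-> W (x - y).
Proof. by split=> [/eqmodP/qmod_relP|/qmod_relP/eqmodP]. Qed.

Lemma qmod_surj (z : qmod) : exists x, qmod_pi x = z.
Proof. by exists (repr (z : {eq_quot rel})); rewrite /qmod_pi reprK. Qed.

Let rp (z : qmod) : V := repr (z : {eq_quot rel}).

Let rpK z : qmod_pi (rp z) = z. Proof. by rewrite /qmod_pi reprK. Qed.

Definition qmod_add (x y : qmod) : qmod := qmod_pi (rp x + rp y).
Definition qmod_opp (x : qmod) : qmod := qmod_pi (- rp x).
Definition qmod_scale (a : A) (x : qmod) : qmod := qmod_pi (a *: rp x).

Let rp_pi x : W (rp (qmod_pi x) - x).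
Proof. by apply/qmod_piP; rewrite rpK. Qed.

Let addE x y : qmod_add (qmod_pi x) (qmod_pi y) = qmod_pi (x + y).
Proof.
by apply/qmod_piP; have := WD (rp_pi x) (rp_pi y); rewrite opprD addrACA.
Qed.

Let oppE x : qmod_opp (qmod_pi x) = qmod_pi (- x).
Proof. by apply/qmod_piP; rewrite -opprD; apply/WN/rp_pi. Qed.

Let scaleE a x : qmod_scale a (qmod_pi x) = qmod_pi (a *: x).
Proof. by apply/qmod_piP; rewrite -scalerBr; apply/WZ/rp_pi. Qed.

Let addA : associative qmod_add.
Proof.
move=> x y z; rewrite -(rpK x) -(rpK y) -(rpK z).
by rewrite !addE addrA.
Qed.

Let addC : commutative qmod_add.
Proof. by move=> x y; rewrite /qmod_add addrC. Qed.

Let add0 : left_id (qmod_pi 0) qmod_add.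
Proof. by move=> x; rewrite -(rpK x) addE add0r. Qed.

Let addN : left_inverse (qmod_pi 0) qmod_opp qmod_add.
Proof. by move=> x; rewrite -(rpK x) oppE addE addNr. Qed.

HB.instance Definition _ := GRing.isZmodule.Build qmod addA addC add0 addN.

Let scaleA a b (x : qmod) : qmod_scale a (qmod_scale b x) = qmod_scale (a * b) x.
Proof. by rewrite -(rpK x) !scaleE scalerA. Qed.

Let scale1 : left_id 1 qmod_scale.
Proof. by move=> x; rewrite -(rpK x) scaleE scale1r. Qed.

Let scaleDr : right_distributive qmod_scale +%R.
Proof.
move=> a x y; rewrite -(rpK x) -(rpK y).
by rewrite [_ + _]addE !scaleE [RHS]addE scalerDr.
Qed.

Let scaleDl (x : qmod) : {morph qmod_scale^~ x : a b / a + b}.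
Proof. by move=> a b; rewrite -(rpK x) !scaleE [RHS]addE scalerDl. Qed.

HB.instance Definition _ :=
  GRing.Zmodule_isLmodule.Build A qmod scaleA scale1 scaleDr scaleDl.

Lemma qmod_pi_linear : linear qmod_pi.
Proof.
by move=> a x y; rewrite -addE -scaleE.
Qed.

HB.instance Definition _ := GRing.isLinear.Build A V qmod _ qmod_pi qmod_pi_linear.

End QuotientModule.

Lemma quotient_module (A : comNzRingType) (V : lmodType A) (W : set V) :
  W 0 -> (forall x y, W x -> W y -> W (x + y)) -> (forall a x, W x -> W (a *: x)) ->
  exists (M : lmodType A) (q : {linear V -> M}),
    (forall z, exists x, q x = z) /\ forall x, q x = 0 <-> W x.
Proof.
move=> W0 WD WZ; exists (qmod W0 WD WZ), (@qmod_pi _ _ _ W0 WD WZ); split.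
  exact: qmod_surj.
move=> x; rewrite -(raddf0 (@qmod_pi _ _ _ W0 WD WZ)).
by rewrite [X in X <-> _]qmod_piP subr0.
Qed.

(** * Homogenization on an affine chart *)

Section Homogenization.
Variables (n : nat) (A : comNzRingType) (i : 'I_n.+1).
Implicit Types (I : set {mpoly A[n.+1]}) (f g : {mpoly A[n.+1]}) (t : nat).

(** The target degree t is fixed and higher components are dropped, which makes the operation linear
    in f. *)
Definition homogenize t f : {mpoly A[n.+1]} := \sum_(d < t.+1) 'X_i ^+ (t - d) * hc d f.

Lemma homogenizeD t f g : homogenize t (f + g) = homogenize t f + homogenize t g.
Proof. by rewrite -big_split; apply: eq_bigr => d _; rewrite raddfD mulrDr. Qed.

Lemma homogenizeZ t a f : homogenize t (a *: f) = a *: homogenize t f.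
Proof. by rewrite scaler_sumr; apply: eq_bigr => d _; rewrite linearZ scalerAr. Qed.

Lemma homogenize_chart I t f : (msize f <= t.+1)%N ->
  chart_ideal I i (f - homogenize t f).
Proof.
move=> ft; have idc : is_ideal (chart_ideal I i) by apply: ideal_gen_ideal.
rewrite {1}(pihomog_sumE ft) -sumrB; apply: (ideal_sum idc) => d _.
rewrite -{1}[hc d f]mul1r -mulrBl; apply: (ideal_mulr idc).
have X1 : chart_ideal I i ('X_i - 1) by apply: ideal_gen_sub; right.
rewrite -opprB; apply: (idealN idc).
elim: (t - d)%N => [|j IH]; first by rewrite expr0 subrr; apply: (ideal0 idc).
have -> : 'X_i ^+ j.+1 - 1 = 'X_i ^+ j * ('X_i - 1) + ('X_i ^+ j - 1) :> {mpoly A[n.+1]}.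
  by rewrite mulrBr mulr1 -exprSr addrA subrK.
by apply: (idealD idc) => //; apply: (ideal_mull idc).
Qed.

Lemma homogenize_mulX t f : (msize f <= t)%N -> homogenize t ('X_i * f) = homogenize t f.
Proof.
move=> ft; have Xh : 'X_i \is [in A[n.+1], 1.-homog] by rewrite dhomogX /= mdeg1.
rewrite /homogenize [LHS]big_ord_recl [RHS]big_ord_recr /=.
rewrite {1}['X_i * f]mulrC (pihomogM_lt _ Xh) // mulr0 add0r subnn expr0 mul1r.
have -> : hc t f = 0.
  apply/mpolyP => m; rewrite mcoeff_pihomog mcoeff0; case: eqP => // mt.
  by apply/memN_msupp_eq0/msize_mdeg_ge; rewrite mt.
rewrite addr0; apply: eq_bigr => d _; rewrite /bump /= add1n.
have -> : hc d.+1 ('X_i * f) = 'X_i * hc d f.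
  by rewrite mulrC -[d.+1](addn1 d) (pihomogM _ _ Xh) mulrC.
by rewrite mulrA -exprSr subnSK.
Qed.

(** In a fixed large degree, multiplication by X_i does not change the homogenization, so multiples
    of X_i - 1 homogenize to zero and only the part from [I] remains. *)
Lemma chart_homogenize I f : hideal I -> chart_ideal I i f ->
  exists t0, forall t, (t0 <= t)%N -> I (homogenize t f).
Proof.
move=> [idI hI].
have : chart_ideal I i `<=` add_gen I ('X_i - 1).
  apply: ideal_gen_min; first exact: add_gen_ideal.
  by move=> g [Ig|->]; [exact: add_gen_sub|exact: add_gen_mem].
move=> h /h[u [v [Iu ->]]]; exists (msize v) => t vt.
have -> : homogenize t (u + v * ('X_i - 1)) = homogenize t u.
  rewrite homogenizeD mulrBr mulr1 -scaleN1r homogenizeD homogenizeZ mulrC.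
  by rewrite homogenize_mulX // scaleN1r subrr addr0.
by apply: ideal_sum => // d _; apply: ideal_mull => //; apply: hI.
Qed.

End Homogenization.

(** * Families with a monic standard basis *)

Section MonicFamily.
Variables (n : nat) (A : comNzRingType) (I : set {mpoly A[n.+1]}).
Variables (B : seq 'X_{1..n.+1}) (G : 'X_{1..n.+1} -> {mpoly A[n.+1]}).
Hypothesis hI : hideal I.
Hypothesis IG : forall b, b \in B -> I (G b).
Hypothesis G1 : forall b, b \in B -> (G b)@_b = 1.
Hypothesis Gle : forall b m, b \in B -> m \in msupp (G b) -> (m <= b)%O.
Hypothesis indep : forall f, I f -> std_supp B f -> f = 0.
Implicit Types f g : {mpoly A[n.+1]}.

Lemma std_suppD (R : nzRingType) (f g : {mpoly R[n.+1]}) :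
  std_supp B f -> std_supp B g -> std_supp B (f + g).
Proof. by move=> fs gs m /msuppD_le; rewrite mem_cat => /orP[/fs|/gs]. Qed.

Lemma std_suppZ (R : nzRingType) a (f : {mpoly R[n.+1]}) :
  std_supp B f -> std_supp B (a *: f).
Proof. by move=> fs m /msuppZ_le /fs. Qed.

Lemma std_suppB (R : nzRingType) (f g : {mpoly R[n.+1]}) :
  std_supp B f -> std_supp B g -> std_supp B (f - g).
Proof. by move=> fs gs; rewrite -scaleN1r; apply/std_suppD/std_suppZ. Qed.

Lemma normal_form_exists : exists nf : {mpoly A[n.+1]} -> {mpoly A[n.+1]},
  [/\ forall f, I (f - nf f) /\ std_supp B (nf f),
      forall f g, nf (f + g) = nf f + nf g,
      forall a f, nf (a *: f) = a *: nf f,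
      forall f, I f -> nf f = 0 & forall f, std_supp B f -> nf f = f].
Proof.
have idI := hI.1.
have /choice[nf nfP] : forall f, exists r, I (f - r) /\ std_supp B r.
  move=> f; have [r [Ir rP]] := division idI IG G1 Gle f.
  by exists r; split=> // m /rP/andP[].
have uniq f r : I (f - r) -> std_supp B r -> nf f = r.
  move=> Ir rs; apply/eqP; rewrite -subr_eq0; apply/eqP/indep.
    by have := idealB idI Ir (nfP f).1; rewrite opprB addrC addrA subrK.
  by apply: std_suppB => //; case: (nfP f).
exists nf; split=> //.
- move=> f g; apply: uniq; last by apply: std_suppD; [case: (nfP f)|case: (nfP g)].
  by rewrite opprD addrACA; apply: idealD => //; [case: (nfP f)|case: (nfP g)].
- move=> a f; apply: uniq; last by apply: std_suppZ; case: (nfP f).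
  by rewrite -scalerBr -mul_mpolyC; apply: ideal_mull => //; case: (nfP f).
- by move=> f If; apply: uniq => [|m]; rewrite ?subr0 // msupp0.
- by move=> f fs; apply: uniq => //; rewrite subrr; apply: ideal0.
Qed.

(** The standard monomials stay independent in each fiber. A scalar multiple of a relation f lifts
    to u in [I]; its nonstandard part w maps to zero, and its standard part is minus the normal form
    of w, whose image vanishes too because normal forms are linear in the coefficients. *)
Lemma monic_fiber_gf (P : Spec A) t :
  gf (base_change (residue_map P) I) t = size [seq m <- monos n.+1 t | standard B m].
Proof.
set pi := residue_map P; have idI := hI.1; have idB := base_change_ideal pi I.
apply/eqP; rewrite eqn_leq; apply/andP; split.
  apply: gf_standard_le => // f ft.
  have bcG b : b \in B -> base_change pi I (map_mpoly pi (G b)).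
    by move=> bB; apply/base_change_mem/IG.
  have G1' b : b \in B -> (map_mpoly pi (G b))@_b = 1.
    by move=> bB; rewrite mcoeff_map G1 // rmorph1.
  have Gle' b m : b \in B -> m \in msupp (map_mpoly pi (G b)) -> (m <= b)%O.
    move=> bB; rewrite mcoeff_msupp mcoeff_map => mG; apply: Gle => //.
    by rewrite mcoeff_msupp; apply: contraNneq mG => ->; rewrite rmorph0.
  have [r [Jr rt rP]] := division_homog idB bcG G1' Gle' (base_change_hideal pi hI) ft.
  by exists r; split=> // m /rP /andP[].
apply: gf_standard_ge => // f If fs.
have [u [a [Iu a0 uE]]] := base_change_clear (@residue_frac _ P) idI If.
have [nf [_ nfD nfZ nf0 nfs]] := normal_form_exists.
have nf_sum (T : Type) (r : seq T) (Q : pred T) (F : T -> {mpoly A[n.+1]}) :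
    nf (\sum_(i <- r | Q i) F i) = \sum_(i <- r | Q i) nf (F i).
  by apply: big_morph => //; apply: nf0; apply: ideal0.
pose v := \sum_(m <- msupp u | standard B m) u@_m *: 'X_[m].
pose w := \sum_(m <- msupp u | ~~ standard B m) u@_m *: 'X_[m].
have uvw : u = v + w by rewrite [LHS]mpolyE (bigID (standard B)).
have vs : std_supp B v.
  move=> m /msupp_sum_le /flattenP[_ /mapP[m' + ->]]; rewrite mem_filter => /andP[m's _].
  by move=> /msuppZ_le; rewrite msuppX inE => /eqP->.
have piw : map_mpoly pi w = 0.
  rewrite rmorph_sum big1_seq // => m /andP[mns _] /=.
  rewrite map_mpolyZ -mcoeff_map uE mcoeffZ memN_msupp_eq0 ?mulr0 ?scale0r //.
  by apply: contra mns => /fs.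
have vE : v = - nf w.
  by apply/eqP; rewrite -addr_eq0 -{1}(nfs v vs) -nfD -uvw nf0.
have piv : map_mpoly pi v = 0.
  have nfw : nf w = \sum_(m <- msupp u | ~~ standard B m) u@_m *: nf 'X_[m].
    by rewrite [LHS]nf_sum; apply: eq_bigr => m _; apply: nfZ.
  suff nfw0 : map_mpoly pi (nf w) = 0 by rewrite vE rmorphN /= nfw0 oppr0.
  rewrite nfw; apply: (big_ind (fun z => map_mpoly pi z = 0)) => [|y z y0 z0|m mns].
  - exact: rmorph0.
  - by rewrite rmorphD /= y0 z0 addr0.
  rewrite map_mpolyZ -mcoeff_map uE mcoeffZ memN_msupp_eq0 ?mulr0 ?scale0r //.
  by apply: contra mns => /fs.
have : pi a *: f = 0 by rewrite -uE uvw rmorphD /= piv piw addr0.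
by move=> /eqP; rewrite scaler_eq0 (negbTE a0) => /eqP.
Qed.

(* The coefficients [c t Y m] of the normal form of the homogenization of [Y] in
   all large degrees [t] are coordinates of [Y] on the chart; they send a relation
   in the tensor product with [N'] to functions of [t] and [m], modulo those that
   vanish for large [t], and pull it back to [N]. *)
Lemma monic_flat : flat_subscheme I.
Proof.
move=> i; have idc : is_ideal (chart_ideal I i) by apply: ideal_gen_ideal.
have [||a x Ix|M [q [qs qP]]] := @quotient_module A {mpoly A[n.+1]} (chart_ideal I i).
- exact: ideal0.
- exact: idealD.
- by rewrite -mul_mpolyC; apply: ideal_mull.
exists M, q; split=> // N N' f finj r x y fxy P Bl Blu Blv.
have [nf [nfP nfD nfZ nf0 nfs]] := normal_form_exists.
pose c t Y m : A := (nf (homogenize i t Y))@_m.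
have cD t Y Y' m : c t (Y + Y') m = c t Y m + c t Y' m.
  by rewrite /c homogenizeD nfD mcoeffD.
have cZ t a Y m : c t (a *: Y) m = a * c t Y m.
  by rewrite /c homogenizeZ nfZ mcoeffZ.
have c0 Y : q Y = 0 -> exists t0, forall t m, (t0 <= t)%N -> c t Y m = 0.
  move=> /qP /(chart_homogenize hI)[t0 h]; exists t0 => t m tt.
  by rewrite /c nf0 ?mcoeff0 //; apply: h.
pose V := nat -> 'X_{1..n.+1} -> N'.
pose W (v : V) := exists t0, forall t m, (t0 <= t)%N -> v t m = 0.
have [||a v [t0 h]|P' [q' [qs' qP']]] := @quotient_module A V W.
- by exists 0%N.
- move=> u v [t0 h0] [t1 h1]; exists (maxn t0 t1) => t m; rewrite geq_max => /andP[tt0 tt1].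
  have -> : (u + v) t m = u t m + v t m by [].
  by rewrite h0 // h1 // addr0.
- exists t0 => t m tt; have -> : (a *: v) t m = a *: v t m by [].
  by rewrite h // scaler0.
have /choice[s sP] := qs.
(* Working modulo eventually vanishing functions makes this independent of the lift [s z], by [c0],
   hence bilinear. *)
pose Phi (u : N') (z : M) : P' := q' (fun t m => c t (s z) m *: u).
have PhiE u Y : Phi u (q Y) = q' (fun t m => c t Y m *: u).
  apply/eqP; rewrite -subr_eq0 -raddfB; apply/eqP/qP'.
  have [|t0 h] := c0 (s (q Y) - Y); first by rewrite raddfB /= sP subrr.
  exists t0 => t m tt.
  have -> : ((fun t m => c t (s (q Y)) m *: u) - (fun t m => c t Y m *: u) : V) t m =
    c t (s (q Y)) m *: u - c t Y m *: u by [].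
  rewrite -scalerBl.
  have := h t m tt; rewrite -scaleN1r cD cZ mulN1r => ->.
  by rewrite scale0r.
have /qP'[t0 t0P] : q' (\sum_(j < r) (fun t m => c t (s (y j)) m *: f (x j))) = 0.
  rewrite raddf_sum; apply: (fxy P' Phi) => [u a z z'|z a u u'].
    have [Z <-] := qs z; have [Z' <-] := qs z'.
    rewrite -linearP !PhiE -linearP; congr (q' _); apply/funext => t; apply/funext => m.
  have -> : (a *: (fun t m => c t Z m *: u) + (fun t m => c t Z' m *: u) : V) t m =
      a *: (c t Z m *: u) + c t Z' m *: u by [].
    by rewrite cD cZ scalerDl scalerA.
  rewrite /Phi -linearP; congr (q' _); apply/funext => t; apply/funext => m.
  have -> : (a *: (fun t m => c t (s z) m *: u) + (fun t m => c t (s z) m *: u') : V) t m =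
    a *: (c t (s z) m *: u) + c t (s z) m *: u' by [].
  rewrite scalerDr.
  by rewrite !scalerA mulrC.
(* Beyond [t0] the relation holds exactly; beyond the degrees of the lifts, no component is lost in
   homogenizing. *)
pose t := (t0 + \max_j msize (s (y j)))%N.
have xc m : \sum_(j < r) c t (s (y j)) m *: x j = 0.
  apply: finj; rewrite raddf0 raddf_sum -[RHS](t0P t m (leq_addr _ _)) !fct_sumE.
  by apply: eq_bigr => j _; apply: linearZZ.
pose ms := undup (flatten [seq msupp (nf (homogenize i t (s (y j)))) | j : 'I_r]).
have yE j : y j = \sum_(l < size ms) c t (s (y j)) (nth 0%MM ms l) *: q 'X_[nth 0%MM ms l].
  transitivity (q (nf (homogenize i t (s (y j))))).
    rewrite -{1}(sP (y j)); apply/eqP; rewrite -subr_eq0 -raddfB; apply/eqP/qP.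
    rewrite -[s (y j)](subrK (homogenize i t (s (y j)))) -addrA; apply: idealD => //.
      apply: homogenize_chart; rewrite leqW // (leq_trans _ (leq_addl _ _)) //.
      exact: (leq_bigmax (F := fun j => msize (s (y j)))).
    rewrite subrK; apply: ideal_gen_sub; left.
    by case: (nfP (homogenize i t (s (y j)))).
  rewrite [X in q X](@homog_monosE _ _ _ ms) => [||m mf].
  - by rewrite raddf_sum; apply: eq_bigr => l _; apply: linearZZ.
  - exact: undup_uniq.
  rewrite mem_undup; apply/flattenP; exists (msupp (nf (homogenize i t (s (y j))))) => //.
  by apply/mapP; exists j; rewrite ?mem_enum.
have lin_sum (U T : lmodType A) (h : U -> T) (J : Type) (us : seq J) a (u : J -> U) :
    linear h -> h (\sum_(j <- us) a j *: u j) = \sum_(j <- us) a j *: h (u j).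
  move=> hl; have hD v w : h (v + w) = h v + h w by rewrite -[v]scale1r hl !scale1r.
  have h0 : h 0 = 0 by apply: (addrI (h 0)); rewrite -hD !addr0.
  have hZ b v : h (b *: v) = b *: h v by rewrite -[_ *: v]addr0 hl h0 addr0.
  by rewrite (big_morph _ hD h0); apply: eq_bigr.
rewrite (eq_bigr (fun j => \sum_(l < size ms) c t (s (y j)) (nth 0%MM ms l) *:
  Bl (x j) (q 'X_[nth 0%MM ms l]))) => [|j _]; last by rewrite {1}yE lin_sum.
rewrite exchange_big big1 // => l _.
rewrite -(lin_sum _ _ (Bl^~ (q 'X_[nth 0%MM ms l]))) ?xc //.
(* The empty combination shows that a linear map sends 0 to 0. *)
by have := lin_sum _ _ _ nat [::] (fun=> 0) (fun=> 0) (Blv (q 'X_[nth 0%MM ms l]));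
  rewrite !big_nil.
Qed.

End MonicFamily.

(** * Points over their residue field *)

Section MkRmorphism.
Variables (R S : comNzRingType) (f : R -> S).
Hypotheses (fB : zmod_morphism f) (fM : monoid_morphism f).

Definition mk_rmorphism of zmod_morphism f & monoid_morphism f : R -> S := f.
Local Notation g := (mk_rmorphism fB fM).

HB.instance Definition _ := GRing.isZmodMorphism.Build R S g fB.
HB.instance Definition _ := GRing.isMonoidMorphism.Build R S g fM.

Lemma rmorphism_exists : exists h : {rmorphism R -> S}, forall x, h x = f x.
Proof. by exists g. Qed.

End MkRmorphism.

Lemma rmorphism_factor (k1 k2 L : fieldType) (f : {rmorphism k1 -> L}) (g : {rmorphism k2 -> L}) :
  (forall z, exists w, g w = f z) -> exists h : {rmorphism k1 -> k2}, forall z, g (h z) = f z.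
Proof.
move=> /choice[h hP]; have gI := fmorph_inj g.
have [||h' h'E] := @rmorphism_exists _ _ h.
- by move=> x y; apply: gI; rewrite rmorphB !hP rmorphB.
- by split=> [|x y]; apply: gI; rewrite ?rmorph1 ?rmorphM !hP ?rmorph1 ?rmorphM.
by exists h' => z; rewrite h'E.
Qed.

Lemma fraction_extend (A : comNzRingType) (F L : fieldType) (pi : {rmorphism A -> F})
    (psi : {rmorphism A -> L}) :
  (forall z, exists a s, pi s != 0 /\ pi s * z = pi a) ->
  (forall a, pi a = 0 <-> psi a = 0) ->
  exists h : {rmorphism F -> L}, forall a, h (pi a) = psi a.
Proof.
move=> frac ker; have psi0 s : pi s != 0 -> psi s != 0.
  by apply: contraNneq => /ker/eqP.
have psiE a b : pi a = pi b -> psi a = psi b.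
  move=> /eqP; rewrite -subr_eq0 -rmorphB => /eqP/ker/eqP.
  by rewrite rmorphB subr_eq0 => /eqP.
have /choice[as_ asP] : forall z, exists a, pi a.2 != 0 /\ pi a.2 * z = pi a.1.
  by move=> z; have [a [s sP]] := frac z; exists (a, s).
pose h z := psi (as_ z).1 / psi (as_ z).2.
have hE z a s : pi s != 0 -> pi s * z = pi a -> psi s * h z = psi a.
  move=> s0 sz; have [t0 tz] := asP z; apply: (mulfI (psi0 _ t0)).
  rewrite mulrCA [X in _ * X]mulrC /h divfK ?psi0 // -!rmorphM /=; apply: psiE; rewrite !rmorphM.
  by rewrite -tz -sz mulrCA.
have [||h' h'E] := @rmorphism_exists _ _ h.
- move=> x y; have [s0 sx] := asP x; have [t0 ty] := asP y.
  have st0 : pi ((as_ x).2 * (as_ y).2) != 0 by rewrite rmorphM mulf_neq0.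
  apply: (mulfI (psi0 _ st0)).
  rewrite (hE _ ((as_ y).2 * (as_ x).1 - (as_ x).2 * (as_ y).1)) //.
    rewrite rmorphB !rmorphM mulrBr; congr (_ - _).
      by rewrite -mulrA mulrCA (hE _ (as_ x).1).
    by rewrite -mulrA (hE _ (as_ y).1).
  rewrite rmorphB !rmorphM mulrBr -sx -ty; congr (_ - _); last by rewrite mulrA.
  by rewrite -mulrA mulrCA.
- split.
    by have := hE 1 1 1; rewrite !rmorph1 !mul1r; apply=> //; rewrite oner_eq0.
  move=> x y; have [s0 sx] := asP x; have [t0 ty] := asP y.
  have st0 : pi ((as_ x).2 * (as_ y).2) != 0 by rewrite rmorphM mulf_neq0.
  apply: (mulfI (psi0 _ st0)).
  rewrite (hE _ ((as_ x).1 * (as_ y).1)) //; last by rewrite !rmorphM -sx -ty mulrACA.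
  by rewrite !rmorphM mulrACA (hE _ (as_ x).1) // (hE _ (as_ y).1).
exists h' => a; rewrite h'E.
by have := hE (pi a) a 1; rewrite !rmorph1 !mul1r; apply=> //; rewrite oner_eq0.
Qed.

(** * The subalgebra generated by finitely many elements *)

Section FinitelyGeneratedSubalgebra.
Variables (K k : fieldType) (sigma : {rmorphism K -> k}) (cs : seq k).
Local Notation S := {mpoly K[size cs]}.

Definition eval_coefs (f : S) : k := mmap sigma (fun i => cs`_i) f.

Lemma eval_coefsM f g : eval_coefs (f * g) = eval_coefs f * eval_coefs g.
Proof. exact: rmorphM. Qed.

Lemma eval_coefs1 : eval_coefs 1 = 1.
Proof. exact: rmorph1. Qed.

Lemma eval_coefsB f g : eval_coefs (f - g) = eval_coefs f - eval_coefs g.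
Proof. exact: mmapB. Qed.

Definition eval_ker : pred S := fun f => eval_coefs f == 0.

Lemma eval_ker_zmod : zmod_closed eval_ker.
Proof.
split; first by apply/eqP/mmap0.
by move=> f g /eqP f0 /eqP g0; apply/eqP; rewrite eval_coefsB f0 g0 subrr.
Qed.

Lemma eval_ker_proper : ring_quotient.proper_ideal eval_ker.
Proof.
split; first by apply/negP => /eqP/eqP; rewrite eval_coefs1 oner_eq0.
by move=> a f /eqP f0; apply/eqP; rewrite eval_coefsM f0 mulr0.
Qed.

HB.instance Definition _ := GRing.isZmodClosed.Build S eval_ker eval_ker_zmod.
HB.instance Definition _ := isProperIdeal.Build S eval_ker eval_ker_proper.

Definition fg_subalgebra : fg_algebra K := FgAlgebra (eval_ker : idealr S).

(** The polynomial ring modulo the kernel of evaluation at [cs]. The last clause, an induction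
    principle, expresses that [cs] generates. *)
Lemma fg_subalgebra_exists : exists (A : fg_algebra K) (iota : {rmorphism A -> k}),
  [/\ injective iota, forall a, iota (fg_struct A a) = sigma a,
      forall c, c \in cs -> exists a, iota a = c
    & forall T : set A, (forall a, T (fg_struct A a)) ->
        (forall a b, T a -> T b -> T (a + b)) -> (forall a b, T a -> T b -> T (a * b)) ->
        (forall a, iota a \in cs -> T a) -> forall a, T a].
Proof.
pose A := fg_subalgebra.
pose pi (f : S) : A := \pi_({ideal_quot (fg_relations A)})%qT f.
pose rp (a : A) : S := repr (a : {ideal_quot (fg_relations A)}).
have rpK a : pi (rp a) = a by apply: reprK.
have piB f g : pi (f - g) = pi f - pi g by apply: rmorphB.
have piD f g : pi (f + g) = pi f + pi g by apply: rmorphD.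
have piM f g : pi (f * g) = pi f * pi g by apply: rmorphM.
have pi1 : pi 1 = 1 by apply: rmorph1.
have piE f g : pi f = pi g <-> eval_coefs f = eval_coefs g.
  have : (f - g \in fg_relations A) = (pi f == pi g) by apply: Quotient.idealrBE.
  have -> : (f - g \in fg_relations A) = (eval_coefs f == eval_coefs g).
    by rewrite -subr_eq0 -eval_coefsB.
  by move=> E; split=> /eqP h; apply/eqP; rewrite ?E // -E.
pose io a := eval_coefs (rp a).
have ioE f : io (pi f) = eval_coefs f by apply/piE; rewrite rpK.
have [||iota iE] := @rmorphism_exists A k io.
- by move=> x y; rewrite -(rpK x) -(rpK y) -piB !ioE eval_coefsB.
- split; first by rewrite -pi1 ioE eval_coefs1.
  by move=> x y; rewrite -(rpK x) -(rpK y) -piM !ioE eval_coefsM.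
have iX i : iota (pi 'X_i) = cs`_i by rewrite iE ioE /eval_coefs mmapX mmap1U.
have iC a : iota (pi a%:MP) = sigma a by rewrite iE ioE /eval_coefs mmapC.
exists A, iota; split.
- by move=> x y; rewrite !iE -(rpK x) -(rpK y) !ioE => /piE.
- exact: iC.
- move=> c ccs; have h : (index c cs < size cs)%N by rewrite index_mem.
  by exists (pi 'X_(Ordinal h)); rewrite iX /= nth_index.
- move=> T TK TD TM Tcs a; rewrite -(rpK a); elim/mpolyind: (rp a) => [|c m f _ _ IH].
    have -> : pi 0 = 0 by apply: rmorph0.
    by have := TK 0; rewrite rmorph0.
  rewrite piD; apply: TD => //; rewrite -mul_mpolyC piM; apply: (TM _ _); first exact: TK.
  rewrite mpolyXE_id; apply: (big_ind (fun f => T (pi f))) => [|f1 f2 T1 T2|i _].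
  - by have := TK 1; rewrite rmorph1 pi1.
  - by rewrite piM; apply: TM.
  - elim: (m i) => [|e IHe]; first by rewrite expr0 pi1; have := TK 1; rewrite rmorph1.
    rewrite exprS piM; apply: TM => //; apply: Tcs.
    by rewrite iX mem_nth.
Qed.

End FinitelyGeneratedSubalgebra.

(** [G b] and its component of degree [mdeg b] have the same coefficient at b, so their difference
    is an element of [J] with standard support, hence zero. *)
Lemma std_basis_homog N (k : fieldType) (J : set {mpoly k[N]}) B G b :
  hideal J -> std_basis J B G -> b \in B -> G b \is (mdeg b).-homog.
Proof.
move=> [idJ hJ] sb bB; suff <- : hc (mdeg b) (G b) = G b by apply: pihomogP.
apply/eqP; rewrite -subr_eq0; apply/eqP; apply: (stdb_indep sb).
  by apply: (idealB idJ); [apply/hJ/(stdb_mem sb)|apply: stdb_mem sb _ bB].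
apply: std_suppP => m mns; rewrite mcoeffB mcoeff_pihomog.
have [mb|mb] := eqVneq m b; first by rewrite mb eqxx subrr.
have : (G b)@_m = 0.
  have /memN_msupp_eq0 : m \notin msupp ('X_[b] - G b).
    by apply: contra mns; apply: stdb_tail sb _ bB _.
  by rewrite mcoeffB mcoeffX eq_sym (negbTE mb) sub0r => /eqP; rewrite oppr_eq0 => /eqP.
by move=> ->; rewrite if_same subrr.
Qed.

Lemma identity_rmorphism (k : fieldType) : exists i : {rmorphism k -> k}, forall a, i a = a.
Proof. by exists idfun. Qed.

Lemma base_change_identity n (k : fieldType) (i : {rmorphism k -> k})
    (I : set {mpoly k[n.+1]}) : (forall a, i a = a) -> is_ideal I -> base_change i I = I.
Proof.
move=> iE idI; have mapE (f : {mpoly k[n.+1]}) : map_mpoly i f = f.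
  by apply/mpolyP => m; rewrite mcoeff_map.
rewrite -[RHS](ideal_gen_id idI) /base_change; congr ideal_gen.
rewrite eqEsubset; split=> f.
  by move=> [g Ig <-]; rewrite mapE.
by move=> If; exists f.
Qed.

Section Representatives.
Variables (K : fieldType) (n : nat) (p : {poly rat}).
Implicit Types x y : field_point K n p.
Local Notation ideal_at x := (@pt_ideal K n p x).

Lemma pt_ideal_hideal x : hideal (ideal_at x).
Proof. exact/base_change_hideal/homogeneous_hideal/fam_homogeneous. Qed.

(* The coefficients of the reduced standard basis generate the smallest field of
   definition of the subscheme. *)
Definition canonical_point x (B : seq 'X_{1..n.+1}) : Prop :=
  exists G : 'X_{1..n.+1} -> {mpoly (pt_field x)[n.+1]},
  [/\ saturation (ideal_at x) = ideal_at x, std_basis (ideal_at x) B G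
    & forall T : set (pt_field x), (forall a, T (pt_struct x a)) ->
        (forall a b, T a -> T b -> T (a + b)) -> (forall a b, T a -> T b -> T (a * b)) ->
        (forall a, T a -> T a^-1) -> (forall b m, b \in B -> T (G b)@_m) -> forall a, T a].

(** The family lives over the subalgebra generated by the coefficients of the basis. This is a
    domain embedded in [k], and its zero prime is the point: the residue field is then the field
    generated by these coefficients. *)
Lemma canonical_point_exists (k : fieldType) (sigma : {rmorphism K -> k})
    (J : set {mpoly k[n.+1]}) : hideal J -> saturation J = J ->
  (exists d0, forall d, (d0 <= d)%N -> p.[d%:R] = (gf J d)%:R) ->
  exists x (h : {rmorphism pt_field x -> k}) B,
    [/\ forall a, h (pt_struct x a) = sigma a, base_change h (ideal_at x) = J
      & canonical_point x B].
Proof.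
move=> hJ satJ [d0 pE]; have idJ := hJ.1; have [B [G sb]] := std_basis_exists idJ.
pose cs := flatten [seq [seq (G b)@_m | m <- msupp (G b)] | b <- B].
have [A [iota [iI iK ics Agen]]] := fg_subalgebra_exists sigma cs.
have iota0 a : iota a = 0 -> a = 0 by move=> a0; apply: iI; rewrite rmorph0.
have csP b m : b \in B -> m \in msupp (G b) -> (G b)@_m \in cs.
  move=> bB mG; apply/flattenP; exists [seq (G b)@_m | m <- msupp (G b)].
    exact: (map_f (fun b => [seq (G b)@_m | m <- msupp (G b)])).
  exact: (map_f (fun m => (G b)@_m)).
have /choice[g gE] : forall b, exists g, b \in B -> map_mpoly iota g = G b.
  move=> b; have [bB|_] := boolP (b \in B); last by exists 0.
  have /choice[a aE] : forall m, exists a, m \in msupp (G b) -> iota a = (G b)@_m.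
    move=> m; have [mG|_] := boolP (m \in msupp (G b)); last by exists 0.
    by have [a aE] := ics _ (csP b m bB mG); exists a.
  exists (\sum_(m <- msupp (G b)) a m *: 'X_[m]) => _; rewrite [RHS]mpolyE rmorph_sum.
  by apply: eq_big_seq => m mG; rewrite /= map_mpolyZ map_mpolyXm aE.
have supp f m : m \in msupp f -> m \in msupp (map_mpoly (n := n.+1) iota f).
  by rewrite !mcoeff_msupp mcoeff_map; apply: contraNneq => /iota0 ->.
have inj0 (f : {mpoly A[n.+1]}) : map_mpoly iota f = 0 -> f = 0.
  move=> f0; apply/mpolyP => m; rewrite mcoeff0; apply: iota0.
  by rewrite -mcoeff_map f0 mcoeff0.
pose I := gens [seq g b | b <- B].
have gh f : f \in [seq g b | b <- B] -> exists d, f \is d.-homog.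
  move=> /mapP[b bB ->]; exists (mdeg b); apply/dhomogP => m /supp; rewrite gE // => mG.
  by have /dhomogP/(_ m mG) := std_basis_homog hJ sb bB.
have hI : hideal I by apply: hideal_gens.
have Ig b : b \in B -> I (g b) by move=> bB; apply/gens_mem/map_f.
have g1 b : b \in B -> (g b)@_b = 1.
  move=> bB; apply: iI; rewrite -mcoeff_map gE // (stdb_lead sb bB).
  by rewrite rmorph1.
have gle b m : b \in B -> m \in msupp (g b) -> (m <= b)%O.
  by move=> bB /supp; rewrite gE // => mG; apply: (stdb_le sb bB).
have IJ : base_change iota I = J.
  rewrite base_change_gens -map_comp (std_basis_gens idJ sb); congr gens.
  by apply/eq_in_map => b bB /=; apply: gE.
have indep f : I f -> std_supp B f -> f = 0.
  move=> If fs; apply/inj0/(stdb_indep sb); first by rewrite -IJ; apply: base_change_mem.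
  move=> m; rewrite mcoeff_msupp mcoeff_map => fm; apply: fs.
  by rewrite mcoeff_msupp; apply: contraNneq fm => ->; rewrite rmorph0.
have hom : homogeneous I by exists [set f | f \in [seq g b | b <- B]]; [exact: gh|exact: gens_genE].
have hilb (P : Spec A) : has_hilbert_poly (base_change (residue_map P) I) p.
  apply/(has_hilbert_polyP _ (base_change_ideal _ _)); exists d0 => d dd.
  by rewrite (monic_fiber_gf hI Ig g1 gle indep) -(gf_standard _ hJ sb) pE.
pose X := HilbFamily hom (monic_flat hI Ig g1 gle indep) hilb.
have p0 : prime_set [set (0 : A)].
  split; first exact: ideal_zero.
    by move=> /eqP; rewrite oner_eq0.
  move=> a b /(congr1 iota)/eqP; rewrite rmorphM rmorph0 mulf_eq0.
  by case/orP => /eqP/iota0; [left|right].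
pose P : Spec A := mk_prime p0.
have ker a : residue_map P a = 0 <-> iota a = 0.
  have -> : residue_map P a = 0 <-> a = 0.
    have : a \in mk_prime p0 <-> a = 0.
      have E := congr1 (fun T => T a) (mk_primeE p0).
      split=> [aP|a0]; first by have : [set` mk_prime p0] a by []; rewrite E.
      by have : [set (0 : A)] a by []; rewrite -E.
    by rewrite -residue_map_eq0 => <-; split=> [->|/eqP].
  by split=> [->|/iota0//]; rewrite rmorph0.
have [h hE] := fraction_extend (@residue_frac _ P) ker.
pose x := FieldPoint X P; exists x, h, B.
have hE' a : iota a = h (residue_map P a) by rewrite hE.
have bcJ : base_change h (ideal_at x) = J := etrans (base_change_compose I hE') IJ.
have hx := pt_ideal_hideal x.
split=> //; first by move=> a; rewrite /= hE iK.
exists (fun b => map_mpoly (residue_map P) (g b)).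
have mapE b : b \in B -> map_mpoly h (map_mpoly (residue_map P) (g b)) = G b.
  by move=> bB; rewrite -(gE b bB); apply: map_mpoly_compose.
have hsupp (f : {mpoly (pt_field x)[n.+1]}) m : m \in msupp f = (m \in msupp (map_mpoly h f)).
  by rewrite !mcoeff_msupp mcoeff_map fmorph_eq0.
split.
- apply: (@base_change_inj _ _ _ h); [exact/saturation_ideal/hx.1|exact: hx.1|].
  by rewrite -saturation_base_change ?bcJ //; apply: hx.1.
- split.
  + by move=> b bB; apply/base_change_mem/Ig.
  + by move=> b bB; rewrite mcoeff_map g1 // rmorph1.
  + by move=> b m bB; rewrite hsupp mapE //; apply: (stdb_le sb bB).
  + move=> b bB m; rewrite hsupp rmorphB /= map_mpolyXm mapE //.
    exact: (stdb_tail sb bB).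
  + move=> f If fs; have : map_mpoly h f = 0.
      apply: (stdb_indep sb); first by rewrite -bcJ; apply: base_change_mem.
      by move=> m; rewrite -hsupp; apply: fs.
    by move=> f0; apply/mpolyP => m; apply: (fmorph_inj h); rewrite -mcoeff_map f0 !mcoeff0 rmorph0.
move=> T TK TD TM TV Tg.
have TA a : T (residue_map P a).
  apply: (Agen [set a | T (residue_map P a)]) => {a} [a|a b|a b|a acs]; rewrite /mkset.
  - exact: TK.
  - by rewrite rmorphD => Ta Tb; apply: TD.
  - by rewrite rmorphM => Ta Tb; apply: (TM _ _).
  - have [_ /mapP[b bB ->] /mapP[m mG aE]] := flattenP acs.
    suff -> : a = (g b)@_m by rewrite -mcoeff_map; apply: Tg.
    by apply: iI; rewrite -mcoeff_map gE.
move=> z; have [a [s [s0 zE]]] := residue_frac z.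
have -> : z = residue_map P a * (residue_map P s)^-1 by rewrite -zE mulrC mulKf.
by apply: (TM _ _); [|apply: TV]; apply: TA.
Qed.

(** Over a common extension, uniqueness of the reduced basis places its coefficients in the image of
    the other field. They generate the field of [x], which therefore maps to that of [y]. *)
Lemma canonical_point_residue_field x B : canonical_point x B -> over_residue_field x.
Proof.
move=> [G [satx sb gen]] y [L [f [g [fgK same]]]].
have hx := pt_ideal_hideal x; have hy := pt_ideal_hideal y.
have idx := hx.1; have idsy := saturation_ideal hy.1.
pose JL := base_change f (ideal_at x).
have JLE : JL = base_change g (saturation (ideal_at y)).
  rewrite -saturation_base_change; last exact: hy.1.
  by rewrite -same saturation_base_change // satx.
have idJL : is_ideal JL by apply: base_change_ideal.
have indep F : JL F -> std_supp B F -> F = 0.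
  move=> /(base_changeP f F idx) JF Fs; apply/mpolyP => m; rewrite mcoeff0.
  apply/eqP; apply: contraT => /(functional_exists f)[l lm].
  have : apply_coefs l F = 0.
    apply: (stdb_indep sb); first exact: JF.
    apply: std_suppP => m' /(contra (Fs m')) /memN_msupp_eq0 Fm.
    by rewrite mcoeff_apply_coefs Fm functional0.
  move=> /mpolyP/(_ m); rewrite mcoeff_apply_coefs mcoeff0 lm => /eqP.
  by rewrite oner_eq0.
have [l l1] := retraction_exists g.
have lg c : l (g c) = c by rewrite -[g c]mulr1 functionalZ l1 mulr1.
(* Retracting the coefficients of F to the field of [y] gives another element of [JL]. Its
   difference from F has standard support, since the leading coefficients 1 cancel, so it
   vanishes. *)
have Gg b m : b \in B -> g (l (f (G b)@_m)) = f (G b)@_m.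
  move=> bB; pose F := map_mpoly f (G b).
  have JF : JL F by apply/base_change_mem/(stdb_mem sb).
  have : JL (map_mpoly g (apply_coefs l F)).
    rewrite JLE; apply: base_change_mem; move: JF; rewrite JLE.
    by move=> /(base_changeP g F idsy); apply.
  move=> /(idealB idJL) /(_ JF) /indep h.
  have /mpolyP/(_ m) : map_mpoly g (apply_coefs l F) - F = 0.
    apply: h; apply: std_suppP => m' m'ns.
    rewrite mcoeffB mcoeff_map mcoeff_apply_coefs mcoeff_map.
    have [-> | mb] := eqVneq m' b.
      by rewrite (stdb_lead sb bB) rmorph1 l1 rmorph1 subrr.
    have : (G b)@_m' = 0.
      have /memN_msupp_eq0 : m' \notin msupp ('X_[b] - G b).
        by apply: contra m'ns; apply: stdb_tail sb _ bB _.
      by rewrite mcoeffB mcoeffX eq_sym (negbTE mb) sub0r => /eqP; rewrite oppr_eq0 => /eqP.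
    by move=> ->; rewrite rmorph0 functional0 rmorph0 subrr.
  rewrite mcoeffB mcoeff_map mcoeff_apply_coefs mcoeff_map mcoeff0 => /eqP.
  by rewrite subr_eq0 => /eqP.
have [h hE] : exists h : {rmorphism pt_field x -> pt_field y}, forall z, g (h z) = f z.
  apply: rmorphism_factor; apply: gen.
  - by move=> a; exists (pt_struct y a); rewrite fgK.
  - by move=> a b [u uE] [v vE]; exists (u + v); rewrite !rmorphD uE vE.
  - by move=> a b [u uE] [v vE]; exists (u * v); rewrite !rmorphM uE vE.
  - by move=> a [u uE]; exists u^-1; rewrite !fmorphV uE.
  - by move=> b m bB; exists (l (f (G b)@_m)); apply: Gg.
exists h; split; first by move=> a; apply: (fmorph_inj g); rewrite hE fgK.
have idhx := base_change_ideal h (ideal_at x).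
apply: (base_change_inj (phi := g) (saturation_ideal idhx) idsy).
have ghf : base_change g (base_change h (ideal_at x)) = base_change f (ideal_at x).
  exact: base_change_compose (fun z => esym (hE z)).
have e1 := saturation_base_change g idhx; have e2 := saturation_base_change g hy.1.
have e0 := congr1 (@saturation n L) ghf.
exact: etrans (etrans (esym e1) e0) (etrans same e2).
Qed.

Lemma representative_exists x : exists x', equiv_points x x' /\ over_residue_field x'.
Proof.
have hx := pt_ideal_hideal x.
have hJ := saturation_hideal hx.
have [||x' [h [B [hK hJE can]]]] := canonical_point_exists (pt_struct x) hJ.
- exact/saturation_id/hx.1.
- have /(has_hilbert_polyP _ hx.1)[d1 pE] := fam_hilbert (pt_family x) (pt_prime x).
  have [d2 d2P] := gf_saturation hx; exists (maxn d1 d2) => d.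
  by rewrite geq_max => /andP[dd1 dd2]; rewrite d2P // pE.
exists x'; split; last exact: canonical_point_residue_field can.
have [i iE] := identity_rmorphism (pt_field x).
exists (pt_field x), i, h; split; first by move=> a; rewrite iE hK.
have bci := base_change_identity iE hx.1.
have e1 := congr1 (@saturation n (pt_field x)) bci.
have e2 := congr1 (@saturation n (pt_field x)) hJE.
have e3 := etrans e1 (esym (etrans e2 (saturation_id hx.1))).
exact e3.
Qed.

(** Equivalent representatives agree over a common extension, and the property is insensitive to
    extension; so it may be tested at [x] instead of a representative over the residue field. *)
Lemma strict_ci_locusP x :
  strict_ci_locus (hilb_point x) <-> strict_complete_intersection (ideal_at x).
Proof.
have sci y : equiv_points x y ->
    strict_complete_intersection (ideal_at x) <-> strict_complete_intersection (ideal_at y).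
  move=> [L [f [g [_ same]]]].
  rewrite -(strict_complete_intersection_base_change f (pt_ideal_hideal x)).
  rewrite -(strict_complete_intersection_base_change g (pt_ideal_hideal y)).
  by rewrite /strict_complete_intersection same.
split; first by move=> [y [xy _ yci]]; apply/(sci y).
move=> xci; have [y [xy yres]] := representative_exists x.
by exists y; split=> //; apply/(sci y).
Qed.

End Representatives.

Theorem corollary6p18 (K : fieldType) (n : nat) (p : {poly rat})
    (hp : hilbert_polynomial K p) (p_nonconst : (1 < size p)%N) :
  open (@strict_ci_locus K n p).
Proof.
move=> A X; have hX := homogeneous_hideal (fam_homogeneous X).
have ciP (P : Spec A) : (classify X @^-1` @strict_ci_locus K n p) P <->
    regular_ci (saturation (base_change (residue_map P) (fam_ideal X))).
  rewrite -strict_complete_intersectionP; last exact: base_change_hideal.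
  exact: (strict_ci_locusP (FieldPoint X P)).
apply: Spec_open_criterion; first exact: fg_noetherian.
  move=> q Q qQ /ciP Qci; apply/ciP.
  apply: (regular_ci_generization (residue_map_sub qQ) (@residue_frac _ Q) hX p_nonconst) Qci.
    exact: fam_hilbert.
  exact: fam_hilbert.
move=> q /ciP qci.
have [g [gq gP]] := regular_ci_open (@residue_frac _ q) hX p_nonconst (fam_hilbert X q) qci.
exists g; first by rewrite -residue_map_eq0.
move=> Q qQ gQ; apply/ciP; apply: gP.
- exact: residue_map_sub.
- by rewrite residue_map_eq0.
- exact: fam_hilbert.
Qed.
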